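(* Let $X$ and $Y$ be uniformly locally finite metric spaces, and let $\Phi\colon C_u^*(X)\to C_u^*(Y)$ be an injective $*$-homomorphism whose range is a hereditary $C^*$-subalgebra of $C_u^*(Y)$. Suppose that every sparse subspace $Z\subseteq Y$ yields only compact ghost projections. Then there exists an injective coarse embedding $f\colon X\to Y$.
   Context: A metric space $(Z,d)$ is uniformly locally finite if $\sup_{z\in Z}|B(z,r)|<\infty$ for every $r\ge 0$. For $a\in B(\ell^2(Z))$, the propagation is $\operatorname{prop}(a)=\sup\{d(z,w):\langle a\delta_w,\delta_z\rangle\ne 0\}$ (possibly infinite). The uniform Roe algebra $C_u^*(Z)$ is the operator-norm closure in $B(\ell^2(Z))$ of the operators of finite propagation. A $C^*$-subalgebra $B$ of a $C^*$-algebra $A$ is hereditary if $0\le a\le b$ with $a\in A$, $b\in B$ implies $a\in B$. A metric space $Z$ is sparse if there is a partition $Z=\bigsqcup_{n\in\mathbb N}Z_n$ into finite nonempty sets such that $d(Z_n,Z_m)\to\infty$ as $n+m\to\infty$ with $n\ne m$; here $d(Z_n,Z_m)=\inf\{d(z,w):z\in Z_n,w\in Z_m\}$. A subset of a metric space is sparse if it is sparse for the restricted metric. An operator $T\in C_u^*(Z)$ is a ghost if for every $\varepsilon>0$ there is a finite $F\subseteq Z$ with $|\langle T\delta_z,\delta_w\rangle|<\varepsilon$ for all $z,w\in Z\setminus F$. A ghost projection is a ghost that is a projection. The space $Z$ yields only compact ghost projections if every ghost projection in $C_u^*(Z)$ is compact. A map $f\colon X\to Y$ between metric spaces is a coarse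 embedding if there are nondecreasing functions $\rho_-,\rho_+\colon[0,\infty)\to[0,\infty)$ with $\rho_-(t)\to\infty$ as $t\to\infty$ such that $\rho_-(d_X(x,x'))\le d_Y(f(x),f(x'))\le\rho_+(d_X(x,x'))$ for all $x,x'\in X$. *)

(* Defs.v *)
From HB Require Import structures.
From mathcomp Require Import all_boot all_order all_algebra.
From mathcomp Require Import complex.
From mathcomp Require Import all_classical all_reals all_analysis.
From mathcomp Require Import ring.

Set Implicit Arguments.
Unset Strict Implicit.
Unset Printing Implicit Defensive.

Import Order.TTheory GRing.Theory Num.Theory.
Import numFieldNormedType.Exports.

Local Open Scope classical_set_scope.
Local Open Scope ring_scope.
Local Open Scope complex_scope.

Local Notation Re := complex.Re.
Local Notation Im := complex.Im.

Section Ell2Vectors.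
Context {R : realType} {Z : choiceType}.
Implicit Types (x y : Z -> R[i]).

Definition abs2 (c : R[i]) : R := Re c ^+ 2 + Im c ^+ 2.

Lemma abs2_ge0 c : 0 <= abs2 c.
Proof. by rewrite /abs2 addr_ge0 ?sqr_ge0. Qed.

Lemma abs2M a c : abs2 (a * c) = abs2 a * abs2 c.
Proof. by case: a c => [a b] [c d]; rewrite /abs2 /=; ring. Qed.

Lemma abs2_eq0 c : abs2 c = 0 -> c = 0.
Proof.
case: c => a b; rewrite /abs2 /= => /eqP.
by rewrite paddr_eq0 ?sqr_ge0// !sqrf_eq0 => /andP[/eqP-> /eqP->].
Qed.

Lemma abs2D (t : R) c d : 0 < t ->
  abs2 (c + d) <= (1 + t) * abs2 c + (1 + t^-1) * abs2 d.
Proof.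
move=> t0; case: c d => [a b] [c d]; rewrite /abs2 /= -subr_ge0.
have -> : (1 + t) * (a ^+ 2 + b ^+ 2) + (1 + t^-1) * (c ^+ 2 + d ^+ 2) -
   ((a + c) ^+ 2 + (b + d) ^+ 2) =
   t^-1 * ((t * a - c) ^+ 2 + (t * b - d) ^+ 2).
  by field; rewrite gt_eqF.
by apply: mulr_ge0; [rewrite invr_ge0 ltW|rewrite addr_ge0 ?sqr_ge0].
Qed.

Definition l2sum x : \bar R := (\esum_(z in [set: Z]) (abs2 (x z))%:E)%E.

Lemma l2sum_ge0 x : (0 <= l2sum x)%E.
Proof. by apply: esum_ge0 => z _; rewrite lee_fin abs2_ge0. Qed.

Lemma esumZ_le (k : R) (f : Z -> R) : 0 <= k -> (forall z, 0 <= f z) ->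
  (\esum_(z in [set: Z]) (k * f z)%:E <= k%:E * \esum_(z in [set: Z]) (f z)%:E)%E.
Proof.
move=> k0 f0; apply: ge_ereal_sup => _ [F FS <-].
under eq_fsbigr do rewrite EFinM.
rewrite -ge0_mule_fsumr; last by move=> z; rewrite lee_fin.
by apply: lee_wpmul2l; [rewrite lee_fin|apply: esum_ge; exists F].
Qed.

Lemma l2sumZ_le a x : (l2sum (a *: x) <= (abs2 a)%:E * l2sum x)%E.
Proof.
apply: le_trans (esumZ_le (abs2_ge0 a) (fun z => abs2_ge0 (x z))).
by apply: le_esum => z _; rewrite lee_fin /= -abs2M.
Qed.

Lemma l2sumD_le (t : R) x y : 0 < t ->
  (l2sum (x + y)%R <= (1 + t)%R%:E * l2sum x + (1 + t^-1)%R%:E * l2sum y)%E.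
Proof.
move=> t0; have t1 : 0 <= 1 + t by rewrite addr_ge0// ltW.
have t2 : 0 <= 1 + t^-1 by rewrite addr_ge0// invr_ge0 ltW.
apply: le_trans (leeD (esumZ_le t1 (fun z => abs2_ge0 (x z)))
                      (esumZ_le t2 (fun z => abs2_ge0 (y z)))).
rewrite -esumD; do ?by move=> z _; rewrite lee_fin mulr_ge0// abs2_ge0.
by apply: le_esum => z _; rewrite -EFinD lee_fin abs2D.
Qed.

Definition square_summable : {pred Z -> R[i]} := fun x => (l2sum x < +oo)%E.

Lemma square_summable_submod : submod_closed square_summable.
Proof.
split=> [|a x y]; rewrite !unfold_in.
  rewrite /l2sum esum1 ?ltry// => z _.
  by rewrite /abs2 /= expr0n addr0.
move=> fx fy; apply: le_lt_trans (l2sumD_le _ _ ltr01) _.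
apply: lte_add_pinfty; apply: lte_mul_pinfty => //.
- by apply: le_lt_trans (l2sumZ_le _ _) _; apply: lte_mul_pinfty; rewrite ?lee_fin ?abs2_ge0.
Qed.

HB.instance Definition _ :=
  GRing.isSubmodClosed.Build _ _ square_summable square_summable_submod.

End Ell2Vectors.

Section Ell2.
Context (R : realType) (Z : choiceType).

Record ell2 := Ell2 {
  ell2_fun :> Z -> R[i];
  _ : ell2_fun \in square_summable }.

HB.instance Definition _ := [isSub for ell2_fun].
HB.instance Definition _ := [Choice of ell2 by <:].
HB.instance Definition _ := [SubChoice_isSubLmodule of ell2 by <:].

Implicit Types x y : ell2.

Lemma ell2P x y : (forall z, x z = y z) -> x = y.
Proof. by move=> xy; apply/val_inj/funext. Qed.

Definition l2norm x : R := Num.sqrt (fine (l2sum x)).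

Lemma l2sum_fin x : (l2sum x = (fine (l2sum x))%:E)%E.
Proof.
rewrite fineK// ge0_fin_numE ?l2sum_ge0//.
by have := valP x; rewrite unfold_in.
Qed.

Lemma l2normE x : l2sum x = (l2norm x ^+ 2)%:E.
Proof. by rewrite sqr_sqrtr ?fine_ge0 ?l2sum_ge0// -l2sum_fin. Qed.

Lemma l2norm_ge0 x : 0 <= l2norm x. Proof. exact: sqrtr_ge0. Qed.

Lemma l2norm0_eq0 x : l2norm x = 0 -> x = 0.
Proof.
move=> x0; apply: ell2P => z; apply: abs2_eq0; apply/eqP.
rewrite eq_le abs2_ge0 andbT -lee_fin.
have -> : 0%:E = l2sum x by rewrite l2normE x0 expr0n.
apply: esum_ge; exists [set z]; last by rewrite fsbig_set1.
by split => //; exact: finite_set1.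
Qed.

Lemma l2normD x y : l2norm (x + y) <= l2norm x + l2norm y.
Proof.
have [/l2norm0_eq0->|x0] := eqVneq (l2norm x) 0.
  by rewrite add0r lerDr l2norm_ge0.
have [/l2norm0_eq0->|y0] := eqVneq (l2norm y) 0.
  by rewrite addr0 lerDl l2norm_ge0.
have {}x0 : 0 < l2norm x by rewrite lt_neqAle eq_sym x0 l2norm_ge0.
have {}y0 : 0 < l2norm y by rewrite lt_neqAle eq_sym y0 l2norm_ge0.
have t0 : 0 < l2norm y / l2norm x by rewrite divr_gt0.
have : (l2sum (x + y : ell2)%R <=
  (1 + l2norm y / l2norm x)%R%:E * l2sum x +
  (1 + (l2norm y / l2norm x)^-1)%R%:E * l2sum y)%E by exact: l2sumD_le.
rewrite !l2normE -!EFinM -EFinD lee_fin => le.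
rewrite -ler_sqr ?nnegrE ?addr_ge0 ?l2norm_ge0//.
apply: le_trans le _; rewrite le_eqVlt; apply/orP; left; apply/eqP.
by field; rewrite !gt_eqF.
Qed.

Lemma l2normZ_le (a : R[i]) x : l2norm (a *: x) <= Num.sqrt (abs2 a) * l2norm x.
Proof.
rewrite -ler_sqr ?nnegrE ?mulr_ge0 ?sqrtr_ge0// exprMn.
rewrite [X in _ <= X * _]sqr_sqrtr ?abs2_ge0//.
have : (l2sum (a *: x : ell2)%R <= (abs2 a)%:E * l2sum x)%E by exact: l2sumZ_le.
by rewrite !l2normE -EFinM lee_fin.
Qed.

Lemma abs2_norm (a : R[i]) : `|a| = (Num.sqrt (abs2 a))%:C.
Proof. exact: normc_def. Qed.

Lemma l2normZ (a : R[i]) x : l2norm (a *: x) = Num.sqrt (abs2 a) * l2norm x.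
Proof.
apply/eqP; rewrite eq_le l2normZ_le /=.
have [->|a0] := eqVneq a 0.
  by rewrite /abs2 /= expr0n addr0 sqrtr0 mul0r l2norm_ge0.
have na : 0 < Num.sqrt (abs2 a).
  by rewrite sqrtr_gt0 lt_neqAle abs2_ge0 andbT eq_sym; apply: contra_neq a0 => /abs2_eq0.
rewrite -ler_pdivlMl//; apply: le_trans (_ : l2norm (a^-1 *: (a *: x)) <= _).
  by rewrite scalerA mulVf// scale1r.
apply: le_trans (l2normZ_le _ _) _; rewrite ler_wpM2r ?l2norm_ge0//.
rewrite -(ler_pM2r na) mulVf ?gt_eqF// -sqrtrM ?abs2_ge0// -abs2M mulVf//.
by rewrite /abs2 /= expr1n expr0n addr0 sqrtr1.
Qed.

Let normD x y : (l2norm (x + y))%:C <= (l2norm x)%:C + (l2norm y)%:C.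
Proof. by rewrite -rmorphD lecR l2normD. Qed.

Let normZ (a : R[i]) x : (l2norm (a *: x))%:C = `|a| * (l2norm x)%:C.
Proof. by rewrite l2normZ abs2_norm -rmorphM. Qed.

Let norm0 x : (l2norm x)%:C = 0 -> x = 0.
Proof. by move=> [] /l2norm0_eq0. Qed.

HB.instance Definition _ :=
  Lmodule_isNormed.Build R[i] ell2 normD normZ norm0.

Lemma ell2_normE x : `|x| = (l2norm x)%:C. Proof. by []. Qed.

Lemma l2norm0 : l2norm 0 = 0.
Proof. by have [] := normr0 ell2. Qed.

End Ell2.

Section Inner.
Context {R : realType} {Z : choiceType}.
Implicit Types x y : ell2 R Z.

(* Unconditional sums, meaningful for absolutely summable families; [csum] is
   applied to such a family in [inner]. *)
Definition rsum (f : Z -> R) : R :=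
  fine (\esum_(z in [set: Z]) (EFin \o f)^\+ z
        - \esum_(z in [set: Z]) (EFin \o f)^\- z)%E.

Definition csum (f : Z -> R[i]) : R[i] :=
  rsum (fun z => Re (f z)) +i* rsum (fun z => Im (f z)).

(* Linear in the first argument. *)
Definition inner x y : R[i] := csum (fun z => x z * conjc (y z)).

Lemma delta_subproof (w : Z) :
  (fun z => (z == w)%:R : R[i]) \in square_summable.
Proof.
rewrite unfold_in /l2sum (esumID [set w]); last by move=> ? _; rewrite lee_fin abs2_ge0.
rewrite [X in (_ + X)%E]esum1 => [|z [_ /=]]; last first.
  by move/eqP/negbTE => ->; rewrite /abs2 /= expr0n addr0.
by rewrite setTI esum_set1 ?adde0 ?ltry// lee_fin abs2_ge0.
Qed.

Definition delta (w : Z) : ell2 R Z := Ell2 (delta_subproof w).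

End Inner.

Section Operators.
Context (R : realType) (Z : choiceType).
Local Notation H := (ell2 R Z).

Definition bounded_linear : {pred H -> H} := fun f =>
  `[< linear f /\ exists M : R, forall x, l2norm (f x) <= M * l2norm x >].

Lemma bounded_linear_submod : submod_closed bounded_linear.
Proof.
split=> [|a f g]; rewrite !unfold_in.
  apply/asboolP; split; first by move=> k u v; rewrite /= scaler0 addr0.
  by exists 0 => x; rewrite mul0r /= l2norm0.
move=> /asboolP[fl [M fM]] /asboolP[gl [N gN]]; apply/asboolP.
have E (w : H) : (a *: f + g) w = a *: f w + g w by [].
split=> [k u v|].
  rewrite !E fl gl !scalerDr !scalerA addrACA; congr (_ + _ + _).
  by rewrite mulrC.
exists (Num.sqrt (abs2 a) * M + N) => x; rewrite E.
apply: le_trans (l2normD _ _) _; rewrite mulrDl lerD// l2normZ -mulrA.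
by rewrite ler_wpM2l// sqrtr_ge0.
Qed.

HB.instance Definition _ :=
  GRing.isSubmodClosed.Build _ _ bounded_linear bounded_linear_submod.

Record bop := Bop { bop_fun :> H -> H; _ : bop_fun \in bounded_linear }.

HB.instance Definition _ := [isSub for bop_fun].
HB.instance Definition _ := [Choice of bop by <:].
HB.instance Definition _ := [SubChoice_isSubLmodule of bop by <:].

Implicit Types a b : bop.

Lemma bopP a b : (forall x, a x = b x) -> a = b.
Proof. by move=> ab; apply/val_inj/funext. Qed.

Lemma bop_linear a : linear a.
Proof. by case: a => f /= /[1!unfold_in] /asboolP[]. Qed.

Lemma bop_bounded a : exists M : R, forall x, l2norm (a x) <= M * l2norm x.
Proof. by case: a => f /= /[1!unfold_in] /asboolP[]. Qed.

Lemma bop0 a : a 0 = 0.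
Proof. by have := bop_linear a (-1) 0 0; rewrite scaler0 addr0 scaleN1r addNr. Qed.

Lemma bopZ a k x : a (k *: x) = k *: a x.
Proof. by have := bop_linear a k x 0; rewrite bop0 !addr0. Qed.

Lemma bopD a x y : a (x + y) = a x + a y.
Proof. by have := bop_linear a 1 x y; rewrite !scale1r. Qed.

Definition opnorm a : R :=
  sup [set l2norm (a x) | x in [set x | l2norm x <= 1]].

Lemma opnorm_has_sup a :
  has_sup [set l2norm (a x) | x in [set x | l2norm x <= 1]].
Proof.
split; first by exists (l2norm (a 0)), 0; rewrite //= l2norm0.
have [M aM] := bop_bounded a; exists `|M| => _ [x /= x1 <-].
apply: le_trans (aM x) _; apply: le_trans (_ : `|M| * l2norm x <= _).
  by rewrite ler_wpM2r ?l2norm_ge0// ler_norm.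
by rewrite ler_piMr.
Qed.

Lemma opnorm_ub a x : l2norm x <= 1 -> l2norm (a x) <= opnorm a.
Proof. by move=> x1; apply: (sup_upper_bound (opnorm_has_sup a)); exists x. Qed.

Lemma opnorm_le a (M : R) :
  (forall x, l2norm x <= 1 -> l2norm (a x) <= M) -> opnorm a <= M.
Proof.
move=> aM; apply: ge_sup; first by have [] := opnorm_has_sup a.
by move=> _ [x /= x1 <-]; exact: aM.
Qed.

Lemma opnorm_ge0 a : 0 <= opnorm a.
Proof. by apply: le_trans (l2norm_ge0 (a 0)) (opnorm_ub _ _); rewrite l2norm0. Qed.

Lemma abs2_real (r : R) : 0 <= r -> Num.sqrt (abs2 r%:C) = r.
Proof. by move=> r0; rewrite /abs2 /= expr0n addr0 sqrtr_sqr ger0_norm. Qed.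

Lemma opnormP a x : l2norm (a x) <= opnorm a * l2norm x.
Proof.
have [/l2norm0_eq0->|x0] := eqVneq (l2norm x) 0.
  by rewrite bop0 l2norm0 mulr0.
have {}x0 : 0 < l2norm x by rewrite lt_neqAle eq_sym x0 l2norm_ge0.
have := @opnorm_ub a ((l2norm x)^-1%:C *: x).
rewrite bopZ !l2normZ abs2_real ?invr_ge0 ?l2norm_ge0//.
rewrite mulVf ?gt_eqF// => /(_ (lexx _)).
by rewrite mulrC ler_pdivrMr.
Qed.

Let normD a b : (opnorm (a + b))%:C <= (opnorm a)%:C + (opnorm b)%:C.
Proof.
rewrite -rmorphD lecR; apply: opnorm_le => x x1.
by apply: le_trans (l2normD _ _) _; rewrite lerD// opnorm_ub.
Qed.

Let normZ (k : R[i]) a : (opnorm (k *: a))%:C = `|k| * (opnorm a)%:C.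
Proof.
rewrite abs2_norm -rmorphM; congr (_%:C); apply/eqP.
have le (c : R[i]) b : opnorm (c *: b) <= Num.sqrt (abs2 c) * opnorm b.
  apply: opnorm_le => x x1; rewrite [X in l2norm X](_ : _ = c *: b x)//.
  by rewrite l2normZ ler_wpM2l ?sqrtr_ge0// opnorm_ub.
rewrite eq_le le /=; have [->|k0] := eqVneq k 0.
  by rewrite /abs2 /= expr0n addr0 sqrtr0 mul0r opnorm_ge0.
have nk : 0 < Num.sqrt (abs2 k).
  by rewrite sqrtr_gt0 lt_neqAle abs2_ge0 andbT eq_sym; apply: contra_neq k0 => /abs2_eq0.
rewrite -ler_pdivlMl//; apply: le_trans (_ : opnorm (k^-1 *: (k *: a)) <= _).
  by rewrite scalerA mulVf// scale1r.
apply: le_trans (le _ _) _; rewrite ler_wpM2r ?opnorm_ge0//.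
rewrite -(ler_pM2r nk) mulVf ?gt_eqF// -sqrtrM ?abs2_ge0// -abs2M mulVf//.
by rewrite /abs2 /= expr1n expr0n addr0 sqrtr1.
Qed.

Let norm0 a : (opnorm a)%:C = 0 -> a = 0.
Proof.
move=> [] a0; apply: bopP => x; apply: l2norm0_eq0; apply/eqP.
by rewrite eq_le l2norm_ge0 andbT; have := opnormP a x; rewrite a0 mul0r.
Qed.

HB.instance Definition _ :=
  Lmodule_isNormed.Build R[i] bop normD normZ norm0.

Lemma bop_id_subproof : (@id H) \in bounded_linear.
Proof.
rewrite unfold_in; apply/asboolP; split=> //.
by exists 1 => x; rewrite mul1r.
Qed.

Lemma bop_comp_subproof a b : a \o b \in bounded_linear.
Proof.
rewrite unfold_in; apply/asboolP; split=> [k u v|].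
  by rewrite /= !bop_linear.
exists (opnorm a * opnorm b) => x; apply: le_trans (opnormP _ _) _.
by rewrite -mulrA ler_wpM2l ?opnorm_ge0// opnormP.
Qed.

Definition bop_id : bop := Bop bop_id_subproof.
Definition bop_comp a b : bop := Bop (bop_comp_subproof a b).

Let compA : associative bop_comp. Proof. by move=> a b c; exact: bopP. Qed.
Let comp1l : left_id bop_id bop_comp. Proof. by move=> a; exact: bopP. Qed.
Let comp1r : right_id bop_id bop_comp. Proof. by move=> a; exact: bopP. Qed.
Let compDl : left_distributive bop_comp +%R.
Proof. by move=> a b c; exact: bopP. Qed.
Let compDr : right_distributive bop_comp +%R.
Proof. by move=> a b c; apply: bopP => x /=; rewrite bopD. Qed.

HB.instance Definition _ :=
  GRing.Zmodule_isPzRing.Build bop compA comp1l comp1r compDl compDr.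

End Operators.

(* In [bop R Z] the product is composition and the norm is the operator norm,
   so that [closure], [closed] and [compact] refer to the norm topologies. *)
Section OperatorAlgebra.
Context {R : realType} {Z : choiceType}.
Local Notation B := (bop R Z).
Implicit Types (a b p : B) (A S : set B).

(* The adjoint as a relation: [b] is the adjoint of [a]. It always exists and is
   unique, so a set is stable under adjoints when it contains every such [b]. *)
Definition is_adjoint a b := forall x y, inner (a x) y = inner x (b y).

Definition projection p := p * p = p /\ is_adjoint p p.

(* The order of [R[i]] makes [0 <= c] mean that [c] is a nonnegative real. *)
Definition op_ge0 a := forall x, 0 <= inner (a x) x.

Definition compact_op a := compact (closure (a @` [set x | `|x| <= 1])).

Definition cstar_subalgebra S A :=
  [/\ S `<=` A,
      S 0 /\ (forall (k : R[i]) a b, S a -> S b -> S (k *: a + b)),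
      forall a b, S a -> S b -> S (a * b),
      forall a b, S a -> is_adjoint a b -> S b
    & closed S].

Definition hereditary_subalgebra S A :=
  cstar_subalgebra S A /\
  forall a b, A a -> S b -> op_ge0 a -> op_ge0 (b - a) -> S a.

End OperatorAlgebra.

Definition star_homomorphism {R : realType} {Z W : choiceType}
    (A : set (bop R Z)) (B : set (bop R W)) (Phi : bop R Z -> bop R W) :=
  [/\ set_fun A B Phi,
      forall (k : R[i]) a b, A a -> A b -> Phi (k *: a + b) = k *: Phi a + Phi b,
      forall a b, A a -> A b -> Phi (a * b) = Phi a * Phi b
    & forall a b, A a -> A b -> is_adjoint a b -> is_adjoint (Phi a) (Phi b)].

(* The restricted metric on a subset. *)
Section SubMetric.
Context {R : realType} {T : metricType R} (A : set T).

Let d (x y : set_type A) : R := mdist (set_val x) (set_val y).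

Let d_ge0 x y : 0 <= d x y. Proof. exact: mdist_ge0. Qed.

Let d_positivity x y : d x y = 0 -> x = y.
Proof. by move=> /mdist_positivity; exact: val_inj. Qed.

Let ballEd x r : ball x r = [set y | d x y < r].
Proof. by rewrite -initial_ballE ballEmdist. Qed.

HB.instance Definition _ :=
  PseudoMetric_isMetric.Build R (set_type A) d_ge0 d_positivity ballEd.

End SubMetric.

Section Coarse.
Context {R : realType}.
Implicit Types X Y Z : metricType R.

Definition uniformly_locally_finite Z :=
  forall r : R, 0 <= r -> exists N : nat, forall z : Z,
    ([set w | mdist z w <= r] #<= `I_N)%card.

Definition set_dist Z (A B : set Z) : R :=
  inf [set mdist p.1 p.2 | p in A `*` B].

Definition sparse Z := exists P : nat -> set Z,
  [/\ forall n, finite_set (P n) /\ P n !=set0,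
      trivIset [set: nat] P, \bigcup_n P n = [set: Z]
    & forall M : R, exists N : nat, forall n m : nat,
        n != m -> (N <= n + m)%N -> M <= set_dist (P n) (P m)].

(* The supremum over an empty set is [-oo], which is below [+oo], so the zero
   operator has finite propagation. *)
Definition propagation Z (a : bop R Z) : \bar R :=
  ereal_sup [set (mdist p.1 p.2)%:E
            | p in [set p | inner (a (delta p.2)) (delta p.1) != 0]].

Definition uniform_roe Z : set (bop R Z) :=
  closure [set a | (propagation a < +oo)%E].

(* [e%:C] is compared with the [R[i]]-valued modulus, which is real. *)
Definition ghost Z (a : bop R Z) := uniform_roe a /\
  forall e : R, 0 < e -> exists F : set Z, finite_set F /\
    forall z w, ~ F z -> ~ F w -> `|inner (a (delta z)) (delta w)| < e%:C.

Definition only_compact_ghost_projections Z :=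
  forall p : bop R Z, ghost p -> projection p -> compact_op p.

Definition coarse_embedding X Y (f : X -> Y) :=
  exists rho_m rho_p : R -> R,
  [/\ forall t, 0 <= t -> 0 <= rho_m t /\ 0 <= rho_p t,
      forall s t, 0 <= s -> s <= t -> rho_m s <= rho_m t,
      forall s t, 0 <= s -> s <= t -> rho_p s <= rho_p t,
      rho_m t @[t --> +oo] --> +oo
    & forall x x', rho_m (mdist x x') <= mdist (f x) (f x')
                /\ mdist (f x) (f x') <= rho_p (mdist x x')].

End Coarse.

Arguments uniformly_locally_finite {R} Z.
Arguments sparse {R} Z.
Arguments uniform_roe {R} Z.
Arguments only_compact_ghost_projections {R} Z.

(* Main.v *)
Require Import Defs.
From HB Require Import structures.
From mathcomp Require Import all_boot all_order all_algebra.
From mathcomp Require Import complex.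
From mathcomp Require Import all_classical all_reals all_analysis.
From mathcomp Require Import ring lra zify.
Import Order.TTheory GRing.Theory Num.Theory.
Import numFieldNormedType.Exports.
Local Open Scope classical_set_scope.
Local Open Scope ring_scope.

(* Write xi x for the unit vector spanning the range of Phi (e_xx), which has
   rank one because the range of Phi is hereditary. The xi x are orthonormal,
   and U : delta x |-> xi x is an isometry with Phi a = U a U^*; moreover the
   compression U^* b U of b in C*_u(Y) lies in C*_u(X).
   Rigidity: some d > 0 satisfies d <= |xi x (y)| for every x and some y = f x.
   Otherwise there are x_n such that xi (x_n) tends to 0 uniformly and is almost
   supported on finite sets Y_n moving apart; normalising the restrictions gives
   a noncompact ghost projection on the sparse space formed by the Y_n.
   Coarseness: a gliding hump shows that U a U^* and U^* b U are approximable at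
   a scale depending only on the propagation of a and b, and matrix units then
   give both bounds on f.
   Injectivity: averaging (U sg U^* ) V sg over signs sg, where V delta x is
   delta (f x), gives U D with D diagonal and bounded below, so by the same
   uniformity U F is almost supported near f(F). Hence Hall's condition holds
   for the balls around the points f x, and a marriage is an injective map at
   bounded distance from f. *)
Set Implicit Arguments.
Unset Strict Implicit.
Unset Printing Implicit Defensive.

Local Open Scope complex_scope.
Local Notation Re := complex.Re.
Local Notation Im := complex.Im.

(** * Square-summable families *)

(** The argument gets by without continuity of [Phi]. Heredity places well-chosen rank-one operators
    in the range, and corners by matrix units read off the entries of their preimages; this yields
    $UU^*=\Phi(1)$ and then the spatial formula. The obstacle to coarseness is that an element of a
    uniform Roe algebra is approximable at a scale of its own, while bounds on [f] need one scale
    for all matrix units of a given length. Gluing is possible because, in a uniformly locally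
    finite space, a kernel with bounded entries and bounded propagation is automatically a bounded
    operator. Rigidity alone only bounds the fibres of [f] by $d^{-2}$. Hall's condition comes from
    linear independence: were there fewer than $|F|$ points near $f(F)$, some nonzero combination of
    the vectors $\xi_x$, $x\in F$, would vanish on all of them. Signs enter because $U^*V$ is not
    diagonal; diagonal sign operators have propagation 0, so their common scale does not depend on
    $F$. *)

Section Modulus.
Context {R : realType}.
Implicit Types c d : R[i].

(** The norm of [R[i]] is valued in [R[i]]; a modulus in [R] makes real arithmetic and the total
    order available. *)
Definition cabs c : R := Num.sqrt (abs2 c).

Lemma cabsE c : `|c| = (cabs c)%:C. Proof. exact: abs2_norm. Qed.

Lemma cabs_ge0 c : 0 <= cabs c. Proof. exact: sqrtr_ge0. Qed.

Lemma cabs_sqr c : cabs c ^+ 2 = abs2 c.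
Proof. by rewrite sqr_sqrtr// abs2_ge0. Qed.

Lemma cabs0 : cabs 0 = 0.
Proof. by apply: complexI; rewrite -cabsE normr0. Qed.

Lemma cabs1 : cabs 1 = 1.
Proof. by apply: complexI; rewrite -cabsE normr1. Qed.

Lemma cabsM c d : cabs (c * d) = cabs c * cabs d.
Proof. by apply: complexI; rewrite -cabsE normrM !cabsE -rmorphM. Qed.

Lemma cabsV c : cabs c^-1 = (cabs c)^-1.
Proof. by apply: complexI; rewrite -cabsE normfV cabsE fmorphV. Qed.

Lemma cabsN c : cabs (- c) = cabs c.
Proof. by apply: complexI; rewrite -!cabsE normrN. Qed.

Lemma cabsJ c : cabs (conjc c) = cabs c.
Proof. by apply: complexI; rewrite -!cabsE normcJ. Qed.

Lemma cabsD c d : cabs (c + d) <= cabs c + cabs d.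
Proof. by rewrite -lecR rmorphD /= -!cabsE ler_normD. Qed.

Lemma cabsB c d : cabs (c - d) <= cabs c + cabs d.
Proof. by rewrite -(cabsN d) cabsD. Qed.

Lemma cabs_eq0 c : cabs c = 0 -> c = 0.
Proof. by move=> c0; apply: abs2_eq0; rewrite -cabs_sqr c0 expr0n. Qed.

Lemma cabs_gt0 c : c != 0 -> 0 < cabs c.
Proof.
move=> c0; rewrite lt_neqAle cabs_ge0 andbT eq_sym.
by apply: contra_neq c0 => /cabs_eq0.
Qed.

Lemma cabs_sum I (s : seq I) (f : I -> R[i]) :
  cabs (\sum_(i <- s) f i) <= \sum_(i <- s) cabs (f i).
Proof.
elim: s => [|i s IH]; first by rewrite !big_nil cabs0.
by rewrite !big_cons; apply: le_trans (cabsD _ _) _; rewrite lerD2l.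
Qed.

Lemma cabs_real (r : R) : 0 <= r -> cabs r%:C = r.
Proof. by move=> r0; rewrite /cabs /abs2 /= expr0n addr0 sqrtr_sqr ger0_norm. Qed.

Lemma mulJ_abs2 c : c * conjc c = (abs2 c)%:C.
Proof.
case: c => a b; apply/eqP; rewrite eq_complex /abs2 /=; apply/andP.
by split; apply/eqP; ring.
Qed.

Lemma abs2_conj c : abs2 (conjc c) = abs2 c.
Proof. by rewrite -!cabs_sqr cabsJ. Qed.

Lemma abs2_0 : abs2 (0 : R[i]) = 0.
Proof. by rewrite -cabs_sqr cabs0 expr0n. Qed.

Lemma Re_cabs c : `|Re c| <= cabs c.
Proof. by rewrite -lecR -cabsE; exact: normc_ge_Re. Qed.

Lemma Im_cabs c : `|Im c| <= cabs c.
Proof.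
rewrite -normrN -ReiNIm; apply: le_trans (Re_cabs _) _.
by rewrite cabsM /cabs /abs2 /= expr0n expr1n add0r sqrtr1 mulr1.
Qed.

Lemma cabs_abs2 (M : R) c : 0 <= M -> (cabs c <= M) = (abs2 c <= M ^+ 2).
Proof. by move=> M0; rewrite -cabs_sqr ler_sqr ?nnegrE ?cabs_ge0. Qed.

End Modulus.

(** * Linearity of signed unconditional sums *)

Section RealSums.
Context {R : realType} {Z : choiceType}.
Implicit Types f g h : Z -> R.

Definition ssum f := summable [set: Z] (EFin \o f).

Lemma esum_seq_le f (s : seq Z) : uniq s -> (forall z, 0 <= f z) ->
  ((\sum_(z <- s) f z)%:E <= \esum_(z in [set: Z]) (f z)%:E)%E.
Proof.
move=> us f0; apply: esum_ge; exists [set` s]; first by split=> //; exact: finite_seq.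
by rewrite -fsbig_seq// sumEFin.
Qed.

Lemma esum_le_seq f (M : \bar R) :
  (forall s, uniq s -> ((\sum_(z <- s) f z)%:E <= M)%E) ->
  (\esum_(z in [set: Z]) (f z)%:E <= M)%E.
Proof.
move=> fM; apply: ge_ereal_sup => _ [F [finF _] <-].
by rewrite fsbig_finite//= sumEFin fM.
Qed.

Lemma ssumP f (M : R) : (forall s, uniq s -> \sum_(z <- s) `|f z| <= M) -> ssum f.
Proof.
move=> fM; apply: (@le_lt_trans _ _ M%:E); last exact: ltry.
by apply: (@esum_le_seq (fun z => `|f z|)) => s us; rewrite lee_fin fM.
Qed.

Lemma ssum_fin f : (forall z, 0 <= f z) -> ssum f ->
  (\esum_(z in [set: Z]) (f z)%:E \is a fin_num)%E.
Proof.
move=> f0; rewrite /ssum summableE; congr (_ \is a fin_num).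
by apply: eq_esum => z _ /=; rewrite ger0_norm.
Qed.

Definition nsum f : R := fine (\esum_(z in [set: Z]) (f z)%:E)%E.

Lemma nsumK f : (forall z, 0 <= f z) -> ssum f ->
  (\esum_(z in [set: Z]) (f z)%:E = (nsum f)%:E)%E.
Proof. by move=> f0 sf; rewrite fineK// ssum_fin. Qed.

Lemma ssumD f g : ssum f -> ssum g -> ssum (fun z => f z + g z).
Proof. exact: summableD. Qed.

Lemma ssumN f : ssum f -> ssum (fun z => - f z).
Proof. by rewrite /ssum summableN. Qed.

Lemma ssumB f g : ssum f -> ssum g -> ssum (fun z => f z - g z).
Proof. by move=> sf /ssumN; exact: ssumD. Qed.

Lemma ssum_abs f : ssum f -> ssum (fun z => `|f z|).
Proof.
rewrite /ssum /summable; apply: le_lt_trans; apply: le_esum => z _ /=.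
by rewrite normr_id.
Qed.

Lemma ssumZ (k : R) f : 0 <= k -> ssum f -> ssum (fun z => k * f z).
Proof.
rewrite /ssum /summable => k0 sf.
apply: (@le_lt_trans _ _ (k%:E * \esum_(z in [set: Z]) (`|f z|)%:E)%E); last first.
  exact: lte_mul_pinfty.
apply: le_trans (esumZ_le k0 (fun z => normr_ge0 (f z))).
by apply: le_esum => z _ /=; rewrite lee_fin normrM ger0_norm.
Qed.

Lemma nsumD f g : (forall z, 0 <= f z) -> (forall z, 0 <= g z) ->
  ssum f -> ssum g -> nsum (fun z => f z + g z) = nsum f + nsum g.
Proof.
move=> f0 g0 sf sg; rewrite {1}/nsum; under eq_esum do rewrite EFinD.
by rewrite esumD ?nsumK// => z _; rewrite lee_fin.
Qed.

Lemma nsumZ (k : R) f : 0 <= k -> (forall z, 0 <= f z) -> ssum f ->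
  nsum (fun z => k * f z) = k * nsum f.
Proof.
move=> k0 f0 sf; have [->|kn0] := eqVneq k 0.
  by rewrite /nsum mul0r esum1// => z _; rewrite mul0r.
have kp : 0 < k by rewrite lt_neqAle eq_sym kn0.
have kf0 z : 0 <= k * f z by rewrite mulr_ge0.
have skf := ssumZ k0 sf.
apply/eqP; rewrite eq_le; apply/andP; split.
  by have := esumZ_le k0 f0; rewrite !nsumK// -EFinM lee_fin.
have := esumZ_le (ltW (divr_gt0 ltr01 kp)) kf0.
rewrite (nsumK kf0)// -EFinM (_ : (fun z => _) = EFin \o f).
  by rewrite nsumK// lee_fin div1r ler_pdivlMl.
by apply/funext => z /=; rewrite div1r mulrA mulVf// mul1r.
Qed.

(** Any splitting into nonnegative summable parts computes [rsum], so linearity need not follow how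
    positive and negative parts behave under sums. The splitting used for it is $|f|-(|f|-f)$. *)
Lemma rsumE f g h : (forall z, 0 <= g z) -> (forall z, 0 <= h z) ->
  ssum g -> ssum h -> (forall z, f z = g z - h z) -> rsum f = nsum g - nsum h.
Proof.
move=> g0 h0 sg sh fE; rewrite /rsum.
rewrite (_ : EFin \o f = (EFin \o g) \- (EFin \o h))%E; last first.
  by apply/funext => z /=; rewrite fE EFinB.
rewrite esumB//= ?nsumK// => z _; rewrite lee_fin//.
Qed.

Lemma rsum_ge0 f : (forall z, 0 <= f z) -> ssum f -> rsum f = nsum f.
Proof.
move=> f0 sf; rewrite (@rsumE f f (fun=> 0))//.
- by rewrite [X in _ - X]/nsum esum1// subr0.
- by apply: (@ssumP _ 0) => s _; rewrite big1// => z _; rewrite normr0.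
- by move=> z; rewrite subr0.
Qed.

Let posg f z : 0 <= `|f z|. Proof. exact: normr_ge0. Qed.

Let posh f z : 0 <= `|f z| - f z. Proof. by rewrite subr_ge0 ler_norm. Qed.

Let rsumE' f : ssum f -> rsum f = nsum (fun z => `|f z|) - nsum (fun z => `|f z| - f z).
Proof.
move=> sf; apply: rsumE => //; first exact: ssum_abs.
  by apply: ssumB => //; exact: ssum_abs.
by move=> z; rewrite opprB addrC subrK.
Qed.

Lemma rsumD f g : ssum f -> ssum g ->
  rsum (fun z => f z + g z) = rsum f + rsum g.
Proof.
move=> sf sg; rewrite (rsumE' sf) (rsumE' sg).
rewrite (@rsumE _ (fun z => `|f z| + `|g z|)
                  (fun z => (`|f z| - f z) + (`|g z| - g z))).
- rewrite nsumD//; try exact: ssum_abs.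
  rewrite nsumD//; first by ring.
  + by apply: ssumB => //; exact: ssum_abs.
  + by apply: ssumB => //; exact: ssum_abs.
- by move=> z; rewrite addr_ge0.
- by move=> z; rewrite addr_ge0.
- by apply: ssumD; exact: ssum_abs.
- by apply: ssumD; apply: ssumB => //; exact: ssum_abs.
- by move=> z; ring.
Qed.

Lemma rsumN f : ssum f -> rsum (fun z => - f z) = - rsum f.
Proof.
move=> sf; rewrite (rsumE' sf) opprB.
apply: rsumE => //; [by apply: ssumB => //; exact: ssum_abs|exact: ssum_abs|].
by move=> z; ring.
Qed.

Lemma rsumZ (k : R) f : ssum f -> rsum (fun z => k * f z) = k * rsum f.
Proof.
wlog k0 : k / 0 <= k => [hw sf|sf].
  have [/hw->//|k0] := leP 0 k.
  have nk0 : 0 <= - k by rewrite oppr_ge0 ltW.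
  rewrite -[in RHS](opprK k) mulNr -(hw _ nk0 sf) -rsumN; last exact: ssumZ.
  by congr rsum; apply/funext => z; ring.
rewrite (rsumE' sf) mulrBr.
rewrite -(nsumZ k0)//; last exact: ssum_abs.
rewrite -(nsumZ k0)//; last by apply: ssumB => //; exact: ssum_abs.
apply: rsumE.
- by move=> z; rewrite mulr_ge0.
- by move=> z; rewrite mulr_ge0.
- by apply: ssumZ => //; exact: ssum_abs.
- by apply: ssumZ => //; apply: ssumB => //; exact: ssum_abs.
- by move=> z; ring.
Qed.

Lemma rsum1 f w : (forall z, z != w -> f z = 0) -> rsum f = f w.
Proof.
move=> fw; have sup1 (g : Z -> R) : (forall z, z != w -> g z = 0) -> 0 <= g w ->
    (\esum_(z in [set: Z]) (g z)%:E = (g w)%:E)%E.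
  move=> gw g0; have g_ge0 z : 0 <= g z.
    by have [->//|/gw->] := eqVneq z w.
  apply/eqP; rewrite eq_le; apply/andP; split; last first.
    by have := @esum_seq_le g [:: w] isT g_ge0; rewrite big_seq1.
  apply: esum_le_seq => s us; rewrite lee_fin.
  have [ws|ws] := boolP (w \in s).
    by rewrite (bigD1_seq w)//= big1 ?addr0.
  rewrite big1_seq// => z /andP[_ zs]; apply: gw.
  by apply: contraNneq ws => <-.
rewrite /rsum.
have -> : (\esum_(z in [set: Z]) (EFin \o f)^\+ z = (Num.max (f w) 0)%:E)%E.
  rewrite -(sup1 (fun z => Num.max (f z) 0)).
  - by apply: eq_esum => z _; rewrite funeposE /= -EFin_max.
  - by move=> z /fw->; rewrite maxxx.
  - by rewrite le_max lexx orbT.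
have -> : (\esum_(z in [set: Z]) (EFin \o f)^\- z = (Num.max (- f w) 0)%:E)%E.
  rewrite -(sup1 (fun z => Num.max (- f z) 0)).
  - by apply: eq_esum => z _; rewrite funenegE /= -EFin_max.
  - by move=> z /fw->; rewrite oppr0 maxxx.
  - by rewrite le_max lexx orbT.
rewrite /= /Num.max; case: ltP => f1; case: ltP => f2; lra.
Qed.

End RealSums.

#[global] Arguments ell2_fun : simpl never.
#[global] Arguments bop_fun : simpl never.

(** * Truncations and tails of vectors *)

Section L2.
Context {R : realType}.
Implicit Types Z W : choiceType.

Lemma l2norm_sum_le Z (x : ell2 R Z) (s : seq Z) : uniq s ->
  \sum_(z <- s) abs2 (x z) <= l2norm x ^+ 2.
Proof.
move=> us; rewrite -lee_fin -l2normE.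
by apply: esum_seq_le => // z; exact: abs2_ge0.
Qed.

Lemma l2norm_le Z (x : ell2 R Z) (M : R) : 0 <= M ->
  (forall s, uniq s -> \sum_(z <- s) abs2 (x z) <= M ^+ 2) -> l2norm x <= M.
Proof.
move=> M0 xM; rewrite -ler_sqr ?nnegrE ?l2norm_ge0// -lee_fin -l2normE.
by apply: (@esum_le_seq _ _ (fun z => abs2 (x z))) => s us; rewrite lee_fin xM.
Qed.

Lemma ell2_ex Z (f : Z -> R[i]) (M : R) : 0 <= M ->
  (forall s, uniq s -> \sum_(z <- s) abs2 (f z) <= M ^+ 2) ->
  exists x : ell2 R Z, (forall z, x z = f z) /\ l2norm x <= M.
Proof.
move=> M0 fM; have sf : f \in square_summable.
  rewrite unfold_in; apply: (@le_lt_trans _ _ (M ^+ 2)%:E); last exact: ltry.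
  by apply: (@esum_le_seq _ _ (fun z => abs2 (f z))) => s us; rewrite lee_fin fM.
by exists (Ell2 sf); split => //; exact: l2norm_le.
Qed.

Lemma coord_le Z (x : ell2 R Z) z : cabs (x z) <= l2norm x.
Proof.
rewrite cabs_abs2 ?l2norm_ge0//.
by have := @l2norm_sum_le _ x [:: z] isT; rewrite big_seq1.
Qed.

Lemma ell2D Z (x y : ell2 R Z) z : (x + y) z = x z + y z. Proof. by []. Qed.

Lemma ell2N Z (x : ell2 R Z) z : (- x) z = - x z. Proof. by []. Qed.

Lemma ell2B Z (x y : ell2 R Z) z : (x - y) z = x z - y z. Proof. by []. Qed.

Lemma ell2Z Z (k : R[i]) (x : ell2 R Z) z : (k *: x) z = k * x z. Proof. by []. Qed.

Lemma ell20 Z z : (0 : ell2 R Z) z = 0. Proof. by []. Qed.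

Lemma ell2_sum Z I (s : seq I) (P : pred I) (F : I -> ell2 R Z) z :
  (\sum_(i <- s | P i) F i) z = \sum_(i <- s | P i) F i z.
Proof. by elim/big_rec2: _ => // i a b _ <-. Qed.

Lemma l2norm_sum Z I (s : seq I) (F : I -> ell2 R Z) :
  l2norm (\sum_(i <- s) F i) <= \sum_(i <- s) l2norm (F i).
Proof.
elim: s => [|i s IH]; first by rewrite !big_nil l2norm0.
by rewrite !big_cons; apply: le_trans (l2normD _ _) _; rewrite lerD2l.
Qed.

Lemma l2normcZ Z (k : R[i]) (x : ell2 R Z) : l2norm (k *: x) = cabs k * l2norm x.
Proof. exact: l2normZ. Qed.

Lemma l2normN Z (x : ell2 R Z) : l2norm (- x) = l2norm x.
Proof. by rewrite -scaleN1r l2normcZ cabsN cabs1 mul1r. Qed.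

Lemma l2normB Z (x y : ell2 R Z) : l2norm (x - y) <= l2norm x + l2norm y.
Proof. by rewrite -(l2normN y) l2normD. Qed.

Lemma deltaE Z (w z : Z) : (delta w : ell2 R Z) z = (z == w)%:R. Proof. by []. Qed.

Definition trunc_fun Z (D : {pred Z}) (x : Z -> R[i]) z := if z \in D then x z else 0.

Lemma trunc_ex Z (D : {pred Z}) (x : ell2 R Z) :
  exists y : ell2 R Z, (forall z, y z = trunc_fun D x z) /\ l2norm y <= l2norm x.
Proof.
apply: ell2_ex; first exact: l2norm_ge0.
move=> s us; apply: le_trans (l2norm_sum_le x us).
apply: ler_sum => z _; rewrite /trunc_fun; case: ifP => // _.
by rewrite abs2_0 abs2_ge0.
Qed.

Definition trunc Z (D : {pred Z}) (x : ell2 R Z) : ell2 R Z :=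
  projT1 (cid (trunc_ex D x)).

Lemma truncE Z (D : {pred Z}) (x : ell2 R Z) z :
  trunc D x z = if z \in D then x z else 0.
Proof. by rewrite /trunc; case: cid => y [/=]. Qed.

Lemma trunc_seqE Z (s : seq Z) (x : ell2 R Z) z :
  trunc (mem s) x z = if z \in s then x z else 0.
Proof. exact: truncE. Qed.

Lemma l2norm_trunc Z (D : {pred Z}) (x : ell2 R Z) : l2norm (trunc D x) <= l2norm x.
Proof. by rewrite /trunc; case: cid => y [/=]. Qed.

Lemma l2norm_trunc_seq Z (s : seq Z) (x : ell2 R Z) : uniq s ->
  l2norm (trunc (mem s) x) ^+ 2 = \sum_(z <- s) abs2 (x z).
Proof.
move=> us; apply/eqP; rewrite eq_le; apply/andP; split; last first.
  apply: le_trans (l2norm_sum_le _ us).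
  by rewrite le_eqVlt; apply/orP; left; apply/eqP/eq_big_seq => z zs; rewrite truncE /= zs.
rewrite -[leRHS]sqr_sqrtr; last by apply: sumr_ge0 => z _; exact: abs2_ge0.
rewrite ler_sqr ?nnegrE ?l2norm_ge0 ?sqrtr_ge0//; apply: l2norm_le.
  exact: sqrtr_ge0.
move=> t ut; rewrite sqr_sqrtr; last by apply: sumr_ge0 => z _; exact: abs2_ge0.
rewrite (bigID (fun z => z \in s))/= [X in _ + X]big1 ?addr0; last first.
  by move=> z /negbTE zs; rewrite truncE /= zs abs2_0.
rewrite -big_filter.
rewrite (eq_big_seq (fun z => abs2 (x z))); last first.
  by move=> z; rewrite mem_filter => /andP[zs _]; rewrite truncE /= zs.
rewrite [leRHS](bigID (fun z => z \in t))/= -[X in _ <= X + _]big_filter.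
rewrite (perm_big [seq z <- s | z \in t]).
  by rewrite lerDl sumr_ge0// => z _; exact: abs2_ge0.
by apply: uniq_perm; rewrite ?filter_uniq// => z; rewrite !mem_filter andbC.
Qed.

Lemma trunc_split_sqr Z (s : seq Z) (x : ell2 R Z) : uniq s ->
  l2norm (x - trunc (mem s) x) ^+ 2 + \sum_(z <- s) abs2 (x z) <= l2norm x ^+ 2.
Proof.
move=> us; set S := \sum_(_ <- _) _.
have S0 : 0 <= l2norm x ^+ 2 - S by rewrite subr_ge0; exact: l2norm_sum_le.
rewrite -lerBrDr -(sqr_sqrtr S0) ler_sqr ?nnegrE ?sqrtr_ge0 ?l2norm_ge0//.
apply: l2norm_le; first exact: sqrtr_ge0.
move=> t ut; rewrite sqr_sqrtr// lerBrDr.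
rewrite (bigID (fun z => z \in s)) big1 ?add0r; last first.
  by move=> z /andP[_ zs]; rewrite ell2B truncE zs subrr abs2_0.
rewrite (eq_bigr (fun z => abs2 (x z))); last first.
  by move=> z /andP[_ /negbTE zs]; rewrite ell2B truncE zs subr0.
rewrite -big_filter /= add0r -big_cat; apply: l2norm_sum_le.
rewrite cat_uniq filter_uniq// us andbT; apply/hasPn => z zs.
by rewrite mem_filter /= zs.
Qed.

(** One finite set serves all larger truncations, so it can be absorbed into a region that is
    enlarged for other reasons. *)
Lemma tail_small Z (x : ell2 R Z) (e : R) : 0 < e ->
  exists s, uniq s /\ forall D : {pred Z}, {subset s <= D} ->
    l2norm (x - trunc D x) < e.
Proof.
move=> e0.
have : (l2sum x - (e ^+ 2 / 2)%:E < l2sum x)%E.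
  by rewrite l2normE -EFinB lte_fin ltrBlDr ltrDl divr_gt0// exprn_gt0.
move=> /ereal_sup_gt [_ [F [finF _] <-]].
rewrite fsbig_finite//= sumEFin l2normE -EFinB lte_fin => lt.
have us : uniq (finmap.enum_fset (fset_set F)) by exact: finmap.fset_uniq.
move: lt us; set s := finmap.enum_fset _ => lt us.
exists s; split=> // D sD.
rewrite -ltr_sqr ?nnegrE ?l2norm_ge0 ?ltW//.
apply: (@le_lt_trans _ _ (l2norm (x - trunc (mem s) x) ^+ 2)).
  rewrite ler_sqr ?nnegrE ?l2norm_ge0//; apply: l2norm_le; first exact: l2norm_ge0.
  move=> t ut; apply: le_trans (l2norm_sum_le _ ut).
  apply: ler_sum => z _; rewrite !ell2B !truncE.
  case: ifP => zD; first by rewrite subrr abs2_0 abs2_ge0.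
  by rewrite subr0 ifF ?subr0//; apply/negP => /sD; rewrite zD.
have := trunc_split_sqr x us; move: lt (exprn_gt0 2 e0).
set S := \sum_(_ <- _) _; lra.
Qed.

Lemma trunc_sum Z (s : seq Z) (x : ell2 R Z) : uniq s ->
  trunc (mem s) x = \sum_(z <- s) x z *: delta z.
Proof.
move=> us; apply: ell2P => z; rewrite truncE ell2_sum; case: ifPn => zs.
  rewrite (bigD1_seq z)// ell2Z deltaE eqxx mulr1 big1; first by rewrite /= addr0.
  move=> w wz; by rewrite ell2Z deltaE eq_sym (negbTE wz) mulr0.
rewrite big1_seq// => w /andP[_ ws].
rewrite ell2Z deltaE; case: eqP => [zw|]; last by rewrite mulr0.
by rewrite zw (ws : is_true (w \in mem s)) in zs.
Qed.

Lemma l2norm_delta Z (z : Z) : l2norm (delta z : ell2 R Z) = 1.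
Proof.
have -> : (delta z : ell2 R Z) = trunc (mem [:: z]) (delta z).
  by apply: ell2P => w; rewrite truncE deltaE [w \in _](mem_seq1 w z); case: eqP.
apply/eqP; rewrite -(@eqrXn2 _ 2) ?l2norm_ge0//.
by rewrite l2norm_trunc_seq// big_seq1 deltaE eqxx -cabs_sqr cabs1 expr1n.
Qed.

(** Finite truncations approximate [x], and on them the value is a combination of the vanishing
    [g (delta w)]. The entrywise criteria for operators below rest on this, one variable at a
    time. *)
Lemma lin_eq0 Z (g : ell2 R Z -> R[i]) (C : R) (x : ell2 R Z) :
  (forall k u v, g (k *: u + v) = k * g u + g v) ->
  (forall u, cabs (g u) <= C * l2norm u) ->
  (forall w, x w != 0 -> g (delta w) = 0) -> g x = 0.
Proof.
move=> gl gC g0; apply: cabs_eq0; apply/eqP; rewrite eq_le cabs_ge0 andbT.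
(* [C] may be nonpositive; the maximum is a safe divisor. *)
have C0 : 0 <= Num.max C 1 by rewrite le_max ler01 orbT.
apply/ler_addgt0Pl => e e0; rewrite addr0.
have d0 : 0 < e / Num.max C 1 by rewrite divr_gt0// lt_max ltr01 orbT.
have [s [us /(_ (mem s) (fun z zs => zs)) xs]] := tail_small x d0.
have g00 : g 0 = 0.
  by have := gl (-1) 0 0; rewrite scaler0 addr0 mulN1r addNr.
have gt0 : g (trunc (mem s) x) = 0.
  rewrite trunc_sum//; elim: s {us xs} => [|w s IH]; first by rewrite big_nil.
  rewrite big_cons gl IH addr0; have [->|/g0->] := eqVneq (x w) 0.
    by rewrite mul0r.
  by rewrite mulr0.
have -> : g x = g (x - trunc (mem s) x).
  by rewrite -[in LHS](subrK (trunc (mem s) x) x) -[_ - _]scale1r gl mul1r gt0 addr0 scale1r.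
apply: le_trans (gC _) _; apply: (@le_trans _ _ (Num.max C 1 * (e / Num.max C 1))).
  apply: (@le_trans _ _ (Num.max C 1 * l2norm (x - trunc (mem s) x))).
    by rewrite ler_wpM2r ?l2norm_ge0// le_max lexx.
  by rewrite ler_wpM2l// ltW.
by rewrite mulrCA divff ?mulr1// gt_eqF// lt_max ltr01 orbT.
Qed.

End L2.

(** * The inner product *)

Section InnerTheory.
Context {R : realType} {Z : choiceType}.
Implicit Types x y : ell2 R Z.

Lemma ssum_inner x y : ssum (fun z => cabs (x z * conjc (y z))).
Proof.
apply: (@ssumP _ _ _ (l2norm x ^+ 2 + l2norm y ^+ 2)) => s us.
apply: le_trans (lerD (l2norm_sum_le x us) (l2norm_sum_le y us)).
rewrite -big_split; apply: ler_sum => z _ /=.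
rewrite ger0_norm ?cabs_ge0// cabsM cabsJ -!cabs_sqr.
have := sqr_ge0 (cabs (x z) - cabs (y z)).
by have := cabs_ge0 (x z); have := cabs_ge0 (y z); nra.
Qed.

Let ssum_le (f g : Z -> R) : ssum g -> (forall z, `|f z| <= g z) -> ssum f.
Proof.
move=> sg fg; apply: le_lt_trans sg; apply: le_esum => z _ /=.
by rewrite lee_fin; apply: le_trans (fg z) _; exact: ler_norm.
Qed.

Lemma ssum_Re x y : ssum (fun z => Re (x z * conjc (y z))).
Proof. by apply: ssum_le (ssum_inner x y) _ => z; exact: Re_cabs. Qed.

Lemma ssum_Im x y : ssum (fun z => Im (x z * conjc (y z))).
Proof. by apply: ssum_le (ssum_inner x y) _ => z; exact: Im_cabs. Qed.

Lemma innerDl x y u : inner (x + y) u = inner x u + inner y u.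
Proof.
apply/eqP; rewrite eq_complex /=; apply/andP; split; apply/eqP.
  rewrite -rsumD; try exact: ssum_Re.
  by congr rsum; apply/funext => z; rewrite ell2D mulrDl raddfD.
rewrite -rsumD; try exact: ssum_Im.
by congr rsum; apply/funext => z; rewrite ell2D mulrDl raddfD.
Qed.

Lemma innerZl k x u : inner (k *: x) u = k * inner x u.
Proof.
have [sR sI] := (ssum_Re x u, ssum_Im x u).
have sZ (c : R) f : @ssum R Z f -> ssum (fun z => c * f z).
  move=> sf; apply: (@ssum_le _ (fun z => `|c| * `|f z|)).
    by apply: ssumZ => //; exact: ssum_abs.
  by move=> z; rewrite normrM.
case: k => a b; apply/eqP; rewrite eq_complex /=; apply/andP; split; apply/eqP.
  rewrite -!rsumZ// -rsumN ?(sZ b)// -rsumD ?(sZ a)//; last by apply: ssumN; exact: sZ.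
  by congr rsum; apply/funext => z; rewrite ell2Z; case: (x z) (u z) => [? ?] [? ?] /=; ring.
rewrite -!rsumZ// -rsumD ?(sZ a) ?(sZ b)//.
by congr rsum; apply/funext => z; rewrite ell2Z; case: (x z) (u z) => [? ?] [? ?] /=; ring.
Qed.

Lemma innerC x y : inner x y = conjc (inner y x).
Proof.
apply/eqP; rewrite eq_complex /=; apply/andP; split; apply/eqP.
  by congr rsum; apply/funext => z; case: (x z) (y z) => [? ?] [? ?] /=; ring.
rewrite -rsumN; last exact: ssum_Im.
by congr rsum; apply/funext => z; case: (x z) (y z) => [? ?] [? ?] /=; ring.
Qed.

Lemma innerDr x y u : inner u (x + y) = inner u x + inner u y.
Proof. by rewrite innerC innerDl rmorphD [inner u x]innerC [inner u y]innerC. Qed.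

Lemma innerZr k x u : inner u (k *: x) = conjc k * inner u x.
Proof. by rewrite innerC innerZl rmorphM [inner u x]innerC. Qed.

Lemma innerNl x y : inner (- x) y = - inner x y.
Proof. by rewrite -scaleN1r innerZl mulN1r. Qed.

Lemma innerNr x y : inner x (- y) = - inner x y.
Proof. by rewrite innerC innerNl rmorphN [inner x y]innerC. Qed.

Lemma innerBl x y u : inner (x - y) u = inner x u - inner y u.
Proof. by rewrite innerDl innerNl. Qed.

Lemma innerBr x y u : inner u (x - y) = inner u x - inner u y.
Proof. by rewrite innerDr innerNr. Qed.

Lemma inner0l x : inner 0 x = 0.
Proof. by rewrite -(scale0r (0 : ell2 R Z)) innerZl mul0r. Qed.

Lemma inner0r x : inner x 0 = 0.
Proof. by rewrite innerC inner0l conjc0. Qed.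

Lemma inner_suml I (s : seq I) (F : I -> ell2 R Z) y :
  inner (\sum_(i <- s) F i) y = \sum_(i <- s) inner (F i) y.
Proof.
elim: s => [|i s IH]; first by rewrite !big_nil inner0l.
by rewrite !big_cons innerDl IH.
Qed.

Lemma inner_sumr I (s : seq I) (F : I -> ell2 R Z) y :
  inner y (\sum_(i <- s) F i) = \sum_(i <- s) inner y (F i).
Proof.
elim: s => [|i s IH]; first by rewrite !big_nil inner0r.
by rewrite !big_cons innerDr IH.
Qed.

Lemma inner_delta x z : inner x (delta z) = x z.
Proof.
have E w : x w * conjc ((delta z : ell2 R Z) w) = if w == z then x w else 0.
  by rewrite deltaE conjc_nat; case: eqP => _; rewrite ?mulr1 ?mulr0.
rewrite /inner /csum (rsum1 (w := z)); last by move=> w /negbTE wz; rewrite E wz.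
rewrite (rsum1 (w := z)); last by move=> w /negbTE wz; rewrite E wz.
by rewrite !E eqxx; case: (x z).
Qed.

Lemma inner_deltal x z : inner (delta z) x = conjc (x z).
Proof. by rewrite innerC inner_delta. Qed.

Lemma inner_xx x : inner x x = (l2norm x ^+ 2)%:C.
Proof.
have E z : x z * conjc (x z) = (abs2 (x z))%:C by exact: mulJ_abs2.
have sx : ssum (fun z => abs2 (x z)).
  apply: (@ssumP _ _ _ (l2norm x ^+ 2)) => s us.
  by under eq_bigr do rewrite ger0_norm ?abs2_ge0//; exact: l2norm_sum_le.
rewrite /inner /csum; apply/eqP; rewrite eq_complex /=; apply/andP; split; apply/eqP.
  have -> : (fun z => Re (x z * conjc (x z))) = (fun z => abs2 (x z)).
    by apply/funext => z; rewrite E.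
  rewrite rsum_ge0//; last by move=> z; exact: abs2_ge0.
  rewrite sqr_sqrtr ?fine_ge0 ?l2sum_ge0//.
have -> : (fun z => Im (x z * conjc (x z))) = (fun z => 0 * abs2 (x z)).
  by apply/funext => z; rewrite E mul0r.
by rewrite rsumZ// mul0r.
Qed.

Lemma l2norm_sqrD x y :
  l2norm (x + y) ^+ 2 = l2norm x ^+ 2 + l2norm y ^+ 2 + 2 * Re (inner x y).
Proof.
apply: complexI; rewrite -inner_xx innerDl !innerDr !inner_xx (innerC y x).
apply/eqP; rewrite eq_complex; case: (inner x y) => a b /=.
by apply/andP; split; apply/eqP; ring.
Qed.

Lemma cauchy_schwarz x y : cabs (inner x y) <= l2norm x * l2norm y.
Proof.
have [/l2norm0_eq0->|y0] := eqVneq (l2norm y) 0.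
  by rewrite inner0r cabs0 l2norm0 mulr0.
have {}y0 : 0 < l2norm y by rewrite lt_neqAle eq_sym y0 l2norm_ge0.
pose c := inner x y; pose t := (l2norm y ^+ 2)^-1.
have : 0 <= l2norm (x + (- (t%:C * c)) *: y) ^+ 2 by exact: sqr_ge0.
rewrite l2norm_sqrD l2normcZ innerZr -/c cabsN cabsM cabs_real ?invr_ge0 ?sqr_ge0//.
have -> : Re (conjc (- (t%:C * c)) * c) = - (t * cabs c ^+ 2).
  by rewrite cabs_sqr; case: (c) => a b; rewrite /abs2 /=; ring.
have ty : t * l2norm y ^+ 2 = 1 by rewrite mulVf// expf_neq0// gt_eqF.
have -> : (t * cabs c * l2norm y) ^+ 2 = t * cabs c ^+ 2 * (t * l2norm y ^+ 2) by ring.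
rewrite ty mulr1 => ineq.
have {ineq} : t * cabs c ^+ 2 <= l2norm x ^+ 2 by lra.
rewrite /t ler_pdivrMl ?exprn_gt0// -exprMn.
by rewrite ler_sqr ?nnegrE ?cabs_ge0 ?mulr_ge0 ?l2norm_ge0// mulrC.
Qed.

End InnerTheory.

Lemma bessel (R : realType) (X : eqType) (Z : choiceType) (xi : X -> ell2 R Z) (w : ell2 R Z)
    (s : seq X) : uniq s ->
  (forall x x', inner (xi x) (xi x') = (x == x')%:R) ->
  \sum_(x <- s) abs2 (inner w (xi x)) <= l2norm w ^+ 2.
Proof.
move=> us ortho; set S := \sum_(_ <- _) _.
pose v := \sum_(x <- s) inner w (xi x) *: xi x.
have wv : inner w v = S%:C.
  rewrite inner_sumr /S rmorph_sum; apply: eq_bigr => x _.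
  by rewrite innerZr mulrC mulJ_abs2.
have vv : inner v v = S%:C.
  rewrite {1}/v inner_suml /S rmorph_sum; apply: eq_big_seq => x xs.
  rewrite innerZl inner_sumr (bigD1_seq x)//= innerZr ortho eqxx mulr1.
  rewrite big1 ?addr0 ?mulJ_abs2// => x' x'x.
  by rewrite innerZr ortho eq_sym (negbTE x'x) mulr0.
have := sqr_ge0 (l2norm (w - v)); rewrite l2norm_sqrD l2normN innerNr wv.
have -> : l2norm v ^+ 2 = S by apply: complexI; rewrite -inner_xx.
by rewrite raddfN /=; lra.
Qed.

(** Real parts come from the norms of sums, imaginary parts from replacing $u$ by $iu$. The two maps
    may have different target spaces, as [ana] and [Phi 1] do. *)
Lemma polarization (R : realType) (V : lmodType R[i]) (A B : choiceType)
    (S : V -> ell2 R A) (T : V -> ell2 R B) :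
  (forall k u v, S (k *: u + v) = k *: S u + S v) ->
  (forall k u v, T (k *: u + v) = k *: T u + T v) ->
  (forall v, l2norm (S v) = l2norm (T v)) ->
  forall u v, inner (S u) (S v) = inner (T u) (T v).
Proof.
move=> Sl Tl ST u v.
have ReE u' v' : Re (inner (S u') (S v')) = Re (inner (T u') (T v')).
  have /(congr1 (fun r => r ^+ 2)) : l2norm (S u' + S v') = l2norm (T u' + T v').
    by have := ST (1 *: u' + v'); rewrite Sl Tl !scale1r.
  move: (l2norm_sqrD (S u') (S v')) (l2norm_sqrD (T u') (T v')).
  rewrite (ST u') (ST v') => /= -> ->.
  move=> /addrI/mulfI; apply; by rewrite pnatr_eq0.
have S0 : S 0 = 0 by have := Sl (-1) 0 0; rewrite scaler0 addr0 scaleN1r addNr.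
have T0 : T 0 = 0 by have := Tl (-1) 0 0; rewrite scaler0 addr0 scaleN1r addNr.
have SZ k w : S (k *: w) = k *: S w by have := Sl k w 0; rewrite S0 !addr0.
have TZ k w : T (k *: w) = k *: T w by have := Tl k w 0; rewrite T0 !addr0.
apply/eqP; rewrite eq_complex ReE eqxx /=.
have := ReE ('i%C *: u) v; rewrite SZ TZ !innerZl.
rewrite !(mulrC 'i%C) !ReiNIm => /eqP; by rewrite eqr_opp.
Qed.

(** * Bounded operators and the uniform Roe algebra *)

Section BoundedOperators.
Context {R : realType} {Z : choiceType}.
Local Notation B := (bop R Z).
Implicit Types (a b : B) (x y v w : ell2 R Z).

Lemma bopDE a b x : (a + b) x = a x + b x. Proof. by []. Qed.
Lemma bopBE a b x : (a - b) x = a x - b x. Proof. by []. Qed.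
Lemma bopZE (k : R[i]) a x : (k *: a) x = k *: a x. Proof. by []. Qed.
Lemma bop0E x : (0 : B) x = 0. Proof. by []. Qed.
Lemma bop1E x : (1 : B) x = x. Proof. by []. Qed.
Lemma bopME a b x : (a * b) x = a (b x). Proof. by []. Qed.

Lemma bop_sumE I (s : seq I) (F : I -> B) x :
  (\sum_(i <- s) F i) x = \sum_(i <- s) F i x.
Proof. by elim/big_rec2: _ => // i a b _ <-. Qed.

Lemma bop_sum a I (s : seq I) (F : I -> ell2 R Z) :
  a (\sum_(i <- s) F i) = \sum_(i <- s) a (F i).
Proof.
elim: s => [|i s IH]; first by rewrite !big_nil bop0.
by rewrite !big_cons bopD IH.
Qed.

Lemma scale_bopAl (k : R[i]) a b : (k *: a) * b = k *: (a * b).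
Proof. exact: bopP. Qed.

Lemma scale_bopAr (k : R[i]) a b : a * (k *: b) = k *: (a * b).
Proof. by apply: bopP => x; rewrite bopME !bopZE bopZ. Qed.

Lemma opnorm_leP a (M : R) : 0 <= M ->
  (forall x, l2norm (a x) <= M * l2norm x) -> opnorm a <= M.
Proof.
move=> M0 aM; apply: opnorm_le => x x1; apply: le_trans (aM x) _.
by rewrite ler_piMr.
Qed.

Lemma opnormD a b : opnorm (a + b) <= opnorm a + opnorm b.
Proof.
apply: opnorm_leP; first by rewrite addr_ge0 ?opnorm_ge0.
move=> x; rewrite bopDE mulrDl; apply: le_trans (l2normD _ _) _.
by rewrite lerD ?opnormP.
Qed.

Lemma opnormZ_le (k : R[i]) a : opnorm (k *: a) <= cabs k * opnorm a.
Proof.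
apply: opnorm_leP; first by rewrite mulr_ge0 ?opnorm_ge0 ?cabs_ge0.
by move=> x; rewrite bopZE l2normcZ -mulrA ler_wpM2l ?cabs_ge0 ?opnormP.
Qed.

Lemma opnormN a : opnorm (- a) = opnorm a.
Proof.
have le b : opnorm (- b) <= opnorm b.
  by rewrite -scaleN1r; apply: le_trans (opnormZ_le _ _) _; rewrite cabsN cabs1 mul1r.
by apply/eqP; rewrite eq_le le -[X in opnorm X <= _]opprK le.
Qed.

Lemma opnormB a b : opnorm (a - b) <= opnorm a + opnorm b.
Proof. by rewrite -(opnormN b) opnormD. Qed.

Lemma opnormM a b : opnorm (a * b) <= opnorm a * opnorm b.
Proof.
apply: opnorm_leP; first by rewrite mulr_ge0 ?opnorm_ge0.
move=> x; rewrite bopME -mulrA; apply: le_trans (opnormP _ _) _.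
by rewrite ler_wpM2l ?opnorm_ge0 ?opnormP.
Qed.

Lemma cabs_inner_op a x y : cabs (inner (a x) y) <= opnorm a * l2norm x * l2norm y.
Proof.
apply: le_trans (cauchy_schwarz _ _) _.
by rewrite ler_wpM2r ?l2norm_ge0 ?opnormP.
Qed.

Lemma cabs_inner_le a x y (M C D : R) : opnorm a <= M -> l2norm x <= C ->
  l2norm y <= D -> cabs (inner (a x) y) <= M * C * D.
Proof.
move=> aM xC yD; apply: le_trans (cabs_inner_op a x y) _.
apply: ler_pM => //; rewrite ?mulr_ge0 ?opnorm_ge0 ?l2norm_ge0//.
by apply: ler_pM; rewrite ?opnorm_ge0 ?l2norm_ge0.
Qed.

(** The basic constructor of operators: a bound on finite partial sums of coordinates gives square
    summability and the norm estimate together. *)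
Lemma bop_ex (k : ell2 R Z -> Z -> R[i]) (M : R) : 0 <= M ->
  (forall c x y z, k (c *: x + y) z = c * k x z + k y z) ->
  (forall x s, uniq s -> \sum_(z <- s) abs2 (k x z) <= (M * l2norm x) ^+ 2) ->
  exists a : B, (forall x z, a x z = k x z) /\ opnorm a <= M.
Proof.
move=> M0 kl kM.
have kex x := ell2_ex (mulr_ge0 M0 (l2norm_ge0 x)) (kM x).
pose f x := projT1 (cid (kex x)).
have fE x z : f x z = k x z by rewrite /f; case: cid => ? [].
have fM x : l2norm (f x) <= M * l2norm x by rewrite /f; case: cid => ? [].
have fB : f \in @bounded_linear R Z.
  rewrite unfold_in; apply/asboolP; split; last by exists M.
  by move=> c x y; apply: ell2P => z; rewrite fE kl ell2D ell2Z !fE.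
by exists (Bop fB); split => //; apply: opnorm_leP.
Qed.

Lemma bop_eq_entries a b :
  (forall w z : Z, a (delta w) z = b (delta w) z) -> a = b.
Proof.
move=> ab; apply: bopP => x; apply: ell2P => z; apply/eqP; rewrite -subr_eq0; apply/eqP.
apply: (@lin_eq0 R Z (fun x => a x z - b x z) (opnorm a + opnorm b)).
- by move=> k u v; rewrite !bopD !bopZ !ell2D !ell2Z; ring.
- move=> u; rewrite mulrDl; apply: le_trans (cabsB _ _) _; apply: lerD.
    by apply: le_trans (coord_le _ _) (opnormP _ _).
  by apply: le_trans (coord_le _ _) (opnormP _ _).
- by move=> w _; rewrite ab subrr.
Qed.

(** [lin_eq0] in one variable and then in the other turns a condition on matrix entries into one on
    vectors of infinite support. *)
Lemma inner_supp0 a x y :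
  (forall w z : Z, x w != 0 -> y z != 0 -> a (delta w) z = 0) -> inner (a x) y = 0.
Proof.
move=> a0; apply: (@lin_eq0 R Z (fun u => inner (a u) y) (opnorm a * l2norm y)).
- by move=> k u v; rewrite bopD bopZ innerDl innerZl.
- by move=> u; rewrite mulrAC; exact: cabs_inner_op.
move=> w xw; rewrite innerC.
rewrite (@lin_eq0 R Z (fun u => inner u (a (delta w))) (l2norm (a (delta w))) y) ?conjc0//.
- by move=> k u v; rewrite innerDl innerZl.
- by move=> u; rewrite mulrC; exact: cauchy_schwarz.
by move=> z yz; rewrite inner_deltal a0// conjc0.
Qed.

Lemma is_adjoint_entries a b :
  (forall w z : Z, a (delta w) z = conjc (b (delta z) w)) -> is_adjoint a b.
Proof.
move=> ab.
have h (w : Z) y : inner (a (delta w)) y = inner (delta w) (b y).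
  apply/eqP; rewrite -subr_eq0; apply/eqP.
  rewrite innerC (innerC (delta w)) -rmorphB.
  rewrite (@lin_eq0 R Z (fun u => inner u (a (delta w)) - inner (b u) (delta w))
     (l2norm (a (delta w)) + opnorm b * 1) y) ?rmorph0//.
  - by move=> k u v; rewrite bopD bopZ !innerDl !innerZl; ring.
  - move=> u; apply: le_trans (cabsB _ _) _; rewrite mulrDl; apply: lerD.
      by rewrite mulrC; exact: cauchy_schwarz.
    by apply: le_trans (cabs_inner_op _ _ _) _; rewrite l2norm_delta !mulr1.
  - by move=> z _; rewrite inner_deltal ab conjcK inner_delta subrr.
move=> x y; apply/eqP; rewrite -subr_eq0; apply/eqP.
apply: (@lin_eq0 R Z (fun u => inner (a u) y - inner u (b y))
     (opnorm a * l2norm y + l2norm (b y))).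
- by move=> k u v; rewrite bopD bopZ !innerDl !innerZl; ring.
- move=> u; apply: le_trans (cabsB _ _) _; rewrite mulrDl; apply: lerD.
    by rewrite mulrAC; exact: cabs_inner_op.
  by rewrite mulrC; exact: cauchy_schwarz.
- by move=> w _; rewrite h subrr.
Qed.

Lemma is_adjoint1 : is_adjoint (1 : B) 1.
Proof. by move=> x y; rewrite !bop1E. Qed.

Lemma rk1_ex v w : exists a : B,
  (forall x z, a x z = (inner x w *: v) z) /\ opnorm a <= l2norm v * l2norm w.
Proof.
apply: bop_ex; first by rewrite mulr_ge0 ?l2norm_ge0.
  by move=> c x y z; rewrite !ell2Z innerDl innerZl; ring.
move=> x s us; apply: le_trans (l2norm_sum_le _ us) _.
rewrite ler_sqr ?nnegrE ?mulr_ge0 ?l2norm_ge0// l2normcZ -mulrA mulrC.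
by rewrite ler_wpM2l ?l2norm_ge0// mulrC cauchy_schwarz.
Qed.

(** This is $v w^*$; [rk1 (delta x) (delta x')] is the matrix unit taking [delta x'] to
    [delta x]. *)
Definition rk1 v w : B := projT1 (cid (rk1_ex v w)).

Lemma rk1E v w x : rk1 v w x = inner x w *: v.
Proof. by apply: ell2P => z; rewrite /rk1; case: cid => ? []. Qed.

Lemma opnorm_rk1 v w : opnorm (rk1 v w) <= l2norm v * l2norm w.
Proof. by rewrite /rk1; case: cid => ? []. Qed.

Lemma rk1_adjoint v w : is_adjoint (rk1 v w) (rk1 w v).
Proof. by move=> x y; rewrite !rk1E innerZl innerZr -innerC mulrC. Qed.

Lemma mul_rk1 a v w : a * rk1 v w = rk1 (a v) w.
Proof. by apply: bopP => x; rewrite bopME !rk1E bopZ. Qed.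

Lemma rk1_mul b b' v w : is_adjoint b b' -> rk1 v w * b = rk1 v (b' w).
Proof. by move=> bb; apply: bopP => x; rewrite bopME !rk1E bb. Qed.

Lemma rk1_rk1 v w v' w' : rk1 v w * rk1 v' w' = inner v' w *: rk1 v w'.
Proof. by apply: bopP => x; rewrite bopME bopZE !rk1E innerZl scalerA mulrC. Qed.

Lemma rk1Bl v v' w : rk1 (v - v') w = rk1 v w - rk1 v' w.
Proof. by apply: bopP => x; rewrite bopBE !rk1E scalerBr. Qed.

Lemma rk1Br v w w' : rk1 v (w - w') = rk1 v w - rk1 v w'.
Proof. by apply: bopP => x; rewrite bopBE !rk1E innerBr scalerBl. Qed.

Lemma rk1Zl k v w : rk1 (k *: v) w = k *: rk1 v w.
Proof. by apply: bopP => x; rewrite bopZE !rk1E !scalerA mulrC. Qed.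

Lemma rk1Zr k v w : rk1 v (k *: w) = conjc k *: rk1 v w.
Proof. by apply: bopP => x; rewrite bopZE !rk1E innerZr scalerA. Qed.

Lemma rk1_eq0 v : rk1 v v = 0 -> v = 0.
Proof.
move=> /(congr1 (fun a : B => inner (a v) v)) /=.
rewrite rk1E bop0E inner0l innerZl inner_xx -rmorphM => -[] /eqP.
by rewrite mulf_eq0 orbb sqrf_eq0 => /eqP/l2norm0_eq0.
Qed.

Lemma trunc_linear (D : {pred Z}) c x y z :
  trunc_fun D (c *: x + y : ell2 R Z) z = c * trunc_fun D x z + trunc_fun D y z.
Proof.
by rewrite /trunc_fun; case: ifP => _; rewrite ?ell2D ?ell2Z// mulr0 addr0.
Qed.

Lemma proj_ex (D : {pred Z}) : exists a : B,
  (forall x z, a x z = trunc_fun D x z) /\ opnorm a <= 1.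
Proof.
apply: bop_ex => //; first by move=> c x y z; exact: trunc_linear.
move=> x s us; rewrite mul1r; apply: le_trans (l2norm_sum_le x us).
apply: ler_sum => z _; rewrite /trunc_fun; case: ifP => // _.
by rewrite abs2_0 abs2_ge0.
Qed.

Definition proj (D : {pred Z}) : B := projT1 (cid (proj_ex D)).

Lemma projE (D : {pred Z}) x : proj D x = trunc D x.
Proof. by apply: ell2P => z; rewrite truncE /proj; case: cid => ? []. Qed.

Lemma opnorm_proj (D : {pred Z}) : opnorm (proj D) <= 1.
Proof. by rewrite /proj; case: cid => ? []. Qed.

Lemma opnorm_mul_proj a (D : {pred Z}) : opnorm (a * proj D) <= opnorm a.
Proof.
by apply: le_trans (opnormM _ _) _; rewrite ler_piMr ?opnorm_ge0 ?opnorm_proj.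
Qed.

Lemma opnorm_proj_mul a (D : {pred Z}) : opnorm (proj D * a) <= opnorm a.
Proof.
by apply: le_trans (opnormM _ _) _; rewrite ler_piMl ?opnorm_ge0 ?opnorm_proj.
Qed.

Lemma inner_trunc (D : {pred Z}) x y : inner (trunc D x) y = inner x (trunc D y).
Proof.
rewrite /inner /csum; congr (_ +i* _); congr rsum; apply/funext => z;
  by rewrite !truncE; case: ifP => _ //; rewrite conjc0 mulr0 mul0r.
Qed.

End BoundedOperators.

(** * The uniform Roe algebra through matrix entries *)

Section UniformRoe.
Context {R : realType} {Z : metricType R}.
Local Notation B := (bop R Z).
Implicit Types (a b : B).

Definition fprop (s : R) a := forall w z, a (delta w) z != 0 -> mdist w z <= s.

Lemma propagation_lty a : (propagation a < +oo)%E <-> exists s, fprop s a.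
Proof.
split=> [afin|[s sa]].
  have H w z : a (delta w) z != 0 -> ((mdist w z)%:E <= propagation a)%E.
    move=> awz; apply: ereal_sup_ubound; exists (z, w) => /=.
      by rewrite inner_delta.
    by rewrite metric_sym.
  case E : (propagation a) H afin => [s| |] H //_; first by exists s => w z /H.
  by exists 0 => w z /H.
apply: (@le_lt_trans _ _ s%:E); last exact: ltry.
apply: ge_ereal_sup => _ [[z w] /= awz <-]; rewrite lee_fin metric_sym sa//.
by rewrite -inner_delta.
Qed.

Lemma uniform_roeP a : uniform_roe Z a <->
  forall e : R, 0 < e -> exists b s, fprop s b /\ opnorm (a - b) < e.
Proof.
split=> [ca e e0|H A].
  have : nbhs a (ball a (e%:C)) by apply: nbhsx_ballx; rewrite ltcR.
  move=> /ca [b [/= /propagation_lty [s sb]]]; rewrite -ball_normE /= => ab.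
  by exists b, s; split => //; rewrite -ltcR.
move=> /nbhs_ballP [e /= e0]; rewrite -ball_normE => eA.
(* A positive element of [R[i]] is real, so the radius of the ball is a real one. *)
have eE : e = (Re e)%:C by apply/esym/RRe_real/gtr0_real.
have e0' : 0 < Re e by rewrite -ltcR -eE.
have [b [s [sb ab]]] := H _ e0'; exists b; split.
  by apply/propagation_lty; exists s.
by apply: eA; rewrite /= eE ltcR.
Qed.

Lemma uniform_roe_lim a :
  (forall e : R, 0 < e -> exists b, uniform_roe Z b /\ opnorm (a - b) < e) ->
  uniform_roe Z a.
Proof.
move=> H; apply/uniform_roeP => e e0; have e2 : 0 < e / 2 by rewrite divr_gt0.
have [b [/uniform_roeP/(_ _ e2)[c [s [sc bc]]] ab]] := H _ e2.
exists c, s; split => //; rewrite -(subrK b a) -addrA.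
by apply: le_lt_trans (opnormD _ _) _; rewrite [ltRHS]splitr ltrD.
Qed.

Lemma fprop_mono (s t : R) a : s <= t -> fprop s a -> fprop t a.
Proof. by move=> st sa w z /sa /le_trans; exact. Qed.

Lemma fpropD s a b : fprop s a -> fprop s b -> fprop s (a + b).
Proof.
move=> sa sb w z; rewrite bopDE ell2D.
have [a0|/sa//] := eqVneq (a (delta w) z) 0.
by rewrite a0 add0r => /sb.
Qed.

Lemma fpropZ k s a : fprop s a -> fprop s (k *: a).
Proof. by move=> sa w z; rewrite bopZE ell2Z mulf_eq0 negb_or => /andP[_ /sa]. Qed.

Lemma fpropM s t a b : fprop s a -> fprop t b -> fprop (s + t) (a * b).
Proof.
move=> sa tb w z; rewrite bopME; apply: contraR; rewrite -ltNge => dwz.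
rewrite -inner_delta inner_supp0// => u v /tb dwu.
rewrite deltaE pnatr_eq0 eqb0 negbK => /eqP->.
apply/eqP; apply: contraLR dwz => /sa duz; rewrite -leNgt addrC.
by apply: le_trans (metric_triangle _ u _) _; rewrite lerD.
Qed.

Lemma fprop_inner0 s a (x y : ell2 R Z) : fprop s a ->
  (forall w z : Z, x w != 0 -> y z != 0 -> s < mdist w z) -> inner (a x) y = 0.
Proof.
move=> sa xy; apply: inner_supp0 => w z xw yz; apply/eqP.
by apply: contraLR (xy _ _ xw yz) => /sa; rewrite -leNgt.
Qed.

Lemma fprop_roe s a : fprop s a -> uniform_roe Z a.
Proof.
by move=> sa; apply/uniform_roeP => e e0; exists a, s; rewrite subrr /opnorm;
  split => //; apply: le_lt_trans e0; apply: opnorm_leP => // x;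
  rewrite bop0E l2norm0 mul0r.
Qed.

Lemma fprop1 : fprop 0 (1 : B).
Proof.
move=> w z; rewrite bop1E deltaE pnatr_eq0 eqb0 negbK => /eqP->.
by rewrite mdistxx.
Qed.

Lemma uniform_roe1 : uniform_roe Z (1 : B).
Proof. exact: fprop_roe fprop1. Qed.

Lemma uniform_roe0 : uniform_roe Z (0 : B).
Proof. by apply: (@fprop_roe 0) => w z; rewrite bop0E ell20 eqxx. Qed.

Lemma uniform_roeD a b : uniform_roe Z a -> uniform_roe Z b -> uniform_roe Z (a + b).
Proof.
move=> /uniform_roeP ra /uniform_roeP rb; apply/uniform_roeP => e e0.
have e2 : 0 < e / 2 by rewrite divr_gt0.
have [a' [s [sa aa]]] := ra _ e2; have [b' [t [tb bb]]] := rb _ e2.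
exists (a' + b'), (Num.max s t); split.
  by apply: fpropD; [apply: fprop_mono sa|apply: fprop_mono tb];
     rewrite le_max lexx ?orbT.
by rewrite opprD addrACA; apply: le_lt_trans (opnormD _ _) _; rewrite [ltRHS]splitr ltrD.
Qed.

Lemma uniform_roeZ k a : uniform_roe Z a -> uniform_roe Z (k *: a).
Proof.
move=> /uniform_roeP ra; apply/uniform_roeP => e e0.
have k0 : 0 < cabs k + 1 by rewrite ltr_wpDl// cabs_ge0.
have [b [s [sb ab]]] := ra _ (divr_gt0 e0 k0).
exists (k *: b), s; split; first exact: fpropZ.
rewrite -scalerBr; apply: le_lt_trans (opnormZ_le _ _) _.
apply: (@le_lt_trans _ _ ((cabs k + 1) * opnorm (a - b))).
  by rewrite ler_wpM2r ?opnorm_ge0// lerDl.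
by rewrite mulrC -ltr_pdivlMr.
Qed.

Lemma uniform_roe_sum I (s : seq I) (F : I -> B) :
  (forall i, uniform_roe Z (F i)) -> uniform_roe Z (\sum_(i <- s) F i).
Proof.
move=> rF; elim: s => [|i s IH]; first by rewrite big_nil; exact: uniform_roe0.
by rewrite big_cons; exact: uniform_roeD.
Qed.

Lemma uniform_roeM a b : uniform_roe Z a -> uniform_roe Z b -> uniform_roe Z (a * b).
Proof.
move=> /uniform_roeP ra /uniform_roeP rb; apply/uniform_roeP => e e0.
have e2 : 0 < e / 2 by rewrite divr_gt0.
have A0 : 0 < opnorm b + 1 by rewrite ltr_wpDl// opnorm_ge0.
have [a' [s [sa aa]]] := ra (e / 2 / (opnorm b + 1)) (divr_gt0 e2 A0).
have B0 : 0 < opnorm a' + 1 by rewrite ltr_wpDl// opnorm_ge0.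
have [b' [t [tb bb]]] := rb (e / 2 / (opnorm a' + 1)) (divr_gt0 e2 B0).
exists (a' * b'), (s + t); split; first exact: fpropM.
have -> : a * b - a' * b' = (a - a') * b + a' * (b - b').
  by rewrite mulrBl mulrBr addrA subrK.
apply: le_lt_trans (opnormD _ _) _; rewrite [ltRHS]splitr; apply: ltrD.
  apply: le_lt_trans (opnormM _ _) _.
  apply: (@le_lt_trans _ _ (opnorm (a - a') * (opnorm b + 1))).
    by rewrite ler_wpM2l ?opnorm_ge0// lerDl.
  by rewrite -ltr_pdivlMr.
apply: le_lt_trans (opnormM _ _) _.
apply: (@le_lt_trans _ _ ((opnorm a' + 1) * opnorm (b - b'))).
  by rewrite ler_wpM2r ?opnorm_ge0// lerDl.
by rewrite mulrC -ltr_pdivlMr.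
Qed.

Lemma rk1_delta_roe w z : uniform_roe Z (rk1 (delta w) (delta z)).
Proof.
apply: (@fprop_roe (mdist w z)) => u v; rewrite rk1E inner_delta ell2Z !deltaE.
by rewrite mulf_eq0 negb_or !pnatr_eq0 !eqb0 !negbK => /andP[/eqP<- /eqP->]; rewrite metric_sym.
Qed.

(** Truncating both vectors leaves a finite combination of matrix units. So every rank-one operator
    lies in the algebra, and heredity can be tested on it. *)
Lemma rk1_roe v w : uniform_roe Z (rk1 v w).
Proof.
apply: uniform_roe_lim => e e0.
have B0 : 0 < l2norm v + l2norm w + 1 by rewrite ltr_wpDl// addr_ge0 ?l2norm_ge0.
have d0 : 0 < e / (l2norm v + l2norm w + 1) by rewrite divr_gt0.
have [s [us /(_ (mem s) (fun _ H => H)) vs]] := tail_small v d0.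
have [t [ut /(_ (mem t) (fun _ H => H)) wt]] := tail_small w d0.
exists (rk1 (trunc (mem s) v) (trunc (mem t) w)); split.
  have -> : rk1 (trunc (mem s) v) (trunc (mem t) w) =
     \sum_(i <- s) \sum_(j <- t) (v i * conjc (w j)) *: rk1 (delta i) (delta j).
    apply: bopP => x; rewrite rk1E bop_sumE (trunc_sum v us) scaler_sumr.
    apply: eq_bigr => i _; rewrite bop_sumE (trunc_sum w ut) inner_sumr scaler_suml.
    apply: eq_bigr => j _; rewrite bopZE rk1E innerZr !scalerA; congr (_ *: _).
    by ring.
  by apply: uniform_roe_sum => i; apply: uniform_roe_sum => j;
     apply: uniform_roeZ; exact: rk1_delta_roe.
have -> : rk1 v w - rk1 (trunc (mem s) v) (trunc (mem t) w) =
   rk1 (v - trunc (mem s) v) w + rk1 (trunc (mem s) v) (w - trunc (mem t) w).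
  by rewrite rk1Bl rk1Br addrA subrK.
apply: le_lt_trans (opnormD _ _) _.
apply: (@le_lt_trans _ _ (e / (l2norm v + l2norm w + 1) * (l2norm v + l2norm w))).
  rewrite mulrDr addrC; apply: lerD.
    apply: le_trans (opnorm_rk1 _ _) _; rewrite mulrC.
    apply: ler_pM; [exact: l2norm_ge0|exact: l2norm_ge0|exact: ltW|exact: l2norm_trunc].
  apply: le_trans (opnorm_rk1 _ _) _.
  exact: (ler_wpM2r (l2norm_ge0 w) (ltW vs)).
rewrite mulrAC ltr_pdivrMr// ltr_pM2l//.
by rewrite ltrDl.
Qed.

Lemma fprop_proj (D : {pred Z}) : fprop 0 (proj D).
Proof.
move=> w z; rewrite projE truncE deltaE; case: ifP => _; last by rewrite eqxx.
by rewrite pnatr_eq0 eqb0 negbK => /eqP->; rewrite mdistxx.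
Qed.

Lemma proj_roe (D : {pred Z}) : uniform_roe Z (proj D).
Proof. exact: fprop_roe (@fprop_proj D). Qed.

End UniformRoe.

#[global] Opaque trunc rk1 proj.

(** * Operators from kernels of bounded propagation *)

Section BandOperators.
Context {R : realType} {Z : metricType R}.
Implicit Types w z : Z.

Lemma ulf_ball (r : R) : uniformly_locally_finite Z ->
  exists (N : nat) (bs : Z -> seq Z), forall z,
    [/\ uniq (bs z), forall w, (w \in bs z) = (mdist z w <= r) & (size (bs z) <= N)%N].
Proof.
move=> ulfZ; have [r0|r0] := leP 0 r; last first.
  exists 0%N, (fun=> [::]) => z; split => // w.
  by apply/esym/negbTE; rewrite -ltNge; apply: lt_le_trans r0 _; exact: mdist_ge0.
have [N HN] := ulfZ r r0; exists N.
exists (fun z => finmap.enum_fset (fset_set [set w | mdist z w <= r])) => z.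
have fin : finite_set [set w | mdist z w <= r].
  by apply: card_le_finite (HN z) _; exact: finite_II.
split; first exact: finmap.fset_uniq.
  by move=> w; apply/idP/idP => [|dzw]; have := in_fset_set fin w => ->; rewrite ?inE.
exact: geq_card_fset_set.
Qed.

(* A crude constant suffices here, since balls have bounded size. *)
Lemma abs2_sum_le I (s : seq I) (f : I -> R[i]) :
  abs2 (\sum_(i <- s) f i) <= 2 ^+ size s * \sum_(i <- s) abs2 (f i).
Proof.
elim: s => [|i s IH]; first by rewrite !big_nil abs2_0 mulr0.
rewrite !big_cons /= exprS.
have lei := abs2D (f i) (\sum_(j <- s) f j) ltr01.
apply: le_trans lei _; rewrite invr1 (_ : 1 + 1 = 2)// -mulrDr -mulrA ler_wpM2l// mulrDr.
by rewrite lerD// ler_peMl ?abs2_ge0// exprn_ege1// ler1n.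
Qed.

(** A Schur-type test. [M] is chosen before the kernel and so bounds all kernels of this propagation
    and size at once; gluing infinitely many operators relies on this order of quantifiers. *)
Lemma band_ex (r C : R) : uniformly_locally_finite Z -> 0 <= C ->
  exists M : R, 0 <= M /\ forall k : Z -> Z -> R[i],
    (forall w z, k w z != 0 -> mdist w z <= r) ->
    (forall w z, cabs (k w z) <= C) ->
    exists a : bop R Z, (forall w z, a (delta w) z = k w z) /\ opnorm a <= M.
Proof.
move=> ulfZ C0; have [N [bs bsP]] := ulf_ball r ulfZ.
(* A row has at most [N] terms, which costs $2^N C^2$; a column meets at most [N] rows. *)
pose M2 : R := 2 ^+ N * C ^+ 2 * N%:R.
have M20 : 0 <= M2 by rewrite !mulr_ge0 ?exprn_ge0.
exists (Num.sqrt M2); split; first exact: sqrtr_ge0.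
move=> k kr kC.
pose F (x : ell2 R Z) z := \sum_(w <- bs z) k w z * x w.
have [|c x y z|x s us|a [aE aM]] := @bop_ex R Z F (Num.sqrt M2).
- exact: sqrtr_ge0.
- rewrite /F mulr_sumr -big_split; apply: eq_bigr => w _ /=.
  by rewrite ell2D ell2Z; ring.
- rewrite exprMn sqr_sqrtr//.
  pose t := undup (flatten (map bs s)).
  have ut : uniq t by exact: undup_uniq.
  apply: (@le_trans _ _ (\sum_(z <- s) 2 ^+ N * C ^+ 2 * \sum_(w <- t | w \in bs z) abs2 (x w))).
    rewrite big_seq [leRHS]big_seq; apply: ler_sum => z zs; apply: le_trans (abs2_sum_le _ _) _.
    have [ub mb sb] := bsP z.
    have -> : \sum_(w <- t | w \in bs z) abs2 (x w) = \sum_(w <- bs z) abs2 (x w).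
      rewrite -big_filter; apply: perm_big; apply: uniq_perm => //.
        by rewrite filter_uniq.
      move=> w; rewrite mem_filter; case: (boolP (w \in bs z)) => //= wb.
      rewrite mem_undup; apply/flattenP; exists (bs z) => //; exact: map_f.
    rewrite -mulrA; apply: ler_pM; rewrite ?exprn_ge0//.
    + by apply: sumr_ge0 => w _; exact: abs2_ge0.
    + by rewrite ler_weXn2l// ler1n.
    rewrite mulr_sumr; apply: ler_sum => w _; rewrite abs2M ler_wpM2r ?abs2_ge0//.
    by rewrite -cabs_abs2.
  rewrite -mulr_sumr /M2 -[leRHS]mulrA; apply: ler_wpM2l.
    by rewrite mulr_ge0 ?exprn_ge0.
  under eq_bigr do rewrite big_mkcond.
  rewrite exchange_big; apply: (@le_trans _ _ (\sum_(w <- t) N%:R * abs2 (x w))).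
    apply: ler_sum => w _; rewrite -big_mkcond -big_filter big_const_seq.
    rewrite count_predT iter_addr_0 -[leLHS]mulr_natl ler_wpM2r ?abs2_ge0// ler_nat.
    have [ub mb sb] := bsP w; apply: leq_trans sb; apply: uniq_leq_size.
      by rewrite filter_uniq.
    move=> z; rewrite mem_filter => /andP[+ _]; have [_ -> _] := bsP z.
    by rewrite mb metric_sym.
  by rewrite -mulr_sumr; apply: ler_wpM2l => //; exact: l2norm_sum_le.
exists a; split => // w z; rewrite aE /F.
have [ub mb sb] := bsP z; have [wb|wb] := boolP (w \in bs z).
  rewrite (bigD1_seq w)//= deltaE eqxx mulr1 big1 ?addr0// => w' w'w.
  by rewrite deltaE (negbTE w'w) mulr0.
rewrite big1_seq; last first.
  move=> w' /andP[_ w'b]; rewrite deltaE; case: eqP => [ww|_]; last by rewrite mulr0.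
  by rewrite -ww w'b in wb.
by apply/esym/eqP; apply: contraNT wb => /kr; rewrite mb metric_sym.
Qed.

End BandOperators.

(** * The isometry implementing a hereditary embedding *)

Section HereditaryEmbedding.
Context {R : realType} {X Y : metricType R} (Phi : bop R X -> bop R Y).
Hypothesis Phi_hom : star_homomorphism (uniform_roe X) (uniform_roe Y) Phi.
Hypothesis Phi_inj : set_inj (uniform_roe X) Phi.
Hypothesis Phi_her : hereditary_subalgebra (Phi @` uniform_roe X) (uniform_roe Y).
Local Notation A := (uniform_roe X).
Implicit Types (a b c : bop R X).

Lemma Phi_roe a : A a -> uniform_roe Y (Phi a).
Proof. by case: Phi_hom => H _ _ _ /H. Qed.

Lemma Phi0 : Phi 0 = 0.
Proof.
case: Phi_hom => _ /(_ (-1) 0 0 uniform_roe0 uniform_roe0) + _ _.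
by rewrite scaler0 addr0 scaleN1r addNr.
Qed.

Lemma PhiD a b : A a -> A b -> Phi (a + b) = Phi a + Phi b.
Proof.
move=> Aa Ab; case: Phi_hom => _ /(_ 1 a b Aa Ab) + _ _.
by rewrite !scale1r.
Qed.

Lemma PhiZ k a : A a -> Phi (k *: a) = k *: Phi a.
Proof.
move=> Aa; case: Phi_hom => _ /(_ k a 0 Aa uniform_roe0) + _ _.
by rewrite Phi0 !addr0.
Qed.

Lemma PhiM a b : A a -> A b -> Phi (a * b) = Phi a * Phi b.
Proof. by case: Phi_hom => _ _ H _ /H; apply. Qed.

Lemma Phi_adj a b : A a -> A b -> is_adjoint a b -> is_adjoint (Phi a) (Phi b).
Proof. by case: Phi_hom => _ _ _ H /H{}H /H; apply. Qed.

Lemma Phi_eq0 a : A a -> Phi a = 0 -> a = 0.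
Proof.
move=> Aa Pa0; apply: Phi_inj; rewrite ?inE//; first exact: uniform_roe0.
by rewrite Pa0 Phi0.
Qed.

Let e (x x' : X) : bop R X := rk1 (delta x) (delta x').

Let Ae x x' : A (e x x'). Proof. exact: rk1_roe. Qed.

Let e_mul x y z : e x y * e y z = e x z.
Proof. by rewrite /e rk1_rk1 inner_delta deltaE eqxx scale1r. Qed.

(** After applying [Phi], the left side is a corner of [Phi c] by rank-one operators; this is how
    the entries of a preimage are recovered from its image. *)
Lemma corner_entry c x x' : e x x * c * e x' x' = c (delta x') x *: e x x'.
Proof. by rewrite -mulrA mul_rk1 rk1_rk1 inner_delta. Qed.

(* [rk1 v v <= |v|^2 Phi a], so heredity applies. *)
Lemma range_rk1 a (v : ell2 R Y) : A a -> Phi a * Phi a = Phi a ->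
  is_adjoint (Phi a) (Phi a) -> Phi a v = v -> exists2 c, A c & Phi c = rk1 v v.
Proof.
move=> Aa qq qa qv.
have rv x : inner (rk1 v v x) x = (abs2 (inner x v))%:C.
  by rewrite rk1E innerZl (innerC v) mulJ_abs2.
case: Phi_her => _ /(_ (rk1 v v) (Phi ((l2norm v ^+ 2)%:C *: a))) [].
- exact: rk1_roe.
- by exists ((l2norm v ^+ 2)%:C *: a) => //; exact: uniform_roeZ.
- by move=> x; rewrite rv ler0c abs2_ge0.
- move=> x; rewrite bopBE innerBl rv PhiZ// bopZE innerZl.
  have -> : inner (Phi a x) x = inner (Phi a x) (Phi a x).
    by rewrite -[in LHS]qq bopME qa.
  rewrite inner_xx -rmorphM -rmorphB ler0c subr_ge0.
  rewrite -{1}qv -qa -cabs_sqr -exprMn ler_sqr ?nnegrE ?mulr_ge0 ?cabs_ge0 ?l2norm_ge0//.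
  by rewrite mulrC cauchy_schwarz.
- by move=> c Ac <-; exists c.
Qed.

(** The projection [q] is nonzero by injectivity. For $v=q\eta\ne0$ heredity gives $vv^*=\Phi(c)$.
    Cutting by [q] on both sides fixes $vv^*$ and reduces [c] to a multiple of $e_{x_0x_0}$, so
    $vv^*$ is a multiple of [q]; evaluation at [v] shows that the factor is $\|v\|^2$. *)
Lemma rk1_base (x0 : X) : exists2 xi0 : ell2 R Y, inner xi0 xi0 = 1 & Phi (e x0 x0) = rk1 xi0 xi0.
Proof.
set q := Phi (e x0 x0).
have qq : q * q = q by rewrite -PhiM// e_mul.
have qa : is_adjoint q q by apply: Phi_adj => //; exact: rk1_adjoint.
have [eta qeta] : exists eta, q eta != 0.
  apply: contrapT => H; have : q = 0.
    apply: bopP => x; rewrite bop0E; apply/eqP; apply: contrapT => qx.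
    by apply: H; exists x; apply/negP.
  move=> /(Phi_eq0 (@Ae x0 x0)) /rk1_eq0 /(congr1 (@l2norm R X)).
  by rewrite l2norm_delta l2norm0 => /eqP; rewrite oner_eq0.
set v := q eta in qeta.
have qv : q v = v by rewrite /v -bopME qq.
have [c Ac cE] := range_rk1 (@Ae x0 x0) qq qa qv.
have vE : rk1 v v = c (delta x0) x0 *: q.
  rewrite -PhiZ// -corner_entry !PhiM//; last exact: uniform_roeM.
  by rewrite cE mul_rk1 (rk1_mul _ _ qa) qv.
have nv : l2norm v != 0 by apply: contra_neq qeta => /l2norm0_eq0.
have cv : c (delta x0) x0 = (l2norm v ^+ 2)%:C.
  move: vE => /(congr1 (fun a : bop R Y => a v)); rewrite bopZE qv rk1E inner_xx.
  by move=> /eqP; rewrite -subr_eq0 -scalerBl scaler_eq0 (negbTE qeta) orbF subr_eq0 => /eqP.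
exists ((l2norm v)^-1%:C *: v).
  rewrite innerZl innerZr inner_xx conjc_real -!rmorphM -[RHS]/(1%:C).
  by congr (_%:C); field.
rewrite rk1Zl rk1Zr conjc_real vE cv !scalerA -!rmorphM.
rewrite -[LHS]scale1r; congr (_ *: _); rewrite -[LHS]/(1%:C); congr (_%:C).
by field.
Qed.

(** All [xi x] are transported from one base vector by images of matrix units. Chosen separately
    from the rank-one projections, they would be determined only up to phase and the off-diagonal
    units would not match. *)
Lemma matrix_units (x0 : X) : exists xi : X -> ell2 R Y,
  (forall x x', inner (xi x) (xi x') = (x == x')%:R) /\
  (forall x x', Phi (rk1 (delta x) (delta x')) = rk1 (xi x) (xi x')).
Proof.
have [xi0 n0 q0] := rk1_base x0.
exists (fun x => Phi (e x x0) xi0).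
have adj x x' : is_adjoint (Phi (e x x')) (Phi (e x' x)).
  by apply: Phi_adj => //; exact: rk1_adjoint.
split=> x x'.
  rewrite adj -bopME -PhiM// /e rk1_rk1 inner_delta deltaE (PhiZ _ (@Ae x0 x0)) q0.
  by rewrite bopZE rk1E n0 scale1r innerZr n0 mulr1 conjc_nat.
have -> : rk1 (delta x) (delta x') = e x x0 * (e x0 x0 * e x0 x') by rewrite !e_mul.
rewrite !PhiM//; last exact: uniform_roeM.
by rewrite q0 (rk1_mul _ _ (adj x0 x')) mul_rk1.
Qed.

Section Implemented.
Context (xi : X -> ell2 R Y).
Hypothesis xi_ortho : forall x x', inner (xi x) (xi x') = (x == x')%:R.
Hypothesis xi_units : forall x x', Phi (rk1 (delta x) (delta x')) = rk1 (xi x) (xi x').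
Implicit Types (v w : ell2 R Y).

Lemma ana_ex w : exists u : ell2 R X,
  (forall x, u x = inner w (xi x)) /\ l2norm u <= l2norm w.
Proof. by apply: ell2_ex; [exact: l2norm_ge0|move=> s us; exact: bessel]. Qed.

(* The adjoint of the isometry sending [delta x] to [xi x]. *)
Definition ana w : ell2 R X := projT1 (cid (ana_ex w)).

Lemma anaE w x : ana w x = inner w (xi x).
Proof. by rewrite /ana; case: cid => ? []. Qed.

Lemma l2norm_ana w : l2norm (ana w) <= l2norm w.
Proof. by rewrite /ana; case: cid => ? []. Qed.

Opaque ana.

Lemma ana_linear k v w : ana (k *: v + w) = k *: ana v + ana w.
Proof. by apply: ell2P => x; rewrite ell2D ell2Z !anaE innerDl innerZl. Qed.

Lemma ana0 : ana 0 = 0.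
Proof. by apply: ell2P => x; rewrite anaE inner0l. Qed.

Let p := Phi 1.
Let A1 : A 1. Proof. exact: uniform_roe1. Qed.

Lemma Phi1_idem : p * p = p.
Proof. by rewrite -PhiM// mulr1. Qed.

Lemma Phi1_adj : is_adjoint p p.
Proof. by apply: Phi_adj => //; exact: is_adjoint1. Qed.

Lemma l2norm_xi x : l2norm (xi x) = 1.
Proof.
have : (l2norm (xi x) ^+ 2)%:C = 1%:C by rewrite -inner_xx xi_ortho eqxx.
by move=> [] /eqP; rewrite sqrp_eq1 ?l2norm_ge0// => /eqP.
Qed.

Lemma xi_neq0 x : xi x != 0.
Proof.
by apply/eqP => /(congr1 (@l2norm R Y)); rewrite l2norm_xi l2norm0 => /eqP; rewrite oner_eq0.
Qed.

Lemma Phi1_xi x : p (xi x) = xi x.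
Proof.
have H : Phi (e x x) (xi x) = xi x by rewrite xi_units rk1E xi_ortho eqxx scale1r.
by rewrite -{1}H -bopME -PhiM// mul1r.
Qed.

Lemma inner_Phi1_xi w x : inner (p w) (xi x) = inner w (xi x).
Proof. by rewrite Phi1_adj Phi1_xi. Qed.

Lemma rk1_cancel (k k' : R[i]) v w : v != 0 -> w != 0 ->
  k *: rk1 v w = k' *: rk1 v w -> k = k'.
Proof.
move=> v0 w0 /eqP; rewrite -subr_eq0 -scalerBl scaler_eq0 subr_eq0 => /orP[/eqP//|].
move=> /eqP/(congr1 (fun a : bop R Y => a w)); rewrite rk1E bop0E inner_xx => /eqP.
rewrite scaler_eq0 (negbTE v0) orbF => /eqP[] /eqP; rewrite sqrf_eq0 => /eqP/l2norm0_eq0 w0'.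
by rewrite w0' eqxx in w0.
Qed.

(** Heredity does the work of continuity: [rk1 (p w) (p w)] is some [Phi c], and its corners show
    that [c] has the entries of [rk1 (ana w) (ana w)]. *)
Lemma Phi_rk1_ana w : Phi (rk1 (ana w) (ana w)) = rk1 (p w) (p w).
Proof.
have [c Ac cE] : exists2 c, A c & Phi c = rk1 (p w) (p w).
  by apply: (@range_rk1 1) => //; [exact: Phi1_idem|exact: Phi1_adj|rewrite -bopME Phi1_idem].
rewrite -cE; congr Phi; apply/esym/bop_eq_entries => x' x.
rewrite rk1E inner_deltal ell2Z !anaE.
apply: (rk1_cancel (xi_neq0 x) (xi_neq0 x')); rewrite -xi_units -(PhiZ _ (@Ae x x')) -corner_entry.
rewrite !PhiM//; last exact: uniform_roeM.
rewrite cE !xi_units rk1_rk1 inner_Phi1_xi scale_bopAl rk1_rk1.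
by rewrite (innerC (xi x')) inner_Phi1_xi scalerA mulrC.
Qed.

(** Squaring $vv^*$ multiplies it by $\|v\|^2$, and [Phi] respects squares. The identity expresses
    $UU^*=\Phi(1)$: the [xi x] form an orthonormal basis of the range of [p]. *)
Lemma parseval w : l2norm (ana w) = l2norm (p w).
Proof.
have [pw|pw] := eqVneq (p w) 0.
  have : rk1 (ana w) (ana w) = 0.
    apply: Phi_eq0; first exact: rk1_roe.
    by rewrite Phi_rk1_ana pw; apply: bopP => x; rewrite rk1E scaler0.
  by move=> /rk1_eq0->; rewrite pw !l2norm0.
have Ar := @rk1_roe R X (ana w) (ana w).
have := PhiM Ar Ar; rewrite rk1_rk1 PhiZ// Phi_rk1_ana rk1_rk1 => /(rk1_cancel pw pw).
rewrite !inner_xx => -[] /eqP.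
by rewrite eqrXn2 ?l2norm_ge0// => /eqP.
Qed.

Lemma inner_ana v w : inner (ana v) (ana w) = inner (p v) (p w).
Proof.
apply: polarization; [exact: ana_linear|by move=> *; rewrite bopD bopZ|exact: parseval].
Qed.

Lemma ana_Phi a w : A a -> ana (Phi a w) = a (ana w).
Proof.
move=> Aa; have paw : Phi a w = Phi a (p w) by rewrite -bopME -PhiM// mulr1.
have [u0|u0] := eqVneq (ana w) 0.
  have /l2norm0_eq0 pw : l2norm (p w) = 0 by rewrite -parseval u0 l2norm0.
  by rewrite paw pw u0 !bop0 ana0.
have pw : p w != 0.
  by apply: contra_neq u0 => pw; apply: l2norm0_eq0; rewrite parseval pw l2norm0.
set u := ana w in u0 *.
have Au (t : ell2 R X) : A (rk1 t u) by exact: rk1_roe.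
have [x1 ux1] : exists x1, u x1 != 0.
  apply: contrapT => H; move/eqP: u0; apply; apply: ell2P => x.
  by apply/eqP; apply: contrapT => ux; apply: H; exists x; apply/negP.
have corner a' x : A a' ->
    Phi ((a' u) x *: rk1 (delta x) u) = inner (Phi a' (p w)) (xi x) *: rk1 (xi x) (p w).
  move=> Aa'; have -> : (a' u) x *: rk1 (delta x) u = e x x * (a' * rk1 u u).
    by rewrite mul_rk1 rk1_rk1 inner_delta.
  rewrite !PhiM//; last exact: uniform_roeM.
  have E1 : Phi (e x x) = rk1 (xi x) (xi x) by exact: xi_units.
  have E2 : Phi (rk1 u u) = rk1 (p w) (p w) by exact: Phi_rk1_ana.

  rewrite E1.
  rewrite E2.
  rewrite mul_rk1.
  by rewrite rk1_rk1.
(* With [a' = 1] the identity [corner] carries the factor [u x], which cancels only where it is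
   nonzero, hence the choice of [x1]; matrix units then carry the result to every [x]. *)
have step1 : Phi (rk1 (delta x1) u) = rk1 (xi x1) (p w).
  have := corner 1 x1 A1; rewrite bop1E PhiZ// -bopME Phi1_idem inner_Phi1_xi -anaE.
  by move=> /(congr1 (fun b : bop R Y => (u x1)^-1 *: b)); rewrite !scalerA mulVf// !scale1r.
have step x : Phi (rk1 (delta x) u) = rk1 (xi x) (p w).
  have -> : rk1 (delta x) u = e x x1 * rk1 (delta x1) u.
    by rewrite rk1_rk1 inner_delta deltaE eqxx scale1r.
  by rewrite PhiM// step1 xi_units rk1_rk1 xi_ortho eqxx scale1r.
apply: ell2P => x; rewrite anaE.
have := corner a x Aa; rewrite PhiZ// step -paw => /esym.
by apply: rk1_cancel; [exact: xi_neq0|].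
Qed.

(** The spatial formula $\Phi(a)=UaU^*$, tested on pairs of vectors. *)
Lemma inner_Phi a v w : A a -> inner (Phi a v) w = inner (a (ana v)) (ana w).
Proof.
move=> Aa; rewrite -ana_Phi// inner_ana -Phi1_adj -!bopME Phi1_idem.
by rewrite -PhiM// mul1r.
Qed.

Lemma range_linear (k k' : R[i]) (b b' : bop R Y) : (Phi @` A) b -> (Phi @` A) b' ->
  (Phi @` A) (k *: b + k' *: b').
Proof.
move=> [a Aa <-] [a' Aa' <-]; exists (k *: a + k' *: a').
  by apply: uniform_roeD; exact: uniform_roeZ.
by rewrite PhiD ?PhiZ//; exact: uniform_roeZ.
Qed.

(* [p (b + b') p + 2 |b| p] lies between [0] and [4 |b| p]. *)
Lemma range_real_part (b b' : bop R Y) : uniform_roe Y b -> uniform_roe Y b' ->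
  is_adjoint b b' -> (Phi @` A) (p * b * p + p * b' * p).
Proof.
move=> rb rb' bb'.
have rp : uniform_roe Y p by exact: Phi_roe.
have Sp : (Phi @` A) p by exists 1.
pose K := 2 * opnorm b; pose h := p * b * p + p * b' * p + K%:C *: p.
have K0 : 0 <= K by rewrite mulr_ge0// opnorm_ge0.
have pw w : inner (p w) w = (l2norm (p w) ^+ 2)%:C.
  by rewrite -{1}Phi1_idem bopME Phi1_adj inner_xx.
have hw w : inner (h w) w = (2 * Re (inner (b (p w)) (p w)) + K * l2norm (p w) ^+ 2)%:C.
  rewrite !bopDE !innerDl bopZE innerZl pw !bopME !(Phi1_adj _ w).
  have -> : inner (b' (p w)) (p w) = conjc (inner (b (p w)) (p w)).
    by rewrite bb' -innerC.
  case: (inner _ _) => s t; apply/eqP; rewrite eq_complex /=.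
  by apply/andP; split; apply/eqP; ring.
have bound w : `|Re (inner (b (p w)) (p w))| <= opnorm b * l2norm (p w) ^+ 2.
  by apply: le_trans (Re_cabs _) _; rewrite expr2 mulrA; exact: cabs_inner_op.
have Sh : (Phi @` A) h.
  case: Phi_her => _ /(_ h ((K + K)%:C *: p)) H; apply: H.
  - apply: uniform_roeD; last exact: uniform_roeZ.
    by apply: uniform_roeD; do 2!apply: uniform_roeM => //.
  - by have := range_linear (K + K)%:C 0 Sp Sp; rewrite scale0r addr0.
  - move=> w; rewrite hw ler0c.
    have := bound w; rewrite ler_norml /K => /andP[+ _].
    rewrite -[2 * _ * _]mulrA; move: (Re _) (opnorm b * _) => ? ?; lra.
  - move=> w; rewrite bopBE innerBl hw bopZE innerZl pw -rmorphM -rmorphB ler0c.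
    have := bound w; rewrite ler_norml /K => /andP[_].
    rewrite mulrDl -[2 * _ * _]mulrA; move: (Re _) (opnorm b * _) => ? ?; lra.
have := range_linear 1 (- K%:C) Sh Sp.
by rewrite scale1r scaleNr /h addrK.
Qed.

(** Heredity speaks of positive operators, so $pbp$ is assembled from the self-adjoint parts
    belonging to $b$ and $ib$: $pbp=\frac12(pbp+pb^*p)-\frac i2(i\,pbp-i\,pb^*p)$. Corners of its
    preimage give the entries of $U^*bU$. *)
Lemma compression (b b' : bop R Y) : uniform_roe Y b -> uniform_roe Y b' ->
  is_adjoint b b' ->
  exists2 c, A c & forall x x', c (delta x) x' = inner (b (xi x)) (xi x').
Proof.
move=> rb rb' bb'.
have S1 := range_real_part rb rb' bb'.
have S2 : (Phi @` A) (p * ('i%C *: b) * p + p * ((- 'i%C) *: b') * p).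
  apply: range_real_part; rewrite ?uniform_roeZ//; try exact: uniform_roeZ.
  move=> v w; rewrite !bopZE innerZl innerZr bb'; congr (_ * _).
  by apply/eqP; rewrite eq_complex /= oppr0 opprK !eqxx.
have ii : 'i%C * 'i%C = -1 :> R[i] by rewrite -sqr_i.
have [c Ac cE] : (Phi @` A) (p * b * p).
  have := range_linear (2^-1) (- 'i%C / 2) S1 S2; congr (_ _).
  rewrite !scale_bopAr !scale_bopAl !scalerDr !scalerA.
  have -> : - 'i%C / 2 * 'i%C = 2^-1 :> R[i].
    by rewrite mulrAC mulNr ii opprK mul1r.
  have -> : - 'i%C / 2 * - 'i%C = - 2^-1 :> R[i].
    by rewrite mulrAC mulrNN ii mulN1r.
  rewrite addrACA -scalerDl scaleNr subrr addr0 -div1r -splitr scale1r.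
  by [].
exists c => // x x'.
apply: (rk1_cancel (xi_neq0 x') (xi_neq0 x)); rewrite -xi_units -(PhiZ _ (@Ae x' x)) -corner_entry.
rewrite !PhiM//; last exact: uniform_roeM.
by rewrite cE !xi_units -!mulrA !mul_rk1 rk1E Phi1_xi rk1Zl inner_Phi1_xi.
Qed.

End Implemented.
End HereditaryEmbedding.

#[global] Opaque ana.

(** * Approximability at a uniform scale *)

Section UniformApproximation.
Context {R : realType}.

Definition separated (Q : metricType R) (s : R) (x y : ell2 R Q) :=
  forall w z, x w != 0 -> y z != 0 -> s < mdist w z.

Lemma separated_mono (Q : metricType R) (s t : R) (x y : ell2 R Q) :
  s <= t -> separated t x y -> separated s x y.
Proof. by move=> st sep w z xw yz; apply: le_lt_trans st (sep _ _ xw yz). Qed.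

Lemma separated_small (Q : metricType R) (c : bop R Q) (e : R) :
  uniform_roe Q c -> 0 < e ->
  exists s, forall x y, l2norm x <= 1 -> l2norm y <= 1 -> separated s x y ->
    cabs (inner (c x) y) <= e.
Proof.
move=> /uniform_roeP rc e0; have [b [s [sb cb]]] := rc _ e0.
exists s => x y x1 y1 sep.
have -> : inner (c x) y = inner ((c - b) x) y.
  by rewrite bopBE innerBl (fprop_inner0 sb sep) subr0.
apply: le_trans (cabs_inner_op _ _ _) _.
apply: (@le_trans _ _ (opnorm (c - b) * 1 * 1)); last by rewrite !mulr1 ltW.
apply: ler_pM => //; rewrite ?mulr_ge0 ?l2norm_ge0 ?opnorm_ge0//.
by rewrite ler_wpM2l ?opnorm_ge0.
Qed.

Lemma inner_trunc_seq (Q : choiceType) (D : bop R Q) (G : seq Q) (x y : ell2 R Q) : uniq G ->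
  inner (D (trunc (mem G) x)) (trunc (mem G) y) =
  \sum_(p <- [seq (w, z) | w <- G, z <- G]) D (delta p.1) p.2 * (x p.1 * conjc (y p.2)).
Proof.
move=> uG; rewrite !(trunc_sum _ uG) bop_sum inner_suml big_allpairs.
apply: eq_bigr => w _; rewrite inner_sumr; apply: eq_bigr => z _ /=.
by rewrite bopZ innerZl innerZr inner_delta; ring.
Qed.

(** One setting for both directions. For $UaU^*$, [P] is $X$, [emb] is the identity and [tr] is
    $U^*$; for $U^*bU$, [P] is $Y$, [emb] is [delta] and [tr] is [xi]. *)
Context (P Q : metricType R) (T : Type) (emb : T -> ell2 R Q) (tr : T -> ell2 R P).
Hypothesis ulfP : uniformly_locally_finite P.
Hypothesis tr_le : forall t, l2norm (tr t) <= l2norm (emb t).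
Hypothesis impl : forall r (a : bop R P), fprop r a -> exists c, uniform_roe Q c /\
  forall t t', inner (c (emb t)) (emb t') = inner (a (tr t)) (tr t').

Let coef t t' (p : P * P) := cabs (tr t p.1 * conjc (tr t' p.2)).

(** Each pair in [L] is tested by its matrix unit, whose counterpart over [Q] is approximable at
    some scale, and a finite list has a common one. So vectors far enough apart put almost no joint
    weight on a region already used. *)
Lemma entries_small (L : seq (P * P)) (e : R) : 0 < e ->
  exists s, forall t t', l2norm (emb t) <= 1 -> l2norm (emb t') <= 1 ->
    separated s (emb t) (emb t') -> \sum_(p <- L) coef t t' p <= e.
Proof.
elim: L e => [|p L IH] e e0; first by exists 0 => t t' _ _ _; rewrite big_nil ltW.
have e2 : 0 < e / 2 by rewrite divr_gt0.
have [s1 H1] := IH _ e2.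
have pf : fprop (mdist p.1 p.2) (rk1 (delta p.2) (delta p.1) : bop R P).
  move=> u v; rewrite rk1E inner_delta ell2Z !deltaE.
  by rewrite mulf_eq0 negb_or !pnatr_eq0 !eqb0 !negbK => /andP[/eqP<- /eqP->].
have [c [rc cE]] := impl pf; have [s2 H2] := separated_small rc e2.
exists (Num.max s1 s2) => t t' nt nt' sep; rewrite big_cons [leRHS]splitr; apply: lerD.
  have := H2 _ _ nt nt'; rewrite cE rk1E inner_delta innerZl inner_deltal; apply.
  by apply: separated_mono sep; rewrite le_max lexx orbT.
by apply: H1 => //; apply: separated_mono sep; rewrite le_max lexx.
Qed.

(* Gliding hump: if operators of propagation [r] violated the bound at every
   scale, then pieces of the violating operators, living on disjoint finite
   regions, would assemble into one such operator whose image lies outside the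
   uniform Roe algebra. *)
Lemma equi_approximable (r e : R) : 0 < e -> exists s, forall a : bop R P,
  fprop r a -> (forall w z, cabs (a (delta w) z) <= 1) ->
  forall t t', l2norm (emb t) <= 1 -> l2norm (emb t') <= 1 ->
    separated s (emb t) (emb t') -> cabs (inner (a (tr t)) (tr t')) <= e.
Proof.
move=> e0; apply: contrapT => noS.
(* The bound 2 on entries covers the difference of two operators with entries at most 1. *)
have [M [M0 HM]] := band_ex r ulfP (ler0n R 2).
have bandM (a : bop R P) : fprop r a -> (forall w z, cabs (a (delta w) z) <= 2) -> opnorm a <= M.
  move=> ra a2; have [b [bE bM]] := HM (fun w z => a (delta w) z) ra a2.
  by rewrite (_ : a = b)//; apply: bop_eq_entries => w z; rewrite bE.
pose bad s (q : bop R P * T * T) :=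
  [/\ fprop r q.1.1, forall w z, cabs (q.1.1 (delta w) z) <= 1,
      l2norm (emb q.1.2) <= 1 /\ l2norm (emb q.2) <= 1,
      separated s (emb q.1.2) (emb q.2)
    & e < cabs (inner (q.1.1 (tr q.1.2)) (tr q.2))].
have bad_ex s : exists q, bad s q.
  apply: contrapT => nq; apply: noS; exists s => a ra a1 t t' nt nt' sep.
  by rewrite leNgt; apply/negP => lt; apply: nq; exists (a, t, t').
(* Two truncation errors meet an operator of norm at most $2M$: in total $4M\eta\le e/4$. *)
pose eta := e / (16 * (M + 1)).
have M1 : 0 < 16 * (M + 1) by rewrite mulr_gt0// ltr_wpDl.
have eta0 : 0 < eta by rewrite divr_gt0.
(* The input is a scale and the finite region used so far; the output is a violating operator with
   its two vectors, almost supported in a larger region and of small joint weight on the old one. *)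
pose step (i : nat * seq P) (o : bop R P * T * T * seq P) :=
  [/\ bad i.1%:R o.1,
      \sum_(p <- [seq (w, z) | w <- i.2, z <- i.2]) coef o.1.1.2 o.1.2 p <= e / 8,
      {subset i.2 <= o.2} /\ uniq o.2,
      l2norm (tr o.1.1.2 - trunc (mem o.2) (tr o.1.1.2)) <= eta
    & l2norm (tr o.1.2 - trunc (mem o.2) (tr o.1.2)) <= eta].
have /choice[next nextP] : forall i, exists o, step i o.
  move=> [n G]; have e8 : 0 < e / 8 by rewrite divr_gt0.
  have [s Hs] := entries_small [seq (w, z) | w <- G, z <- G] e8.
  have [q qb] := bad_ex (Num.max s n%:R).
  have [ra a1 [nt nt'] sep lt] := qb.
  have [s1 [us1 H1]] := tail_small (tr q.1.2) eta0.
  have [s2 [us2 H2]] := tail_small (tr q.2) eta0.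
  exists (q, undup (G ++ s1 ++ s2)); split => /=.
  - by split => //; apply: separated_mono sep; rewrite le_max lexx orbT.
  - by apply: Hs => //; apply: separated_mono sep; rewrite le_max lexx.
  - split; last exact: undup_uniq.
    by move=> w wG; rewrite mem_undup mem_cat wG.
  - apply/ltW/H1 => w ws; change (w \in undup (G ++ s1 ++ s2)).
    by rewrite mem_undup !mem_cat ws orbT.
  - apply/ltW/H2 => w ws; change (w \in undup (G ++ s1 ++ s2)).
    by rewrite mem_undup !mem_cat ws !orbT.
pose G := fix G n := if n is m.+1 then (next (m, G m)).2 else [::].
pose q n := (next (n, G n)).1.
have GS n : {subset G n <= G n.+1} by have [_ _ [sG _] _ _] := nextP (n, G n).
have Gmono m n : (m <= n)%N -> {subset G m <= G n}.
  elim: n => [|n IH]; first by rewrite leqn0 => /eqP->.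
  by rewrite leq_eqVlt => /orP[/eqP->//|/IH mn] w /mn; exact: GS.
have uG n : uniq (G n) by case: n => // n; have [_ _ [_ uG] _ _] := nextP (n, G n).
pose hit w z n := (w \in G n.+1) && (z \in G n.+1).
(* Each entry comes from the first stage whose region contains both points. Propagation and size are
   thereby inherited, and [k] agrees with stage [n] on pairs in [G n.+1] that are not both in
   [G n]. *)
pose k w z : R[i] := match pselect (exists n, hit w z n) with
  | left h => (q (ex_minn h)).1.1 (delta w) z | right _ => 0 end.
have kE n w z : hit w z n -> ~~ ((w \in G n) && (z \in G n)) -> k w z = (q n).1.1 (delta w) z.
  move=> h nh; rewrite /k; case: pselect => [h'|]; last by case; exists n.
  case: ex_minnP => m hm mmin; suff -> : m = n by [].
  apply/eqP; rewrite eqn_leq mmin// leqNgt; apply: contra nh => mn.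
  by case/andP: hm => /(Gmono _ _ mn)-> /(Gmono _ _ mn)->.
have kr w z : k w z != 0 -> mdist w z <= r.
  rewrite /k; case: pselect => [h|]; last by rewrite eqxx.
  by have [[ra _ _ _ _] _ _ _ _] := nextP (ex_minn h, G (ex_minn h)); exact: ra.
have k1 w z : cabs (k w z) <= 1.
  rewrite /k; case: pselect => [h|_]; last by rewrite cabs0.
  by have [[_ a1 _ _ _] _ _ _ _] := nextP (ex_minn h, G (ex_minn h)); exact: a1.
have k2 w z : cabs (k w z) <= 2 by apply: le_trans (k1 w z) _; rewrite ler1n.
have [a [aE aM]] := HM k kr k2.
have ra : fprop r a by move=> w z; rewrite aE; exact: kr.
have [c [rc cE]] := impl ra.
have e4 : 0 < e / 4 by rewrite divr_gt0.
have [s Hs] := separated_small rc e4.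
pose n := Num.bound `|s|.
have sn : s <= n%:R.
  by apply: le_trans (ler_norm s) _; apply/ltW/archi_boundP.
have [[rb b1 [nt nt'] sep] + sumG [GG' _] t1 t2] := nextP (n, G n).
rewrite -/(q n) in rb b1 nt nt' sep sumG t1 t2 *.
set b := (q n).1.1 in rb b1 *; set x := tr (q n).1.2 in t1 *; set y := tr (q n).2 in t2 *.
change (next (n, G n)).2 with (G n.+1) in t1, t2.
apply/negP; rewrite -leNgt.
have nx : l2norm x <= 1 by apply: le_trans (tr_le _) nt.
have ny : l2norm y <= 1 by apply: le_trans (tr_le _) nt'.
(* [D] vanishes on pairs in [G n.+1] not both in [G n]. Its old block [g * D * g] contributes at
   most $2\cdot e/8$, the rest only meets the tails, and the glued operator adds $e/4$: in total
   $3e/4$. *)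
pose D := a - b; pose g := proj (mem (G n)) : bop R P.
have DE w z : D (delta w) z = k w z - b (delta w) z by rewrite bopBE ell2B aE.
have D2 w z : cabs (D (delta w) z) <= 2.
  by rewrite DE; apply: le_trans (cabsB _ _) _; rewrite -[leRHS]/(1 + 1 : R) lerD.
have DM : opnorm D <= M.
  apply: bandM => //; apply: fpropD => //.
  by rewrite -scaleN1r; exact: fpropZ.
pose D' := D - g * D * g.
have D'M : opnorm D' <= 2 * M.
  have gM : opnorm (g * D * g) <= M.
    by apply: le_trans (opnorm_mul_proj _ _) (le_trans (opnorm_proj_mul _ _) DM).
  by apply: le_trans (opnormB _ _) _; rewrite (_ : 2 * M = M + M) ?lerD//; ring.
have bound1 : cabs (inner ((g * D * g) x) y) <= e / 4.
  rewrite !bopME !projE inner_trunc inner_trunc_seq//.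
  apply: le_trans (cabs_sum _ _) _.
  apply: (@le_trans _ _
    (\sum_(p <- [seq (w, z) | w <- G n, z <- G n]) 2 * coef (q n).1.2 (q n).2 p)).
    apply: ler_sum => p _; rewrite cabsM; apply: ler_wpM2r; first exact: cabs_ge0.
    exact: D2.
  rewrite -mulr_sumr; apply: (@le_trans _ _ (2 * (e / 8))).
    by rewrite ler_wpM2l.
  by rewrite le_eqVlt; apply/orP; left; apply/eqP; field.
have zero : inner (D' (trunc (mem (G n.+1)) x)) (trunc (mem (G n.+1)) y) = 0.
  apply: inner_supp0 => w z; rewrite !truncE.
  case: ifP; last by rewrite eqxx.
  move=> wG _; case: ifP; last by rewrite eqxx.
  move=> zG _; rewrite bopBE ell2B !bopME !projE.
  have tw : trunc (mem (G n)) (delta w) = (w \in G n)%:R *: (delta w : ell2 R P).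
    apply: ell2P => v; rewrite truncE ell2Z deltaE.
    case: eqP => [->|_]; last by rewrite mulr0; case: ifP.
    by rewrite (_ : (w \in mem (G n)) = (w \in G n))//; case: (w \in G n); rewrite ?mul1r ?mul0r.
  rewrite tw bopZ truncE ell2Z.
  have [/andP[wn zn]|nwz] := boolP ((w \in G n) && (z \in G n)).
    by rewrite ifT // wn mul1r subrr.
  have hwz : hit w z n by apply/andP; split; [exact: wG|exact: zG].
  have -> : D (delta w) z = 0 by rewrite DE (kE _ _ _ hwz nwz) subrr.
  by rewrite mulr0 if_same subr0.
have bound2 : cabs (inner (D' x) y) <= e / 4.
  set x' := trunc (mem (G n.+1)) x in t1 zero; set y' := trunc (mem (G n.+1)) y in t2 zero.
  have -> : inner (D' x) y = inner (D' (x - x')) y + inner (D' x') (y - y').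
    by rewrite innerBr zero subr0 -innerDl -bopD subrK.
  apply: le_trans (cabsD _ _) _.
  have nx' : l2norm x' <= 1 by apply: le_trans (l2norm_trunc _ _) nx.
  apply: le_trans (lerD (cabs_inner_le D'M t1 ny) (cabs_inner_le D'M nx' t2)) _.
  have <- : 16 * (M + 1) * eta = e by rewrite mulrCA divff ?mulr1// gt_eqF.
  have -> : 16 * (M + 1) * eta / 4 = 4 * M * eta + 4 * eta by field.
  have -> : 2 * M * eta * 1 + 2 * M * 1 * eta = 4 * M * eta by ring.
  by rewrite lerDl mulr_ge0// ltW.
have -> : inner (b x) y = inner (a x) y - (inner ((g * D * g) x) y + inner (D' x) y).
  rewrite -innerDl -bopDE (_ : g * D * g + D' = D); last by rewrite addrC subrK.
  by rewrite bopBE innerBl opprB [RHS]addrC subrK.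
apply: le_trans (cabsB _ _) _.
have ba : cabs (inner (a x) y) <= e / 4.
  by rewrite -cE; apply: Hs => //; apply: separated_mono sep.
apply: le_trans (lerD ba (le_trans (cabsD _ _) (lerD bound1 bound2))) _.
have -> : e / 4 + (e / 4 + e / 4) = e - e / 4 by field.
by rewrite gerBl ltW.
Qed.

End UniformApproximation.

(** * Ghost projections and rigidity *)

Lemma half_pow_small (R : realType) (e : R) : 0 < e -> exists N : nat, (2^-1 : R) ^+ N < e.
Proof.
move=> e0; exists (Num.bound e^-1); set N := Num.bound _.
rewrite exprVn -[ltRHS]invrK ltf_pV2 ?posrE ?invr_gt0 ?exprn_gt0//.
apply: (@lt_trans _ _ N%:R); first by apply: archi_boundP; rewrite invr_ge0 ltW.
by rewrite -natrX ltr_nat ltn_expl.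
Qed.

Lemma trunc_vanish (R : realType) (Z : choiceType) (D : nat -> {pred Z}) (x : ell2 R Z) (e : R) :
  (forall z, exists N, forall M, (N <= M)%N -> z \notin D M) -> 0 < e ->
  exists N, forall M, (N <= M)%N -> l2norm (trunc (D M) x) < e.
Proof.
move=> Dz e0; have [s [us Hs]] := tail_small x e0.
have [N HN] : exists N, forall M, (N <= M)%N -> forall z, z \in s -> z \notin D M.
  elim: s {us Hs} => [|z s [N IH]]; first by exists 0%N.
  have [N' HN'] := Dz z; exists (maxn N N') => M; rewrite geq_max => /andP[NM N'M] w.
  by rewrite inE => /orP[/eqP->|]; [exact: HN'|exact: IH].
exists N => M NM; apply: le_lt_trans (Hs (mem s) (fun _ H => H)).
have -> : trunc (D M) x = trunc (D M) (x - trunc (mem s) x).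
  apply: ell2P => z; rewrite !truncE ell2B truncE; case: ifP => // zD.
  rewrite ifF ?subr0//; apply/negP => zs.
  by have := HN _ NM _ zs; rewrite zD.
exact: l2norm_trunc.
Qed.

(** The increments from stage [n] on have norms summing to at most $2^{-n}$, so pointwise vanishing
    of $T_M$ is enough. This is meant for a difference of two tails of projections, neither of which
    is small in norm. *)
Lemma telescoping_opnorm (R : realType) (Z : choiceType) (T r : nat -> bop R Z) :
  (forall n, T n = T n.+1 + r n) ->
  (forall n, opnorm (r n) <= 2^-1 ^+ n.+1) ->
  (forall x e, 0 < e -> exists N, forall M, (N <= M)%N -> l2norm (T M x) < e) ->
  forall n, opnorm (T n) <= 2^-1 ^+ n.
Proof.
move=> Tr rn Tx n; have h0 m : 0 <= (2^-1 : R) ^+ m by rewrite exprn_ge0// invr_ge0.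
apply: opnorm_leP => // x.
have step k : l2norm (T n x) <= l2norm (T (n + k)%N x) + (2^-1 ^+ n - 2^-1 ^+ (n + k)) * l2norm x.
  elim: k => [|k IH]; first by rewrite addn0 subrr mul0r addr0.
  apply: le_trans IH _; rewrite {1}Tr bopDE addnS.
  apply: le_trans (lerD (l2normD _ _) (lexx _)) _; rewrite -addrA lerD2l.
  rewrite -lerBrDr -mulrBl; apply: le_trans (opnormP _ _) _.
  rewrite ler_wpM2r ?l2norm_ge0//; apply: le_trans (rn _) _.
  rewrite le_eqVlt; apply/orP; left; apply/eqP.
  by rewrite exprS; set u := _ ^+ n; set v := _ ^+ (n + k); field.
apply/ler_addgt0Pl => e e0; have [N HN] := Tx x e e0.
apply: le_trans (step N) _; apply: lerD; first by apply/ltW/HN; rewrite leq_addl.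
by rewrite ler_wpM2r ?l2norm_ge0// gerBl.
Qed.

(** * Projections onto vectors with disjoint supports *)

Section BlockProjection.
Context {R : realType} {Y : choiceType} (s : nat -> seq Y).
Context (zeta : nat -> ell2 R Y) (idx : Y -> nat).
Hypothesis idxP : forall n y, y \in s n -> idx y = n.
Hypothesis zeta_supp : forall n y, zeta n y != 0 -> y \in s n.
Hypothesis zeta_unit : forall n, l2norm (zeta n) = 1.

Lemma zeta_idx n y : zeta n y != 0 -> idx y = n.
Proof. by move=> /zeta_supp /idxP. Qed.

Lemma zeta_ortho n m : inner (zeta n) (zeta m) = (n == m)%:R.
Proof.
have [->|nm] := eqVneq n m; first by rewrite inner_xx zeta_unit expr1n.
rewrite -[zeta n]bop1E; apply: inner_supp0 => w z /zeta_idx wn /zeta_idx zm.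
rewrite bop1E deltaE; case: eqP => // zw.
by rewrite -wn -zm zw eqxx in nm.
Qed.

(** The projection $\sum_n\zeta_n\zeta_n^*$. Each coordinate involves a single summand because the
    supports are disjoint, so no infinite sum has to converge; off the supports [idx] is arbitrary,
    but every [zeta n] vanishes there. *)
Lemma block_ex : exists q : bop R Y,
  (forall x z, q x z = inner x (zeta (idx z)) * zeta (idx z) z) /\ opnorm q <= 1.
Proof.
apply: bop_ex => //; first by move=> c x y z; rewrite innerDl innerZl; ring.
move=> x t ut; rewrite mul1r.
pose ns := undup (map idx t); have uns : uniq ns by exact: undup_uniq.
apply: le_trans (bessel x uns zeta_ortho).
apply: (@le_trans _ _ (\sum_(z <- t) \sum_(n <- ns) abs2 (inner x (zeta n)) * abs2 (zeta n z))).
  rewrite big_seq [leRHS]big_seq; apply: ler_sum => z zt.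
  have nz : idx z \in ns by rewrite mem_undup map_f.
  rewrite (bigD1_seq (idx z))//= abs2M lerDl; apply: sumr_ge0 => n _.
  by rewrite mulr_ge0 ?abs2_ge0.
rewrite exchange_big; apply: ler_sum => n _; rewrite -mulr_sumr.
rewrite ler_piMr ?abs2_ge0//; apply: le_trans (l2norm_sum_le _ ut) _.
by rewrite zeta_unit expr1n.
Qed.

Context (q : bop R Y).
Hypothesis qE : forall x z, q x z = inner x (zeta (idx z)) * zeta (idx z) z.

Lemma block_entry w z : q (delta w) z = conjc (zeta (idx z) w) * zeta (idx z) z.
Proof. by rewrite qE inner_deltal. Qed.

Lemma block_entryC w z : q (delta w) z = conjc (q (delta z) w).
Proof.
rewrite !block_entry rmorphM /= conjcK.
have [->|wz] := eqVneq (idx w) (idx z); first by rewrite mulrC.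
have [->|/zeta_idx zw] := eqVneq (zeta (idx z) w) 0; last by rewrite zw eqxx in wz.
have [->|/zeta_idx zw] := eqVneq (zeta (idx w) z) 0; last by rewrite zw eqxx in wz.
by rewrite conjc0 !mul0r.
Qed.

Lemma block_adj : is_adjoint q q.
Proof. by apply: is_adjoint_entries => w z; exact: block_entryC. Qed.

Lemma block_zeta n : q (zeta n) = zeta n.
Proof.
apply: ell2P => z; rewrite qE zeta_ortho.
have [->|nz] := eqVneq n (idx z); first by rewrite mul1r.
by rewrite mul0r; apply/esym/eqP; apply: contra_neqT nz => /zeta_idx.
Qed.

Lemma block_idem : q * q = q.
Proof.
by apply: bopP => x; apply: ell2P => z; rewrite bopME !(qE _ z) block_adj block_zeta.
Qed.

Lemma block_supp x z : q x z != 0 -> z \in s (idx z).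
Proof. by rewrite qE mulf_eq0 negb_or => /andP[_ /zeta_supp]. Qed.

(** The tail $\sum_{k\ge n}\zeta_k\zeta_k^*$, obtained by cutting coordinates. *)
Definition block_tail n : bop R Y := proj [pred z | (n <= idx z)%N] * q.

Lemma block_tailS n : block_tail n = block_tail n.+1 + rk1 (zeta n) (zeta n).
Proof.
apply: bopP => x; apply: ell2P => z.
rewrite bopDE ell2D !bopME !projE !truncE !inE qE rk1E ell2Z.
rewrite [(n <= _)%N]leq_eqVlt; have [->|nz] := eqVneq n (idx z).
  by rewrite ltnn add0r.
rewrite /= [zeta n z](_ : _ = 0) ?mulr0 ?addr0//.
by apply/eqP; apply: contra_neqT nz => /zeta_idx.
Qed.

Lemma block_tail0 : block_tail 0 = q.
Proof.
by apply: bopP => x; apply: ell2P => z; rewrite bopME projE truncE inE leq0n.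
Qed.

Lemma block_tail_sum n : q = block_tail n + \sum_(i < n) rk1 (zeta i) (zeta i).
Proof.
elim: n => [|n IH]; first by rewrite big_ord0 addr0 block_tail0.
by rewrite big_ord_recr [LHS]IH block_tailS -addrA [rk1 _ _ + _]addrC.
Qed.

Lemma block_tail_vanish x (e : R) : 0 < e ->
  exists N, forall M, (N <= M)%N -> l2norm (block_tail M x) < e.
Proof.
move=> e0.
have [|N HN] := @trunc_vanish R Y (fun n => [pred z | (n <= idx z)%N]) (q x) e _ e0.
  by move=> z; exists (idx z).+1 => M; rewrite inE -ltnNge.
by exists N => M /HN; rewrite bopME projE.
Qed.

End BlockProjection.

(** Uniform smallness is played against finiteness: if all coordinates of $\xi_x$ are below
    $e/(|F|+1)$, its part on the finite set [F] of forbidden points has norm at most $e$, and the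
    support can be moved off [F]. *)
Lemma ghostly_sequence (R : realType) (X : Type) (Y : metricType R) (xi : X -> ell2 R Y) :
  uniformly_locally_finite Y ->
  (forall d : R, 0 < d -> exists x, forall y, cabs (xi x y) < d) ->
  exists (x : nat -> X) (s : nat -> seq Y),
  [/\ forall n, uniq (s n),
      forall m n, (m < n)%N -> forall y y', y \in s m -> y' \in s n -> n%:R < mdist y y',
      forall n y, cabs (xi (x n) y) < n.+1%:R^-1
    & forall n, l2norm (xi (x n) - trunc (mem (s n)) (xi (x n))) <= 2^-1 ^+ (n + 3)].
Proof.
move=> ulfY small.
have /choice[bs bsP] : forall n : nat, exists bs : Y -> seq Y,
    forall z w, (w \in bs z) = (mdist z w <= n%:R).
  by move=> n; have [N [bs H]] := ulf_ball n%:R ulfY; exists bs => z; have [] := H z.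
pose step (i : nat * seq Y) (o : X * seq Y) :=
  [/\ uniq o.2, forall y, y \in o.2 -> y \notin i.2,
      forall y, cabs (xi o.1 y) < i.1.+1%:R^-1
    & l2norm (xi o.1 - trunc (mem o.2) (xi o.1)) <= 2^-1 ^+ (i.1 + 3)].
have /choice[next nextP] : forall i, exists o, step i o.
  move=> [n F0]; pose F := undup F0; pose e : R := 2^-1 ^+ (n + 3) / 2.
  have e0 : 0 < e by rewrite divr_gt0// exprn_gt0// invr_gt0.
  pose d : R := Num.min n.+1%:R^-1 (e / (size F).+1%:R).
  have d0 : 0 < d by rewrite lt_min invr_gt0 ltr0Sn divr_gt0.
  have [x xd] := small d d0; have [t [ut Ht]] := tail_small (xi x) e0.
  exists (x, [seq y <- t | y \notin F]); split => /=.
  - exact: filter_uniq.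
  - by move=> y; rewrite mem_filter mem_undup => /andP[].
  - by move=> y; apply: lt_le_trans (xd y) _; rewrite ge_min lexx.
  have -> : xi x - trunc (mem [seq y <- t | y \notin F]) (xi x) =
      (xi x - trunc (mem (F ++ t)) (xi x)) + trunc (mem F) (xi x).
    apply: ell2P => y; rewrite !ell2D !ell2N !trunc_seqE mem_filter mem_cat.
    by case: (y \in F); case: (y \in t); rewrite /= ?subrr ?subr0 ?add0r ?addr0.
  have -> : 2^-1 ^+ (n + 3) = e + e by rewrite /e -splitr.
  apply: le_trans (l2normD _ _) _; apply: lerD.
    by apply/ltW/Ht => y yt; change (y \in F ++ t); rewrite mem_cat yt orbT.
  rewrite trunc_sum ?undup_uniq//; apply: le_trans (l2norm_sum _ _) _.
  apply: (@le_trans _ _ (\sum_(y <- F) e / (size F).+1%:R)).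
    apply: ler_sum => y _; rewrite l2normcZ l2norm_delta mulr1.
    by apply/ltW/(lt_le_trans (xd y)); rewrite ge_min lexx orbT.
  rewrite big_const_seq count_predT iter_addr_0 -[leLHS]mulr_natl mulrCA ger_pMr//.
  by rewrite ler_pdivrMr// mul1r ler_nat.
(* [F n] contains every point within distance [n] of an earlier support; the growing radii drive the
   supports apart. *)
pose F := fix F n := if n is m.+1 then
  flatten [seq bs m.+1 y | y <- F m ++ (next (m, F m)).2] else [::].
pose s n := (next (n, F n)).2.
have FP n : forall m, (m < n)%N -> forall y y', y \in s m -> mdist y y' <= n%:R -> y' \in F n.
  elim: n => [//|n IH] m; rewrite ltnS leq_eqVlt => mn y y' ym dyy.
  apply/flattenP; exists (bs n.+1 y); last by rewrite bsP.
  apply: map_f; rewrite mem_cat; case/orP: mn => [/eqP<-|mn].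
    by rewrite -/(s m) ym orbT.
  by rewrite (IH m mn y y ym)// mdistxx.
exists (fun n => (next (n, F n)).1), s; split.
- by move=> n; have [] := nextP (n, F n).
- move=> m n mn y y' ym yn; rewrite ltNge; apply/negP => /(FP n m mn y y' ym).
  by apply/negP; have [_ H _ _] := nextP (n, F n); exact: H.
- by move=> n; have [] := nextP (n, F n).
- by move=> n; have [] := nextP (n, F n).
Qed.

(** A cluster point would be within $1/2$ of two distinct terms, which are at least 1 apart. *)
Lemma noncompact_fixed_sequence (R : realType) (Z : choiceType) (a : bop R Z)
    (eta : nat -> ell2 R Z) :
  (forall n, l2norm (eta n) <= 1) -> (forall n, a (eta n) = eta n) ->
  (forall n m, n != m -> 1 <= l2norm (eta n - eta m)) -> ~ compact_op a.
Proof.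
move=> eta1 aeta sep; rewrite /compact_op => cK.
set K := closure _ in cK.
have etaK n : K (eta n).
  apply: subset_closure; exists (eta n) => //=.
  by rewrite ell2_normE -[1]/(1%:C) lecR.
have [|v [_ vc]] := cK (eta @ \oo) _ _; first by exists 0%N => // n _; exact: etaK.
have ballV : nbhs v (ball v (2^-1 : R)%:C).
  by apply: nbhsx_ballx; rewrite ltcR invr_gt0.
have meet (N : nat) : exists2 n, (N <= n)%N & l2norm (v - eta n) < 2^-1.
  have [] := vc [set eta n | n in [set n | (N <= n)%N]] _ _ ballV.
    by exists N => // n /= Nn; exists n.
  move=> _ [[n Nn <-]]; rewrite -ball_normE /= ell2_normE ltcR => H.
  by exists n.
have [n _ vn] := meet 0%N; have [m nm vm] := meet n.+1.
have := sep n m; rewrite ltn_eqF// => /(_ isT); apply/negP; rewrite -ltNge.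
have -> : eta n - eta m = (v - eta m) - (v - eta n) by rewrite opprB [RHS]addrC addrA subrK.
apply: le_lt_trans (l2normB _ _) _.
by rewrite [ltRHS]splitr div1r ltrD.
Qed.

(** * Compression of operators to a subspace *)

Section Compression.
Context {R : realType} {Y : metricType R} (Z : set Y).
Local Notation V := (set_type Z).

Definition ext_fun (x : V -> R[i]) (y : Y) : R[i] := oapp x 0 (insub y).

Lemma ext_ex (x : ell2 R V) : exists u : ell2 R Y,
  (forall y, u y = ext_fun x y) /\ l2norm u <= l2norm x.
Proof.
apply: ell2_ex; first exact: l2norm_ge0.
move=> t ut.
have us : uniq (pmap insub t : seq V) by exact: pmap_sub_uniq.
apply: le_trans (l2norm_sum_le x us).
elim: t {ut us} => [|y t IH]; first by rewrite !big_nil.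
rewrite big_cons /= /ext_fun; case: insubP => [v _ _|_] /=.
  by rewrite big_cons lerD2l.
by rewrite abs2_0 add0r.
Qed.

Definition ext (x : ell2 R V) : ell2 R Y := projT1 (cid (ext_ex x)).

Lemma extE x y : ext x y = ext_fun x y.
Proof. by rewrite /ext; case: cid => ? []. Qed.

Lemma ext_val x (v : V) : ext x (val v) = x v.
Proof. by rewrite extE /ext_fun valK. Qed.

Lemma ext_out x y : ~ Z y -> ext x y = 0.
Proof. by move=> nZ; rewrite extE /ext_fun insubF//; apply/negP => /set_mem. Qed.

Lemma l2norm_ext x : l2norm (ext x) <= l2norm x.
Proof. by rewrite /ext; case: cid => ? []. Qed.

Lemma ell2_YP (u w : ell2 R Y) : (forall v : V, u (val v) = w (val v)) ->
  (forall y, ~ Z y -> u y = w y) -> u = w.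
Proof.
move=> H1 H2; apply: ell2P => y; have [Zy|] := pselect (Z y); last exact: H2.
have [v <-] : exists v : V, val v = y by exists (SigSub (mem_set Zy)).
exact: H1.
Qed.

Lemma ext_linear c x x' : ext (c *: x + x') = c *: ext x + ext x'.
Proof.
apply: ell2_YP => [v|y nZ]; rewrite ell2D ell2Z.
  by rewrite !ext_val.
by rewrite !ext_out// mulr0 addr0.
Qed.

Lemma ext_delta v : ext (delta v) = delta (val v).
Proof.
apply: ell2_YP => [u|y nZ]; first by rewrite ext_val !deltaE (inj_eq val_inj).
rewrite ext_out// deltaE; case: eqP => // yv.
by case: nZ; rewrite yv; apply: set_mem; exact: valP.
Qed.

Lemma restr_ex (u : ell2 R Y) : exists x : ell2 R V,
  (forall v, x v = u (val v)) /\ l2norm x <= l2norm u.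
Proof.
apply: ell2_ex; first exact: l2norm_ge0.
move=> t ut; have uy : uniq (map val t) by rewrite map_inj_uniq//; exact: val_inj.
by have := l2norm_sum_le u uy; rewrite big_map.
Qed.

Definition restr (u : ell2 R Y) : ell2 R V := projT1 (cid (restr_ex u)).

Lemma restrE u v : restr u v = u (val v).
Proof. by rewrite /restr; case: cid => ? []. Qed.

Lemma l2norm_restr u : l2norm (restr u) <= l2norm u.
Proof. by rewrite /restr; case: cid => ? []. Qed.

Lemma ext_restr (u : ell2 R Y) : (forall y, u y != 0 -> Z y) -> ext (restr u) = u.
Proof.
move=> uZ; apply: ell2_YP => [v|y nZ]; first by rewrite ext_val restrE.
by rewrite ext_out//; apply/esym/eqP; apply: contrapT => uy; apply/nZ/uZ/negP.
Qed.

Lemma compress_ex (a : bop R Y) : exists b : bop R V,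
  (forall x v, b x v = a (ext x) (val v)) /\ opnorm b <= opnorm a.
Proof.
apply: bop_ex; first exact: opnorm_ge0.
  by move=> c x y z; rewrite ext_linear bopD bopZ.
move=> x t ut.
have uy : uniq (map val t) by rewrite map_inj_uniq//; exact: val_inj.
have := l2norm_sum_le (a (ext x)) uy; rewrite big_map => /le_trans; apply.
rewrite ler_sqr ?nnegrE ?mulr_ge0 ?l2norm_ge0 ?opnorm_ge0//.
by apply: le_trans (opnormP _ _) _; rewrite ler_wpM2l ?opnorm_ge0 ?l2norm_ext.
Qed.

Definition compress (a : bop R Y) : bop R V := projT1 (cid (compress_ex a)).

Lemma compressE a x v : compress a x v = a (ext x) (val v).
Proof. by rewrite /compress; case: cid => ? []. Qed.

Lemma opnorm_compress a : opnorm (compress a) <= opnorm a.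
Proof. by rewrite /compress; case: cid => ? []. Qed.

Lemma compress_entry a (v w : V) : compress a (delta v) w = a (delta (val v)) (val w).
Proof. by rewrite compressE ext_delta. Qed.

Lemma compress_roe a : uniform_roe Y a -> uniform_roe V (compress a).
Proof.
move=> /uniform_roeP ra; apply/uniform_roeP => e /ra [b [s [sb ab]]].
exists (compress b), s; split; first by move=> v w; rewrite compress_entry => /sb.
apply: le_lt_trans ab; have -> : compress a - compress b = compress (a - b).
  by apply: bopP => x; apply: ell2P => v; rewrite bopBE ell2B !compressE bopBE ell2B.
exact: opnorm_compress.
Qed.

End Compression.

#[global] Opaque ext restr compress.

(** * The sparse space formed by the supports *)

Section SparseSupports.
Context {R : realType} {Y : metricType R} (s : nat -> seq Y).
Hypothesis s_far : forall m n, (m < n)%N ->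
  forall y y', y \in s m -> y' \in s n -> n%:R < mdist y y'.
Hypothesis s_neq0 : forall n, exists y, y \in s n.

Lemma supports_disjoint n m y : y \in s n -> y \in s m -> n = m.
Proof.
wlog nm : n m / (n < m)%N => [hw yn ym|yn ym].
  by have [/hw->|/hw<-|] := ltngtP n m.
by have := s_far nm yn ym; rewrite mdistxx ltNge ler0n.
Qed.

Lemma supports_far n m y y' : n != m -> y \in s n -> y' \in s m ->
  (maxn n m)%:R <= mdist y y'.
Proof.
rewrite neq_ltn => /orP[nm|mn] yn ym.
  by rewrite (maxn_idPr (ltnW nm)); exact/ltW/(s_far nm).
by rewrite (maxn_idPl (ltnW mn)) metric_sym; exact/ltW/(s_far mn).
Qed.

Let Z : set Y := [set y | exists n, y \in s n].

Lemma sparse_supports : sparse (set_type Z).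
Proof.
exists (fun n => [set z | val z \in s n]); split.
- move=> n; split.
    apply: (@finite_preimage _ _ [set` s n] val); last exact: finite_seq.
    by move=> u v _ _; exact: val_inj.
  have [y ys] := s_neq0 n; have Zy : Z y by exists n.
  by exists (SigSub (mem_set Zy)).
- by move=> n m _ _ [z [/= zn zm]]; exact: supports_disjoint zn zm.
- apply/seteqP; split=> // z _.
  by have [n zn] := set_mem (valP z); exists n.
(* The distance is bounded below by the larger index, which is at least half of $n+m$. *)
- move=> M; exists (Num.bound `|M|).*2 => n m nm Nnm.
  apply: lb_le_inf.
    have [y ys] := s_neq0 n; have Zy : Z y by exists n.
    have [y' ys'] := s_neq0 m; have Zy' : Z y' by exists m.
    by eexists; exists (SigSub (mem_set Zy), SigSub (mem_set Zy')).
  move=> _ [[u v] [/= un vm] <-]; apply: le_trans (supports_far nm un vm).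
  apply: le_trans (ler_norm M) _; apply: le_trans (ltW (archi_boundP (normr_ge0 M))) _.
  rewrite ler_nat -leq_double; apply: leq_trans Nnm _.
  by rewrite -addnn leq_add// ?leq_maxl ?leq_maxr.
Qed.

Lemma finite_initial_supports N :
  finite_set [set z : set_type Z | exists2 n, (n < N)%N & val z \in s n].
Proof.
have -> : [set z : set_type Z | exists2 n, (n < N)%N & val z \in s n] =
    val @^-1` [set` flatten [seq s n | n <- iota 0 N]].
  apply/seteqP; split => z /=.
    move=> [n nN zn]; apply/flattenP; exists (s n) => //.
    by apply: map_f; rewrite mem_iota.
  by move=> /flattenP [_ /mapP[n + ->]]; rewrite mem_iota => nN zn; exists n.
apply: finite_preimage; last exact: finite_seq.
by move=> u v _ _; exact: val_inj.
Qed.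

End SparseSupports.

(** * Uniform lower bound on the largest coordinates *)

Section Rigidity.
Context {R : realType} {X Y : metricType R} (Phi : bop R X -> bop R Y).
Hypothesis Phi_hom : star_homomorphism (uniform_roe X) (uniform_roe Y) Phi.
Hypothesis Phi_inj : set_inj (uniform_roe X) Phi.
Hypothesis Phi_her : hereditary_subalgebra (Phi @` uniform_roe X) (uniform_roe Y).
Context (xi : X -> ell2 R Y).
Hypothesis xi_ortho : forall x x', inner (xi x) (xi x') = (x == x')%:R.
Hypothesis xi_units : forall x x', Phi (rk1 (delta x) (delta x')) = rk1 (xi x) (xi x').

Local Notation ana := (ana xi_ortho).

(** Pairing $y=\Phi(P_D)w$ with itself gives $\langle P_DU^*w,U^*y\rangle$. Hence the images of
    diagonal projections tend to zero pointwise as [D] decreases to the empty set. *)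
Lemma l2norm_Phi_proj (D : {pred X}) w :
  l2norm (Phi (proj D) w) <= l2norm (trunc D (ana w)).
Proof.
set y := Phi (proj D) w.
have [->|y0] := eqVneq (l2norm y) 0; first exact: l2norm_ge0.
have yp : 0 < l2norm y by rewrite lt_neqAle eq_sym y0 l2norm_ge0.
rewrite -(ler_pM2r yp) -expr2 -[_ ^+ 2]cabs_real ?sqr_ge0// -inner_xx.
rewrite {1}/y (inner_Phi Phi_hom Phi_inj Phi_her xi_ortho xi_units); last exact: proj_roe.
rewrite projE; apply: le_trans (cauchy_schwarz _ _) _.
by rewrite ler_wpM2l ?l2norm_ge0// l2norm_ana.
Qed.

Lemma opnorm_rk1_diff (u v : ell2 R Y) : l2norm u <= 1 -> l2norm v <= 1 ->
  opnorm (rk1 u u - rk1 v v) <= 2 * l2norm (u - v).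
Proof.
move=> u1 v1; have -> : rk1 u u - rk1 v v = rk1 (u - v) u + rk1 v (u - v).
  by rewrite rk1Bl rk1Br addrA subrK.
apply: le_trans (opnormD _ _) _; rewrite mulr_natl mulr2n; apply: lerD.
  by apply: le_trans (opnorm_rk1 _ _) _; rewrite ler_piMr ?l2norm_ge0.
by apply: le_trans (opnorm_rk1 _ _) _; rewrite ler_piMl ?l2norm_ge0.
Qed.

(* The block projection differs from the image under [Phi] of a diagonal
   projection by compact terms of summable norm. *)
Lemma block_roe (x : nat -> X) (s : nat -> seq Y) (zeta : nat -> ell2 R Y) (idx : Y -> nat)
    (q : bop R Y) :
  injective x ->
  (forall n y, y \in s n -> idx y = n) ->
  (forall n y, zeta n y != 0 -> y \in s n) ->
  (forall n, l2norm (zeta n) = 1) ->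
  (forall n, l2norm (zeta n - xi (x n)) <= 2^-1 ^+ n.+2) ->
  (forall u z, q u z = inner u (zeta (idx z)) * zeta (idx z) z) ->
  uniform_roe Y q.
Proof.
move=> x_inj idxP zeta_supp zeta1 near_xi qE.
pose D n : {pred X} := [pred u | `[< exists2 k, (n <= k)%N & u = x k >]].
have DS n : proj (D n) = proj (D n.+1) + rk1 (delta (x n)) (delta (x n)) :> bop R X.
  apply: bopP => u; apply: ell2P => z.
  rewrite bopDE ell2D !projE !truncE rk1E inner_delta ell2Z deltaE.
  have [->|zn] := eqVneq z (x n).
    rewrite ifT ?ifF ?add0r ?mulr1//; last by apply/asboolP; exists n.
    by apply/negP => /asboolP[k nk /x_inj kn]; rewrite kn ltnn in nk.
  rewrite mulr0 addr0; congr (if _ then _ else _).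
  apply/asboolP/asboolP => -[k nk zk]; exists k => //; last exact: ltnW.
  by rewrite ltn_neqAle nk andbT; apply: contra_neq zn => ->.
pose p n := Phi (proj (D n)).
have pS n : p n = p n.+1 + rk1 (xi (x n)) (xi (x n)).
  by rewrite /p DS (PhiD Phi_hom) ?xi_units//; [exact: proj_roe|exact: rk1_roe].
have p_vanish w e : 0 < e -> exists N, forall M, (N <= M)%N -> l2norm (p M w) < e.
  move=> e0; have [|N HN] := @trunc_vanish R X D (ana w) e _ e0.
    move=> z; have [[k ->]|nk] := pselect (exists k, z = x k).
      exists k.+1 => M kM; apply/negP => /asboolP[j Mj /x_inj kj].
      by rewrite -kj leqNgt kM in Mj.
    by exists 0%N => M _; apply/negP => /asboolP[k _ zk]; apply: nk; exists k.
  by exists N => M /HN; apply: le_lt_trans; exact: l2norm_Phi_proj.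
have q_vanish := block_tail_vanish idx q.
(* Both tails lose one rank-one term per step, and these terms differ by at most $2^{-n-1}$, twice
   the distance of their unit vectors. *)
pose T n := block_tail idx q n - p n.
have Tn n : opnorm (T n) <= 2^-1 ^+ n.
  apply: (@telescoping_opnorm _ _ T (fun n => rk1 (zeta n) (zeta n) - rk1 (xi (x n)) (xi (x n)))).
  - move=> k; rewrite /T (block_tailS idxP zeta_supp qE) pS.
    by rewrite opprD addrACA.
  - move=> k; apply: le_trans (opnorm_rk1_diff _ _) _; rewrite ?zeta1 ?(l2norm_xi xi_ortho)//.
    apply: (@le_trans _ _ (2 * 2^-1 ^+ k.+2)); first by rewrite ler_wpM2l.
    by rewrite [2^-1 ^+ k.+2]exprS mulrA divff ?mul1r// pnatr_eq0.
  - move=> w e e0; have e2 : 0 < e / 2 by rewrite divr_gt0.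
    have [N1 H1] := q_vanish w _ e2; have [N2 H2] := p_vanish w _ e2.
    exists (maxn N1 N2) => M; rewrite geq_max => /andP[/H1 h1 /H2 h2].
    by rewrite bopBE; apply: le_lt_trans (l2normB _ _) _; rewrite [ltRHS]splitr ltrD.
apply: uniform_roe_lim => e e0; have [N eN] := half_pow_small e0.
exists (p N + \sum_(i < N) rk1 (zeta i) (zeta i)); split.
  apply: uniform_roeD; first by apply: (Phi_roe Phi_hom); exact: proj_roe.
  by apply: uniform_roe_sum => i; exact: rk1_roe.
rewrite {1}(block_tail_sum idxP zeta_supp qE N) opprD addrACA subrr addr0.
exact: le_lt_trans (Tn N) eN.
Qed.

Hypothesis ulfY : uniformly_locally_finite Y.
Hypothesis sparse_ghosts : forall Z : set Y, sparse (set_type Z) ->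
  only_compact_ghost_projections (set_type Z).

Lemma rigidity : exists2 d : R, 0 < d & forall x, exists y, d <= cabs (xi x y).
Proof.
apply: contrapT => noD.
have small d : 0 < d -> exists x, forall y, cabs (xi x y) < d.
  move=> d0; apply: contrapT => nx; apply: noD; exists d => // x.
  apply: contrapT => ny; apply: nx; exists x => y; rewrite ltNge.
  by apply/negP => dy; apply: ny; exists y.
have [x [s [us s_far xi_small xi_s]]] := ghostly_sequence ulfY small.
have xi1 u : l2norm (xi u) = 1 by exact: (l2norm_xi xi_ortho).
pose t n := trunc (mem (s n)) (xi (x n)); pose nu n := l2norm (t n).
have nu_le1 n : nu n <= 1 by apply: le_trans (l2norm_trunc _ _) _; rewrite xi1.
have h0 m : 0 < (2^-1 : R) ^+ m by rewrite exprn_gt0// invr_gt0.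
have h8 n : (2^-1 : R) ^+ (n + 3) <= 8^-1.
  rewrite exprD (_ : 2^-1 ^+ 3 = 8^-1 :> R); last by rewrite !exprS expr0; field.
  apply: ler_piMl; first by rewrite invr_ge0 ler0n.
  by apply: exprn_ile1; rewrite ?invr_ge0 ?ler0n// invf_le1 ?ltr0n// ler1n.
have nu_ge n : 1 - 2^-1 ^+ (n + 3) <= nu n.
  have := l2normD (xi (x n) - t n) (t n); rewrite subrK xi1 addrC => le.
  by rewrite lerBlDr; apply: le_trans le _; rewrite lerD2l; exact: xi_s.
have nu_half n : 2^-1 <= nu n by apply: le_trans (nu_ge n); have := h8 n; lra.
have nu0 n : 0 < nu n by apply: lt_le_trans (nu_half n); rewrite invr_gt0.
pose zeta n := (nu n)^-1%:C *: t n.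
have zeta_supp n y : zeta n y != 0 -> y \in s n.
  by rewrite ell2Z trunc_seqE; case: ifP => // _; rewrite mulr0 eqxx.
have zeta1 n : l2norm (zeta n) = 1.
  by rewrite l2normcZ cabs_real ?invr_ge0 ?ltW// mulVf// gt_eqF.
(* Normalising costs at most the same $2^{-n-3}$ as truncating. *)
have near_xi n : l2norm (zeta n - xi (x n)) <= 2^-1 ^+ n.+2.
  have -> : zeta n - xi (x n) = (zeta n - t n) - (xi (x n) - t n).
    by rewrite opprB addrA subrK.
  apply: le_trans (l2normB _ _) _.
  have -> : (2^-1 : R) ^+ n.+2 = 2^-1 ^+ (n + 3) + 2^-1 ^+ (n + 3).
    by rewrite addn3 [2^-1 ^+ n.+3]exprS; set u := _ ^+ n.+2; field.
  apply: lerD; last exact: xi_s.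
  have -> : zeta n - t n = ((nu n)^-1 - 1)%:C *: t n.
    by rewrite rmorphB rmorph1 scalerBl scale1r.
  rewrite l2normcZ cabs_real; last by rewrite subr_ge0 invf_ge1// nu_le1.
  by rewrite mulrBl mulVf ?gt_eqF// mul1r lerBlDr addrC -lerBlDr; exact: nu_ge.
have s_neq0 n : exists y, y \in s n.
  apply: contrapT => ny; have : t n = 0.
    by apply: ell2P => y; rewrite trunc_seqE ifF//; apply/negP => ys; apply: ny; exists y.
  by move=> tn; have := nu0 n; rewrite /nu tn l2norm0 ltxx.
have disj := supports_disjoint s_far.
have /choice[idx idxP'] : forall y, exists k, forall n, y \in s n -> k = n.
  move=> y; have [[k yk]|nk] := pselect (exists k, y \in s k).
    by exists k => n yn; exact: disj yk yn.
  by exists 0%N => n yn; case: nk; exists n.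
have idxP n y : y \in s n -> idx y = n by exact: idxP'.
(* A repeated vector would have norm at least $1/2$ on [s n] but at most $1/8$ off [s m], and these
   supports are disjoint. *)
have x_inj : injective x.
  suff x_lt n m : (n < m)%N -> x n <> x m.
    move=> n m xnm; have [nm|mn|//] := ltngtP n m.
      by case: (x_lt n m nm).
    by case: (x_lt m n mn).
  move=> nm xnm; have : t n = trunc (mem (s n)) (xi (x m) - t m).
    apply: ell2P => y; rewrite !trunc_seqE ell2B trunc_seqE xnm; case: ifP => // yn.
    by rewrite ifF ?subr0//; apply/negP => /(disj _ _ _ yn) nm'; rewrite nm' ltnn in nm.
  move=> /(congr1 (@l2norm R Y)) tn.
  have : nu n <= 8^-1.
    by rewrite /nu tn; apply: le_trans (l2norm_trunc _ _) (le_trans (xi_s m) (h8 m)).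
  by have := nu_half n; lra.
have [q [qE _]] := block_ex idxP zeta_supp zeta1.
have rq := block_roe x_inj idxP zeta_supp zeta1 near_xi qE.
pose Z : set Y := [set y | exists n, y \in s n].
have sZ : sparse (set_type Z) by exact: sparse_supports.
have q_supp u y : q u y != 0 -> Z y.
  by move=> /(block_supp zeta_supp qE) ys; exists (idx y).
have qq : q * q = q := block_idem idxP zeta_supp zeta1 qE.
pose cq := compress Z q.
have zeta_small n y : cabs (zeta n y) < 2 * n.+1%:R^-1.
  rewrite ell2Z cabsM cabs_real ?invr_ge0 ?ltW//.
  apply: (@le_lt_trans _ _ (2 * cabs (t n y))).
    by rewrite ler_wpM2r ?cabs_ge0// invf_ple ?posrE// nu_half.
  rewrite ltr_pM2l// trunc_seqE; case: ifP => _; first exact: xi_small.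
  by rewrite cabs0 invr_gt0.
have gq : ghost cq.
  split; first exact: compress_roe.
  (* An entry is a product of two coordinates of one $\zeta_n$: one factor is at most 1 and the
     other is below $2/(n+1)$, which is at most [e] once $n\ge N$. *)
  move=> e e0; pose N := Num.bound (2 / e).
  exists [set z : set_type Z | exists2 n, (n < N)%N & val z \in s n].
  split; first exact: finite_initial_supports.
  move=> z w _ wF; rewrite cabsE ltcR inner_delta compress_entry.
  rewrite (block_entry qE) cabsM cabsJ.
  have [n wn] : Z (val w) by apply: set_mem; exact: valP.
  rewrite (idxP _ _ wn).
  have Nn : (N <= n)%N by rewrite leqNgt; apply/negP => nN; apply: wF; exists n.
  apply: le_lt_trans (_ : cabs (zeta n (val w)) < _).
    rewrite ler_piMl ?cabs_ge0//; apply: le_trans (coord_le _ _) _.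
    by rewrite zeta1.
  apply: lt_le_trans (zeta_small _ _) _; rewrite ler_pdivrMr ?ltr0Sn// mulrC -ler_pdivrMr//.
  apply: ltW; apply: lt_le_trans (archi_boundP _) _; first by rewrite divr_ge0// ltW.
  by rewrite ler_nat; apply: leq_trans Nn _.
have pq : projection cq.
  split.
    apply: bopP => u; apply: ell2P => v; rewrite bopME !compressE.
    have -> : ext (cq u) = q (ext u).
      rewrite (_ : cq u = restr Z (q (ext u))); last first.
        by apply: ell2P => w; rewrite compressE restrE.
      by apply: ext_restr => y; exact: q_supp.
    by rewrite -bopME qq.
  apply: is_adjoint_entries => v w; rewrite !compress_entry.
  exact: (block_entryC idxP zeta_supp qE).
pose eta n := restr Z (zeta n).
have ext_eta n : ext (eta n) = zeta n.
  by apply: ext_restr => y /zeta_supp yn; exists n.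
apply: (@noncompact_fixed_sequence R _ cq eta); last exact: sparse_ghosts.
- by move=> n; apply: le_trans (l2norm_restr _ _) _; rewrite zeta1.
- move=> n; apply: ell2P => v; rewrite compressE ext_eta.
  by rewrite (block_zeta idxP zeta_supp zeta1 qE) restrE.
- move=> n m nm; apply: le_trans (_ : l2norm (zeta n - zeta m) <= _).
    rewrite -[leLHS]ger0_norm// -ler_sqr ?nnegrE ?normr_ge0 ?l2norm_ge0//.
    rewrite normr1 expr1n l2norm_sqrD l2normN innerNr !zeta1.
    rewrite (zeta_ortho idxP zeta_supp zeta1) (negbTE nm) oppr0 /= mulr0 addr0.
    by rewrite expr1n lerDl.
  have -> : zeta n - zeta m = ext (eta n - eta m).
    by rewrite addrC -scaleN1r -!ext_eta -ext_linear scaleN1r addrC.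
  exact: l2norm_ext.
Qed.

End Rigidity.

(** * Hall's theorem for infinite families *)

Section Hall.
Context {X Y : choiceType}.
Import finmap.
Local Open Scope fset_scope.
Implicit Types (A : X -> {fset Y}) (F : {fset X}) (G : {fset Y}).

(** Letting [G] be any finite set containing the [A x] avoids forming their union. *)
Definition hall_condition A := forall F G,
  (forall x, x \in F -> A x `<=` G) -> (#|` F| <= #|` G|)%N.

Let refines A B := forall x, A x `<=` B x.

(** The intersection of the chain, attained pointwise: a member with fewest elements at [x] is
    smallest there because the sets are finite. For finitely many points a single member of the
    chain lies below, and Hall's condition is inherited from it. *)
Let chain_bound (A0 : X -> {fset Y}) (C : set (X -> {fset Y})) :
  hall_condition A0 ->
  (forall A, C A -> hall_condition A /\ refines A A0) ->
  (forall A B, C A -> C B -> refines A B \/ refines B A) ->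
  exists B, [/\ hall_condition B, refines B A0 & forall A, C A -> refines B A].
Proof.
move=> hA0 CP Ctot; have [[A1 CA1]|nC] := pselect (exists A, C A); last first.
  by exists A0; split => // A CA; case: nC; exists A.
have /choice[M MP] : forall x, exists A, C A /\ forall A', C A' -> A x `<=` A' x.
  move=> x; pose P n := `[< exists A, C A /\ #|` A x| = n >].
  have exP : exists n, P n by exists #|` A1 x|; apply/asboolP; exists A1.
  case: (ex_minnP exP) => n /asboolP[A [CA An]] nmin; exists A; split => // A' CA'.
  have [/(_ x)//|A'A] := Ctot _ _ CA CA'.
  have -> : A' x = A x.
    apply/eqP; rewrite eqEfcard A'A An; apply: nmin.
    by apply/asboolP; exists A'.
  exact: fsubset_refl.
exists (fun x => M x x); split.
- move=> F G FG.
  have [A [CA AM]] : exists A, C A /\ forall x, x \in enum_fset F -> A x `<=` M x x.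
    elim: (enum_fset F) => [|x s [A [CA IH]]]; first by exists A1.
    have [CM _] := MP x; have [AM|MA] := Ctot _ _ CA CM.
      by exists A; split => // z; rewrite inE => /orP[/eqP->|/IH].
    exists (M x); split => // z; rewrite inE => /orP[/eqP->//|/IH].
    by apply: fsubset_trans; exact: MA.
  have [hA _] := CP _ CA; apply: hA => x xF.
  by apply: fsubset_trans (FG x xF); exact: AM.
- by move=> x; have [CM _] := MP x; have [_] := CP _ CM; exact.
- by move=> A CA x; have [_] := MP x; exact.
Qed.

(* Rado: in a minimal family satisfying Hall's condition, two distinct elements
   [y1, y2] of [A x] would give finite witnesses of failure for [A x - y1] and
   [A x - y2], and counting unions and intersections of these contradicts
   Hall's condition for [A]. *)
Lemma hall_choice A0 : hall_condition A0 ->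
  exists f : X -> Y, injective f /\ forall x, f x \in A0 x.
Proof.
move=> hA0.
pose T := {A : X -> {fset Y} | hall_condition A /\ refines A A0}.
(* Larger means finer here, so a maximal element is a minimal family. *)
have [||||m Amin'] := @Zorn T (fun u v : T => `[< refines (projT1 v) (projT1 u) >]).
- by move=> A; apply/asboolP => x; exact: fsubset_refl.
- move=> A B C /asboolP BA /asboolP CB; apply/asboolP => x.
  exact: fsubset_trans (CB x) (BA x).
- move=> [A PA] [B PB] /= /asboolP BA /asboolP AB; apply: eq_exist.
  by apply/funext => x; apply/eqP; rewrite eqEfsubset AB BA.
- move=> C Ctot.
  have [|_ _ [u Cu <-] [v Cv <-]|B [hB BA0 BC]] := @chain_bound A0 [set projT1 u | u in C] hA0.
  + by move=> _ [[A PA] _ <-].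
  + by have [/asboolP|/asboolP] := Ctot _ _ Cu Cv; [right|left].
  + by exists (exist _ B (conj hB BA0)) => u Cu; apply/asboolP/BC; exists u.
case: m Amin' => A [hA AA0] Amin'.
have Amin (u : T) : refines (projT1 u) A -> u = exist _ A (conj hA AA0).
  by move=> uA; apply: Amin'; apply/asboolP.
have single x : exists y, A x = [fset y].
  have A1 : (0 < #|` A x|)%N.
    by have := hA [fset x] (A x); rewrite cardfs1; apply => z; rewrite inE => /eqP->.
  have [y yA] : exists y, y \in A x by move: A1; rewrite cardfs_gt0 => /fset0Pn.
  exists y; apply/eqP; rewrite eq_sym eqEfsubset fsub1set yA /=.
  apply/fsubsetP => y' y'A; rewrite inE; apply: contrapT => /negP y'y.
  have bad z : z \in A x -> exists F G, [/\ (#|` G| < #|` F|)%N, x \in F,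
      A x `\ z `<=` G & forall u, u \in F -> u != x -> A u `<=` G].
    move=> zA; pose Az u := if u == x then A x `\ z else A u.
    have AzA : refines Az A.
      by move=> u; rewrite /Az; case: eqP => [->|_]; rewrite ?fsubD1set ?fsubsetU1 ?fsubset_refl.
    have nh : ~ hall_condition Az.
      move=> hAz; have AzA0 : refines Az A0 by move=> u; exact: fsubset_trans (AzA u) (AA0 u).
      have := Amin (exist _ Az (conj hAz AzA0)) AzA => /(congr1 (fun u : T => projT1 u)) /= AE.
      have : Az x = A x by rewrite AE.
      by rewrite /Az eqxx => AxE; move: zA; rewrite -AxE !inE eqxx.
    have /existsNP[F /existsNP[G /not_implyP[FG /negP]]] := nh.
    rewrite -ltnNge => GF.
    have FG' u : u \in F -> u != x -> A u `<=` G.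
      by move=> uF ux; have := FG u uF; rewrite /Az (negbTE ux).
    have xF : x \in F.
      apply: contraLR GF => xF; rewrite -leqNgt; apply: (hA _ _) => u uF; apply: FG' => //.
      by apply: contraNneq xF => <-.
    by exists F, G; split => //; have := FG x xF; rewrite /Az eqxx.
  have [F1 [G1 [GF1 xF1 Ax1 FG1]]] := bad _ yA.
  have [F2 [G2 [GF2 xF2 Ax2 FG2]]] := bad _ y'A.
  have hU : (#|` F1 `|` F2| <= #|` G1 `|` G2|)%N.
    apply: (hA _ _) => u; have [->|ux] := eqVneq u x => [_|].
      apply/fsubsetP => z zA; rewrite inE; have [zy|zy] := eqVneq z y.
        apply/orP; right; apply: (fsubsetP Ax2); rewrite !inE zA andbT zy.
        by rewrite eq_sym.
      by apply/orP; left; apply: (fsubsetP Ax1); rewrite !inE zA zy.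
    rewrite inE => /orP[/FG1|/FG2] /(_ ux) sub; apply: fsubset_trans sub _.
      exact: fsubsetUl.
    exact: fsubsetUr.
  have hI : (#|` (F1 `&` F2) `\ x| <= #|` G1 `&` G2|)%N.
    apply: (hA _ _) => u; rewrite !inE => /and3P[ux u1 u2].
    by rewrite fsubsetI FG1 ?FG2.
  (* The witnesses give $|F_1|+|F_2|\ge|G_1|+|G_2|+2$, whereas [hU] and [hI] allow an excess of only
     1, for the point [x] removed from the intersection. *)
  have := cardfsUI F1 F2; have := cardfsUI G1 G2.
  have := cardfsD1 x (F1 `&` F2); rewrite inE xF1 xF2 /=.
  by move: hU hI GF1 GF2; lia.
have /choice[f fE] := single.
exists f; split; last by move=> x; apply: (fsubsetP (AA0 x)); rewrite fE inE.
move=> x x' fx; apply/eqP; apply: contrapT => /negP xx'.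
have := hA [fset x; x'] [fset f x]; rewrite cardfs1 cardfs2 xx' => H.
suff : (2 <= 1)%N by [].
apply: H => z; rewrite !inE => /orP[]/eqP->; rewrite fE ?fx fsubset_refl//.
Qed.

End Hall.

(** * The coarse embedding *)

Lemma coarse_embedding_bounds (R : realType) (X Y : metricType R) (f : X -> Y) :
  (forall r, exists s, forall x x', mdist x x' <= r -> mdist (f x) (f x') <= s) ->
  (forall s, exists r, forall x x', mdist (f x) (f x') <= s -> mdist x x' <= r) ->
  coarse_embedding f.
Proof.
move=> up lo.
(* The adjoined 0 and [t] keep the sets nonempty when no pair of points qualifies, as for [Dm] in a
   bounded space; the infimum can still tend to infinity because [t] does. *)
pose Dp t := [set mdist (f p.1) (f p.2) | p in [set p : X * X | mdist p.1 p.2 <= t]] `|` [set 0].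
pose Dm t := [set mdist (f p.1) (f p.2) | p in [set p : X * X | t <= mdist p.1 p.2]] `|` [set t].
have Dp_sup t : has_sup (Dp t).
  split; first by exists 0; right.
  have [s Hs] := up t; exists (Num.max s 0) => _ [[p /= pt <-]|->]; last first.
    by rewrite le_max lexx orbT.
  by rewrite le_max Hs.
have Dm_lb t : 0 <= t -> lbound (Dm t) 0.
  by move=> t0 _ [[p _ <-]|->]; rewrite ?mdist_ge0.
have Dm_inf t : 0 <= t -> has_inf (Dm t).
  by move=> t0; split; [exists t; right|exists 0; exact: Dm_lb].
exists (fun t => inf (Dm t)), (fun t => sup (Dp t)); split.
- move=> t t0; split.
    by apply: lb_le_inf; [exists t; right|exact: Dm_lb].
  by apply: sup_upper_bound; [exact: Dp_sup|right].
- move=> s t s0 st; apply: lb_le_inf; first by exists t; right.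
  move=> _ [[p /= tp <-]|->].
    apply: (ge_inf (Dm_inf s s0).2); left; exists p => //.
    exact: le_trans st tp.
  by apply: le_trans st; apply: (ge_inf (Dm_inf s s0).2); right.
- move=> s t s0 st; apply: ge_sup; first by exists 0; right.
  move=> _ [[p /= sp <-]|->]; apply: sup_upper_bound => //; last by right.
  by left; exists p => //; exact: le_trans sp st.
- apply/cvgryPge => M; have [r Hr] := lo M.
  exists (Num.max M (Num.max r 0)); split; first exact: num_real.
  move=> t; rewrite !gt_max => /and3P[Mt rt t0].
  apply: lb_le_inf; first by exists t; right.
  move=> _ [[p /= tp <-]|->]; last exact: ltW.
  by rewrite leNgt; apply/negP => /ltW/Hr; rewrite leNgt (lt_le_trans rt tp).
move=> x x'; split.
  apply: (ge_inf (Dm_inf _ (mdist_ge0 x x')).2); left.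
  by exists (x, x') => /=.
by apply: sup_upper_bound => //; left; exists (x, x') => /=.
Qed.

Lemma kernel_combination (K : fieldType) (X Y : eqType) (xi : X -> Y -> K)
    (s : seq X) (t : seq Y) : uniq s -> (size t < size s)%N ->
  exists zeta : X -> K, (exists2 x, x \in s & zeta x != 0) /\
    forall y, y \in t -> \sum_(x <- s) zeta x * xi x y = 0.
Proof.
move=> us ts.
pose M := \matrix_(i < size s, j < size t) xi (tnth (in_tuple s) i) (tnth (in_tuple t) j).
have : kermx M != 0.
  rewrite kermx_eq0 /row_free neq_ltn; apply/orP; left.
  by apply: leq_ltn_trans ts; exact: rank_leq_col.
move=> /rowV0Pn [v /sub_kermxP vM v0].
pose zeta x := if insub (index x s) is Some i then v ord0 i else 0.
have zetaE (i : 'I_(size s)) : zeta (tnth (in_tuple s) i) = v ord0 i.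
  rewrite /zeta; case: insubP => [j _|]; last first.
    by rewrite index_mem mem_tnth.
  rewrite [tnth _ _](tnth_nth (tnth (in_tuple s) i)) index_uniq// => /val_inj -> //.
exists zeta; split.
  have [i vi] : exists i, v ord0 i != 0.
    apply/existsP; apply: contraNT v0; rewrite negb_exists => /forallP v0.
    apply/eqP/rowP => i; rewrite mxE; apply/eqP.
    by have := v0 i; rewrite negbK.
  by exists (tnth (in_tuple s) i); [exact: mem_tnth|rewrite zetaE].
move=> y /(tnthP (in_tuple t)) [j ->].
rewrite big_tnth; transitivity ((v *m M) ord0 j); last by rewrite vM mxE.
by rewrite mxE; apply: eq_bigr => i _; rewrite zetaE mxE.
Qed.

(* The average over independent signs of the double sum is its diagonal part. *)
Lemma sign_choice (R : realType) (X : eqType) (m : X -> X -> R[i]) (s : seq X) (c : R[i]) :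
  uniq s -> exists sg : X -> R[i], (forall x, sg x = 1 \/ sg x = -1) /\
    cabs (c + \sum_(x <- s) m x x) <=
    cabs (c + \sum_(x <- s) \sum_(x' <- s) sg x * sg x' * m x x').
Proof.
elim: s c => [|x s IH] c.
  by exists (fun=> 1); split; [left|rewrite !big_nil].
move=> /= /andP[xs us]; have [sg [sg1 le]] := IH (c + m x x) us.
pose L := \sum_(x' <- s) sg x' * (m x x' + m x' x).
pose A := c + m x x + \sum_(x1 <- s) \sum_(x2 <- s) sg x1 * sg x2 * m x1 x2.
(* [A] is the midpoint of [A + L] and [A - L], so one of them has modulus at least that of [A]. The
   induction fixes one sign at a time, with [c] collecting diagonal terms. *)
have [e [e1 eA]] : exists e : R[i], (e = 1 \/ e = -1) /\ cabs A <= cabs (A + e * L).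
  apply: contrapT => H.
  have lt e : e = 1 \/ e = -1 -> cabs (A + e * L) < cabs A.
    by move=> e1; rewrite ltNge; apply/negP => le'; apply: H; exists e.
  have := lt 1 (or_introl erefl); have := lt (-1) (or_intror erefl).
  have := cabsD (A + 1 * L) (A + (-1) * L).
  have -> : A + 1 * L + (A + (-1) * L) = (2 : R)%:C * A by rewrite rmorphMn /= ; ring.
  rewrite cabsM cabs_real//; move: (cabs _) (cabs _) (cabs _) => a b d; lra.
exists (fun x' => if x' == x then e else sg x'); split.
  by move=> x'; case: eqP.
rewrite !big_cons eqxx addrA; apply: le_trans le _; apply: le_trans eA _.
rewrite le_eqVlt; apply/orP; left; apply/eqP; congr cabs.
have ee : e * e = 1 by case: e1 => ->; rewrite ?mulrNN mulr1.
have nx x' : x' \in s -> (x' == x) = false.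
  by move=> x's; apply/negbTE; apply: contraNneq xs => <-.
rewrite ee mul1r /A /L.
have -> : \sum_(j <- s) e * (if j == x then e else sg j) * m x j =
          e * \sum_(j <- s) sg j * m x j.
  by rewrite mulr_sumr; apply: eq_big_seq => j /nx ->; ring.
have -> : \sum_(j <- s) \sum_(x' <- (x :: s))
    (if j == x then e else sg j) * (if x' == x then e else sg x') * m j x' =
  e * (\sum_(j <- s) sg j * m j x) + \sum_(x1 <- s) \sum_(x2 <- s) sg x1 * sg x2 * m x1 x2.
  rewrite mulr_sumr -big_split; apply: eq_big_seq => j /nx -> /=.
  rewrite big_cons eqxx; congr (_ + _); first by ring.
  by apply: eq_big_seq => k /nx ->.
have -> : \sum_(x' <- s) sg x' * (m x x' + m x' x) =
    \sum_(j <- s) sg j * m x j + \sum_(j <- s) sg j * m j x.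
  by rewrite -big_split; apply: eq_bigr => j _; rewrite mulrDr.
by ring.
Qed.

Lemma diag_op_ex (R : realType) (X : metricType R) (s : seq X) (sg : X -> R[i]) :
  uniq s -> (forall x, cabs (sg x) <= 1) -> exists a : bop R X,
  [/\ fprop 0 a, forall w z, cabs (a (delta w) z) <= 1
    & forall u v, inner (a u) v = \sum_(x <- s) sg x * u x * conjc (v x)].
Proof.
move=> us sg1; pose a : bop R X := \sum_(x <- s) sg x *: rk1 (delta x) (delta x).
have aE w z : a (delta w) z = if (w == z) && (w \in s) then sg w else 0.
  rewrite bop_sumE ell2_sum; under eq_bigr do rewrite bopZE rk1E inner_delta !ell2Z !deltaE.
  have [ws|ws] := boolP (w \in s); last first.
    rewrite andbF big1_seq// => x /andP[_ xs]; case: eqP => [xw|_]; last by rewrite mul0r mulr0.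
    by rewrite -xw xs in ws.
  rewrite andbT (bigD1_seq w)//= eqxx mul1r big1 ?addr0 => [|x xw]; last first.
    by rewrite (negbTE xw) mul0r mulr0.
  by rewrite eq_sym; case: eqP; rewrite ?mulr1 ?mulr0.
exists a; split.
- move=> w z; rewrite aE; have [->|_] := eqVneq w z; first by rewrite mdistxx.
  by rewrite /= eqxx.
- by move=> w z; rewrite aE; case: ifP => _; rewrite ?cabs0.
- move=> u v; rewrite bop_sumE inner_suml; apply: eq_bigr => x _.
  by rewrite bopZE rk1E inner_delta innerZl innerZl inner_deltal mulrA.
Qed.

Lemma matrix_unit_band (R : realType) (X : metricType R) (x x' : X) :
  let a := rk1 (delta x') (delta x) : bop R X in
  [/\ fprop (mdist x x') a, forall w z, cabs (a (delta w) z) <= 1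
    & forall u v, inner (a u) v = u x * conjc (v x')].
Proof.
split=> [w z|w z|u v].
- rewrite rk1E inner_delta ell2Z !deltaE mulf_eq0 negb_or !pnatr_eq0 !eqb0 !negbK.
  by move=> /andP[/eqP<- /eqP->].
- rewrite rk1E inner_delta ell2Z !deltaE.
  by do 2!case: eqP => _; rewrite ?mulr1 ?mulr0 ?cabs1 ?cabs0.
- by rewrite rk1E inner_delta innerZl inner_deltal.
Qed.

(** * Bounds and Hall's condition for the concentration map *)

Section CoarseMap.
Context {R : realType} {X Y : metricType R} (Phi : bop R X -> bop R Y).
Hypothesis Phi_hom : star_homomorphism (uniform_roe X) (uniform_roe Y) Phi.
Hypothesis Phi_inj : set_inj (uniform_roe X) Phi.
Hypothesis Phi_her : hereditary_subalgebra (Phi @` uniform_roe X) (uniform_roe Y).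
Context (xi : X -> ell2 R Y).
Hypothesis xi_ortho : forall x x', inner (xi x) (xi x') = (x == x')%:R.
Hypothesis xi_units : forall x x', Phi (rk1 (delta x) (delta x')) = rk1 (xi x) (xi x').
Hypothesis ulfX : uniformly_locally_finite X.
Hypothesis ulfY : uniformly_locally_finite Y.
Context (d : R) (f : X -> Y).
Hypothesis d0 : 0 < d.
Hypothesis fP : forall x, d <= cabs (xi x (f x)).

Local Notation ana := (ana xi_ortho).

Let Phi_approx := @equi_approximable R X Y (ell2 R Y) id ana ulfX (l2norm_ana xi_ortho)
  (fun r a ra => ex_intro _ (Phi a) (conj (Phi_roe Phi_hom (fprop_roe ra))
     (fun v w => inner_Phi Phi_hom Phi_inj Phi_her xi_ortho xi_units v w (fprop_roe ra)))).

(** [compression] takes an adjoint as data; for finite propagation the conjugate transpose is a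
    kernel to which [band_ex] applies. *)
Lemma band_adjoint r (a : bop R Y) : fprop r a -> exists2 b, is_adjoint a b & uniform_roe Y b.
Proof.
move=> ra; have [M [M0 HM]] := band_ex r ulfY (opnorm_ge0 a).
have [||b [bE _]] := HM (fun w z => conjc (a (delta z) w)).
- by move=> w z; rewrite conjc_eq0 => /ra; rewrite metric_sym.
- move=> w z; rewrite cabsJ; apply: le_trans (coord_le _ _) _.
  by apply: le_trans (opnormP _ _) _; rewrite l2norm_delta mulr1.
exists b; first by apply: is_adjoint_entries => w z; rewrite bE conjcK.
by apply: (@fprop_roe _ _ r) => w z; rewrite bE conjc_eq0 => /ra; rewrite metric_sym.
Qed.

Lemma compression_approx r (e : R) : 0 < e -> exists s, forall a : bop R Y,
  fprop r a -> (forall w z, cabs (a (delta w) z) <= 1) ->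
  forall x x', s < mdist x x' -> cabs (inner (a (xi x)) (xi x')) <= e.
Proof.
move=> e0; have [||s Hs] := @equi_approximable R Y X X delta xi ulfY _ _ r e e0.
- by move=> x; rewrite (l2norm_xi xi_ortho) l2norm_delta.
- move=> r' a ra; have [b ab rb] := band_adjoint ra.
  have [c rc cE] := compression Phi_hom Phi_her xi_ortho xi_units (fprop_roe ra) rb ab.
  by exists c; split => // x x'; rewrite inner_delta cE.
exists s => a ra a1 x x' sx; apply: Hs => //; rewrite ?l2norm_delta// => w z.
by rewrite !deltaE !pnatr_eq0 !eqb0 !negbK => /eqP-> /eqP->.
Qed.

Let dd_half : d ^+ 2 / 2 < d ^+ 2.
Proof. by rewrite ltr_pdivrMr// mulr_natr mulr2n ltrDl exprn_gt0. Qed.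

Let dd_half0 : 0 < d ^+ 2 / 2.
Proof. by rewrite divr_gt0// exprn_gt0. Qed.

(** Transported to $Y$, the matrix unit from [x] to [x'] pairs [delta (f x)] with [delta (f x')] to
    a number of modulus at least $d^2$, above the tolerance $d^2/2$, so these points cannot lie
    beyond the common scale. *)
Lemma concentration_upper r :
  exists s, forall x x', mdist x x' <= r -> mdist (f x) (f x') <= s.
Proof.
have [s Hs] := Phi_approx r dd_half0; exists s => x x' xx'; rewrite leNgt; apply/negP => far.
have [ra a1 aE] := matrix_unit_band x x'.
have := Hs _ (fprop_mono xx' ra) a1 (delta (f x)) (delta (f x')).
rewrite !l2norm_delta aE !anaE !inner_deltal cabsM !cabsJ.
move=> /(_ (lexx _) (lexx _)) H; have : d ^+ 2 <= d ^+ 2 / 2.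
  apply: le_trans (H _).
    by rewrite expr2; apply: ler_pM; rewrite ?fP// ltW.
  by move=> w z; rewrite !deltaE !pnatr_eq0 !eqb0 !negbK => /eqP-> /eqP->.
by apply/negP; rewrite -ltNge.
Qed.

(** The same test in the other direction, with the matrix unit from [f x] to [f x'] compressed to
    $X$. *)
Lemma concentration_lower s :
  exists r, forall x x', mdist (f x) (f x') <= s -> mdist x x' <= r.
Proof.
have [r Hr] := compression_approx s dd_half0; exists r => x x' fxx'.
rewrite leNgt; apply/negP => far.
have [ra a1 aE] := matrix_unit_band (f x) (f x').
have := Hr _ (fprop_mono fxx' ra) a1 x x' far; rewrite aE cabsM cabsJ => H.
have : d ^+ 2 <= d ^+ 2 / 2.
  by apply: le_trans H; rewrite expr2; apply: ler_pM; rewrite ?fP// ltW.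
by apply/negP; rewrite -ltNge.
Qed.

(** Bessel's inequality for [delta y]: each point of the fibre contributes at least $d^2$ to a sum
    bounded by 1. *)
Lemma fiber_bound y (s : seq X) : uniq s -> (forall x, x \in s -> f x = y) ->
  (size s)%:R <= d ^- 2.
Proof.
move=> us fs; rewrite -[leRHS]mul1r ler_pdivlMr ?exprn_gt0//.
apply: le_trans (_ : l2norm (delta y : ell2 R Y) ^+ 2 <= _); last first.
  by rewrite l2norm_delta expr1n.
apply: le_trans (bessel (delta y) us xi_ortho).
rewrite mulr_natl -[leLHS]iter_addr_0 -[size s](count_predT s) -big_const_seq.
rewrite big_seq [leRHS]big_seq; apply: ler_sum => x xs.
rewrite inner_deltal abs2_conj -cabs_sqr ler_sqr ?nnegrE ?cabs_ge0 ?(ltW d0)//.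
by rewrite -(fs x xs).
Qed.

(** So $V$ has norm at most $d^{-1}$: cross terms occur only within fibres, where $ab\le(a^2+b^2)/2$
    and the fibre bound apply. *)
Lemma l2norm_pushforward (s : seq X) (c : X -> R[i]) : uniq s ->
  l2norm (\sum_(x <- s) c x *: (delta (f x) : ell2 R Y)) ^+ 2 <=
  d ^- 2 * \sum_(x <- s) abs2 (c x).
Proof.
move=> us; set w := \sum_(_ <- _) _.
rewrite -[leLHS]cabs_real ?sqr_ge0// -inner_xx {1}/w inner_suml.
apply: le_trans (cabs_sum _ _) _.
apply: (@le_trans _ _ (\sum_(x <- s) \sum_(x' <- s | f x' == f x)
    (abs2 (c x) / 2 + abs2 (c x') / 2))).
  apply: ler_sum => x _; rewrite innerZl inner_sumr cabsM.
  apply: le_trans (ler_wpM2l (cabs_ge0 _) (cabs_sum _ _)) _.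
  rewrite mulr_sumr [leRHS]big_mkcond; apply: ler_sum => x' _.
  rewrite innerZr inner_delta deltaE cabsM cabsJ eq_sym; case: eqP => _; last first.
    by rewrite cabs0 !mulr0.
  rewrite cabs1 mulr1 -!cabs_sqr; have := sqr_ge0 (cabs (c x) - cabs (c x')).
  by move: (cabs _) (cabs _) => a b; nra.
under eq_bigr do rewrite big_split.
rewrite big_split /=.
rewrite [X in _ + X](_ : _ = \sum_(x <- s) \sum_(x' <- s | f x' == f x) abs2 (c x) / 2).
  rewrite -big_split [leRHS]mulr_sumr; apply: ler_sum => x _.
  rewrite /= -mulr2n -[leLHS]mulr_natl mulr_sumr -big_filter.
  under eq_bigr do rewrite mulrCA divff ?mulr1 ?pnatr_eq0//.
  rewrite big_const_seq count_predT iter_addr_0 -[leLHS]mulr_natl ler_wpM2r ?abs2_ge0//.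
  apply: (@fiber_bound (f x)); first exact: filter_uniq.
  by move=> x'; rewrite mem_filter => /andP[/eqP].
under eq_bigr do rewrite big_mkcond.
rewrite exchange_big; apply: eq_bigr => x _; rewrite [RHS]big_mkcond.
by apply: eq_bigr => x' _; rewrite eq_sym.
Qed.

(* With [c x = sg x * zeta x / conj (xi x (f x))], the diagonal part of
   [sg * ana (sum c x *: delta (f x))] is [zeta], so a vector [sum zeta x *: xi x]
   vanishing near [f s] would pair too strongly with a vector supported on [f s]. *)
Lemma hall_condition_near : exists r, forall (s : seq X) (t : seq Y), uniq s ->
  (forall x y, x \in s -> mdist (f x) y <= r -> y \in t) -> (size s <= size t)%N.
Proof.
(* Propagation 0 suffices for diagonal sign operators; [r] is fixed before [s], [t] and the
   signs. *)
have [r Hr] := Phi_approx 0 dd_half0; exists r => s t us st.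
rewrite leqNgt; apply/negP => lt.
have [zeta0 [[x0 x0s zx0] z0]] := kernel_combination (fun x y => xi x y) us lt.
pose S0 := \sum_(x <- s) abs2 (zeta0 x).
have S0p : 0 < S0.
  rewrite /S0 (bigD1_seq x0)//= ltr_pwDl//; last by apply: sumr_ge0 => x _; exact: abs2_ge0.
  by rewrite -cabs_sqr exprn_gt0// cabs_gt0.
pose zeta x := (Num.sqrt S0)^-1%:C * zeta0 x.
have zeta1 : \sum_(x <- s) abs2 (zeta x) = 1.
  under eq_bigr do rewrite abs2M.
  rewrite -mulr_sumr -cabs_sqr cabs_real ?invr_ge0 ?sqrtr_ge0// exprVn sqr_sqrtr ?ltW//.
  by rewrite mulVf// gt_eqF.
have zt y : y \in t -> \sum_(x <- s) zeta x * xi x y = 0.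
  move=> /z0 zy; under eq_bigr do rewrite -mulrA.
  by rewrite -mulr_sumr zy mulr0.
pose v := \sum_(x <- s) zeta x *: xi x.
have anav x : x \in s -> ana v x = zeta x.
  move=> xs; rewrite anaE inner_suml (bigD1_seq x)//= innerZl xi_ortho eqxx mulr1.
  rewrite big1 ?addr0// => x' x'x; by rewrite innerZl xi_ortho (negbTE x'x) mulr0.
have nv : l2norm v = 1.
  have : (l2norm v ^+ 2)%:C = 1%:C.
    rewrite -inner_xx {2}/v inner_sumr -zeta1 rmorph_sum; apply: eq_big_seq => x xs.
    by rewrite innerZr -anaE anav// mulrC mulJ_abs2.
  by move=> [] /eqP; rewrite sqrp_eq1 ?l2norm_ge0// => /eqP.
have f0 x : xi x (f x) != 0.
  apply/eqP => x0'; have := fP x; rewrite x0' cabs0.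
  by apply/negP; rewrite -ltNge.
(* The diagonal terms are $|\zeta_x|^2$, with sum 1, and the signed double sum is, up to the factor
   $d^2$, the pairing estimated below. *)
pose m x' x := zeta x / conjc (xi x (f x)) * conjc (xi x' (f x)) * conjc (zeta x').
have [sg [sg1 Hsg]] := sign_choice m 0 us.
have sgn x : cabs (sg x) = 1 by case: (sg1 x) => ->; rewrite ?cabsN cabs1.
pose c x := sg x * (zeta x / conjc (xi x (f x))).
pose w : ell2 R Y := \sum_(x <- s) c x *: delta (f x).
(* One factor $d^{-1}$ comes from the pushforward and one from dividing by $\xi_x(f x)$; $d^2$
   compensates both. *)
have nw : l2norm ((d ^+ 2)%:C *: w) <= 1.
  rewrite l2normcZ cabs_real ?sqr_ge0// -ler_sqr ?nnegrE ?mulr_ge0 ?sqr_ge0 ?l2norm_ge0 ?(ltW d0)//.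
  rewrite exprMn expr1n; apply: le_trans (ler_wpM2l (sqr_ge0 _) (l2norm_pushforward _ us)) _.
  apply: (@le_trans _ _ ((d ^+ 2) ^+ 2 * (d ^- 2 * \sum_(x <- s) d ^- 2 * abs2 (zeta x)))).
    apply: ler_wpM2l; first exact: sqr_ge0.
    apply: ler_wpM2l; first by rewrite invr_ge0 sqr_ge0.
    apply: ler_sum => x _.
    rewrite /c (abs2M (sg x)) (abs2M (zeta x)) -(cabs_sqr (sg x)) sgn expr1n.
    rewrite mul1r mulrC ler_wpM2r ?abs2_ge0//.
    rewrite -cabs_sqr cabsV cabsJ exprVn lef_pV2 ?posrE ?exprn_gt0 ?cabs_gt0//.
    by rewrite ler_sqr ?nnegrE ?cabs_ge0 ?(ltW d0).
  rewrite -mulr_sumr zeta1 mulr1 le_eqVlt; apply/orP; left; apply/eqP.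
  by field; rewrite gt_eqF.
have [|a [ra a1 aE]] := diag_op_ex us (sg := sg); first by move=> x; rewrite sgn.
have anaw x : ana ((d ^+ 2)%:C *: w) x = (d ^+ 2)%:C * \sum_(x' <- s) c x' * conjc (xi x (f x')).
  rewrite anaE innerZl inner_suml; congr (_ * _); apply: eq_bigr => x' _.
  by rewrite innerZl inner_deltal.
have := Hr a ra a1 ((d ^+ 2)%:C *: w) v nw; rewrite nv => /(_ (lexx _)) H.
have {}H : cabs (inner (a (ana ((d ^+ 2)%:C *: w))) (ana v)) <= d ^+ 2 / 2.
  apply: H => y z; rewrite ell2Z mulf_eq0 negb_or ell2_sum => /andP[_ wy] vz.
  have [x xs yx] : exists2 x, x \in s & y = f x.
    apply: contrapT => nx; move/eqP: wy; apply; apply: big1_seq => x /andP[_ xs].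
    rewrite ell2Z deltaE; case: eqP => [yx|_]; last by rewrite mulr0.
    by case: nx; exists x.
  rewrite ltNge; apply/negP; rewrite yx => /(st _ _ xs) /zt zz.
  move/eqP: vz; apply; rewrite ell2_sum -[RHS]zz; apply: eq_bigr => x' _.
  by rewrite ell2Z.
have : d ^+ 2 <= cabs (inner (a (ana ((d ^+ 2)%:C *: w))) (ana v)).
  rewrite aE (_ : \sum_(_ <- _) _ =
      (d ^+ 2)%:C * \sum_(x <- s) \sum_(x' <- s) sg x * sg x' * m x x').
    rewrite cabsM cabs_real ?sqr_ge0// ler_peMr ?sqr_ge0//.
    move: Hsg; rewrite !add0r; apply: le_trans.
    rewrite (_ : \sum_(x <- s) m x x = 1%:C) ?cabs1//.
    rewrite -zeta1 rmorph_sum; apply: eq_bigr => x _.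
    by rewrite /m divfK ?conjc_eq0// mulJ_abs2.
  rewrite mulr_sumr; apply: eq_big_seq => x xs.
  rewrite anaw anav// [sg x * _]mulrCA -[LHS]mulrA; congr (_ * _).
  rewrite mulr_sumr mulr_suml; apply: eq_bigr => x' _.
  by rewrite /c /m; ring.
by move=> le; have := le_lt_trans (le_trans le H) dd_half; rewrite ltxx.
Qed.

End CoarseMap.

Theorem theorem1p3 (R : realType) (X Y : metricType R)
    (ulfX : uniformly_locally_finite X) (ulfY : uniformly_locally_finite Y)
    (Phi : bop R X -> bop R Y)
    (Phi_hom : star_homomorphism (uniform_roe X) (uniform_roe Y) Phi)
    (Phi_inj : set_inj (uniform_roe X) Phi)
    (Phi_her : hereditary_subalgebra (Phi @` uniform_roe X) (uniform_roe Y))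
    (sparse_ghosts : forall Z : set Y, sparse (set_type Z) ->
       only_compact_ghost_projections (set_type Z)) :
  exists f : X -> Y, injective f /\ coarse_embedding f.
Proof.
(* The vectors [xi] are transported from a base point, so an empty [X] is treated apart. *)
have [[x0 _]|X0] := pselect (exists x : X, True); last first.
  have /choice[f _] : forall x : X, exists y : Y, True by move=> x; case: X0; exists x.
  exists f; split; first by move=> x; case: X0; exists x.
  by apply: coarse_embedding_bounds => r; exists 0 => x; case: X0; exists x.
have [xi [xi_ortho xi_units]] := matrix_units Phi_hom Phi_inj Phi_her x0.
have [d d0 /choice[f fP]] :=
  rigidity Phi_hom Phi_inj Phi_her xi_ortho xi_units ulfY sparse_ghosts.
have up := concentration_upper Phi_hom Phi_inj Phi_her xi_ortho xi_units ulfX d0 fP.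
have lo := concentration_lower Phi_hom Phi_her xi_ortho xi_units ulfY d0 fP.
have [r Hr] := hall_condition_near Phi_hom Phi_inj Phi_her xi_ortho xi_units ulfX d0 fP.
have [N [bs bsP]] := ulf_ball r ulfY.
have [|g [g_inj gA]] := @hall_choice X Y (fun x => finmap.seq_fset tt (bs (f x))).
  move=> F G FG; apply: Hr; first exact: finmap.fset_uniq.
  move=> x y xF dxy; apply: (finmap.fsubsetP (FG x xF)).
  by rewrite finmap.seq_fsetE; have [_ -> _] := bsP (f x).
(* At distance at most [r] from [f], the injective choice inherits both bounds at the cost of
   $2r$. *)
have gf x : mdist (f x) (g x) <= r.
  by have := gA x; rewrite finmap.seq_fsetE; have [_ -> _] := bsP (f x).
exists g; split => //; apply: coarse_embedding_bounds => [t|t].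
  have [s Hs] := up t; exists (r + (s + r)) => x x' /Hs le.
  apply: le_trans (metric_triangle _ (f x) _) _; apply: lerD; first by rewrite metric_sym.
  by apply: le_trans (metric_triangle _ (f x') _) _; apply: lerD.
have [s Hs] := lo (r + (t + r)); exists s => x x' le; apply: Hs.
apply: le_trans (metric_triangle _ (g x) _) _; apply: lerD => //.
by apply: le_trans (metric_triangle _ (g x') _) _; apply: lerD => //; rewrite metric_sym.
Qed.
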